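(* Let $k,d\in\mathbb{N}$ (positive integers) with $(d,k)\neq(1,1)$ and let $T_0>0$. Let $0<\rho\le 1$, and let $\lambda,\gamma$ satisfy $0<\lambda<\gamma\le 1$ and $\gamma+\lambda>1$. Assume that a real-valued continuous function $w\in C([0,T_0];\mathbb{R})$ is $(\rho,\gamma)$-irregular on $[0,T_0]$. Then for any $s>s(\rho):=\frac d2-\frac{\rho}{k}$ and any $\psi\in H^s(\mathbb{T}^d)$, there exists $T=T(\|\psi\|_{H^s},\|\Phi^w\|_{\mathcal{W}^{\rho,\gamma}_{T_0}})\in(0,T_0)$ such that there exists a solution $u\in C^\lambda([0,T];H^s(\mathbb{T}^d))$ to the Young integral equation $$u(t)=\psi+\int_0^t X_{d\tau}(u(\tau)),\qquad 0\le t\le T.$$ Moreover, $u$ is the unique solution to this equation (with datum $\psi$) that belongs to $C^\lambda([0,T];H^s(\mathbb{T}^d))$. Finally, for every $R>0$, taking a common time $T=T(R,\|\Phi^w\|_{\mathcal{W}^{\rho,\gamma}_{T_0}})\in(0,T_0)$ for all data in the ball of $H^s(\mathbb{T}^d)$ with radius $R$ centered at the origin, the solution map $\psi\mapsto u$ is continuous from this ball into $C^\lambda([0,T];H^s(\mathbb{T}^d))$.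
   Context: $\mathbb{T}^d=(\mathbb{R}/2\pi\mathbb{Z})^d$; $\hat\varphi(n)$, $n\in\mathbb{Z}^d$, are the Fourier coefficients of $\varphi:\mathbb{T}^d\to\mathbb{C}$; $\langle n\rangle=(1+|n|^2)^{1/2}$; $\|\varphi\|_{H^s}=\|\langle n\rangle^s\hat\varphi(n)\|_{\ell^2(\mathbb{Z}^d_n)}$. Irregularity. Let $\rho>0$, $0<\gamma\le1$, $T_0>0$. A function $w\in C([0,T_0];\mathbb{R})$ is $(\rho,\gamma)$-irregular on $[0,T_0]$ if $$\|\Phi^w\|_{\mathcal{W}^{\rho,\gamma}_{T_0}}:=\sup_{a\in\mathbb{R}}\ \sup_{0\le s<t\le T_0}(1+|a|)^\rho\,\frac{|\Phi^w_t(a)-\Phi^w_s(a)|}{|t-s|^\gamma}<\infty,\qquad \Phi^w_t(a)=\int_0^t e^{iaw(r)}\,dr.$$ The operator $X$. Define $U^{w}(t)\varphi=\sum_{n\in\mathbb{Z}^d}e^{in\cdot x-i|n|^2w(t)}\hat\varphi(n)$ and $U^{-w}(t)=(U^w(t))^{-1}$ (that is, $w$ is replaced by $-w$). Let $$\mathcal{N}(\varphi_1,\dots,\varphi_{2k+1})=\Big(\prod_{j=1}^{k+1}\varphi_{2j-1}\Big)\prod_{l=1}^{k}\overline{\varphi_{2l}},$$ $$X_t(\varphi_1,\dots,\varphi_{2k+1})=-i\int_0^t U^{-w}(\tau)\,\mathcal{N}\big(U^w(\tau)\varphi_1,\dots,U^w(\tau)\varphi_{2k+1}\big)\,d\tau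 .$$ This is initially defined for sufficiently regular functions (e.g. in $H^{s_1}(\mathbb{T}^d)$, $s_1>d/2$). On $H^s(\mathbb{T}^d)$ with $s>\frac d2-\frac\rho k$, $X_t$ denotes its (unique, by density) bounded multilinear extension $H^s\times\cdots\times H^s\to H^s$, where ''multilinear'' allows conjugate-linearity in some of the slots; with these extensions, $t\mapsto X_t$ is $\gamma$-Hölder continuous in the multilinear operator norm. Write $X_{s;t}=X_t-X_s$ and $X_t(\varphi)=X_t(\varphi,\dots,\varphi)$. Young integral. For $g_1,\dots,g_{2k+1}\in C^\lambda([0,T];H^s(\mathbb{T}^d))$ with $\gamma+\lambda>1$, $$\int_0^tX_{d\tau}(g_1(\tau),\dots,g_{2k+1}(\tau)):=\lim_{\delta_t\to0}\sum_{j=0}^{n-1}X_{t_j;t_{j+1}}(g_1(t_j),\dots,g_{2k+1}(t_j))\quad\text{in }H^s(\mathbb{T}^d),$$ where $0=t_0<t_1<\dots<t_n=t$ is a partition of $[0,t]$ and $\delta_t=\max_{1\le j\le n}|t_j-t_{j-1}|$ (the limit exists and is independent of the partitions). The notation $\int_0^tX_{d\tau}(u(\tau))$ means all $g_j=u$. Hölder spaces. For a Banach space $U$, $C^\lambda([0,T];U)$ is the space of $\lambda$-Hölder continuous functions $f:[0,T]\to U$, equipped with the norm $\sup_{0\le t\le T}\|f(t)\|_U+\sup_{0\le s<t\le T}\frac{\|f(t)-f(s)\|_U}{|t-s|^\lambda}$. *)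

(* Defs.v *)
From mathcomp Require Import all_boot all_order all_algebra.
From mathcomp Require Import all_classical all_reals all_analysis.
From mathcomp Require Import complex.

Set Implicit Arguments.
Unset Strict Implicit.
Unset Printing Implicit Defensive.

Import Order.TTheory GRing.Theory Num.Theory.
Import numFieldNormedType.Exports.

Local Open Scope classical_set_scope.
Local Open Scope ring_scope.
Local Open Scope complex_scope.

(* [Normc.normc] is the real-valued modulus; the norm of R[i] takes values in R[i]. *)

Definition cexpi (R : realType) (x : R) : R[i] := cos x +i* sin x.

Definition cintegral (R : realType) (a b : R) (f : R -> R[i]) : R[i] :=
  Rintegral lebesgue_measure `[a, b] (fun x => complex.Re (f x)) +i*
  Rintegral lebesgue_measure `[a, b] (fun x => complex.Im (f x)).

(* Unconditional sum over a countable index type; only meaningful for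
   absolutely summable families. *)
Definition rsum (R : realType) (I : choiceType) (f : I -> R) : R :=
  fine (\esum_(i in [set: I]) (Num.max (f i) 0)%:E) -
  fine (\esum_(i in [set: I]) (Num.max (- f i) 0)%:E).

Definition csum (R : realType) (I : choiceType) (f : I -> R[i]) : R[i] :=
  rsum (fun i => complex.Re (f i)) +i* rsum (fun i => complex.Im (f i)).

(* Frequencies are integer row vectors, and a function (or distribution) on the
   torus is represented by its family of Fourier coefficients. *)
Notation fcoefs R d := ('rV[int]_d -> R[i]).

Definition sqfreq (R : realType) (d : nat) (n : 'rV[int]_d) : R :=
  \sum_(i < d) ((n 0 i)%:~R) ^+ 2.

Definition dotfreq (R : realType) (d : nat) (n : 'rV[int]_d) (x : 'rV[R]_d) : R :=
  \sum_(i < d) (n 0 i)%:~R * x 0 i.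

Definition japanese (R : realType) (d : nat) (n : 'rV[int]_d) : R :=
  Num.sqrt (1 + sqfreq R n).

Definition Hs_sqnorm (R : realType) (d : nat) (s : R) (phi : fcoefs R d) : \bar R :=
  \esum_(n in [set: 'rV[int]_d])
    ((japanese R n `^ s * Normc.normc (phi n)) ^+ 2)%:E.

Definition in_Hs (R : realType) (d : nat) (s : R) (phi : fcoefs R d) : Prop :=
  (Hs_sqnorm s phi < +oo)%E.

Definition Hs_norm (R : realType) (d : nat) (s : R) (phi : fcoefs R d) : R :=
  Num.sqrt (fine (Hs_sqnorm s phi)).

Definition fourier_series (R : realType) (d : nat) (phi : fcoefs R d)
    (x : 'rV[R]_d) : R[i] :=
  csum (fun n => cexpi (dotfreq n x) * phi n).

(* Iterated integral over the fundamental domain [0, 2 pi]^d. *)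
Fixpoint torus_integral (R : realType) (d : nat) :
    ('rV[R]_d -> R[i]) -> R[i] :=
  match d with
  | 0 => fun f => f 0
  | d'.+1 => fun f => cintegral 0 (2 * pi) (fun x =>
      torus_integral (fun y : 'rV[R]_d' => f (row_mx (x%:M : 'rV[R]_1) y)))
  end.

Definition fourier_coef (R : realType) (d : nat) (f : 'rV[R]_d -> R[i]) :
    fcoefs R d :=
  fun n => (((2 * pi) ^+ d)^-1)%:C *
    torus_integral (fun x => cexpi (- dotfreq n x) * f x).

Definition Phi (R : realType) (w : R -> R) (t a : R) : R[i] :=
  cintegral 0 t (fun r => cexpi (a * w r)).

Definition irr_enorm (R : realType) (rho gamma T0 : R) (w : R -> R) : \bar R :=
  ereal_sup [set y : \bar R | exists a s t : R, [/\ 0 <= s, s < t, t <= T0 &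
    y = ((1 + `|a|) `^ rho *
         (Normc.normc (Phi w t a - Phi w s a) / `|t - s| `^ gamma))%:E]].

Definition irr_norm (R : realType) (rho gamma T0 : R) (w : R -> R) : R :=
  fine (irr_enorm rho gamma T0 w).

Definition irregular (R : realType) (rho gamma T0 : R) (w : R -> R) : Prop :=
  (irr_enorm rho gamma T0 w < +oo)%E.

Definition Uop (R : realType) (d : nat) (w : R -> R) (t : R) (phi : fcoefs R d) :
    fcoefs R d :=
  fun n => cexpi (- (sqfreq R n * w t)) * phi n.

(* Slots are numbered from 0, so phi_1, phi_3, ... sit in the even slots. *)
Definition nonlin (R : realType) (k : nat) (A : Type)
    (f : 'I_(k.*2.+1) -> A -> R[i]) (x : A) : R[i] :=
  (\prod_(j < k.*2.+1 | ~~ odd j) f j x) *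
  (\prod_(j < k.*2.+1 | odd j) (f j x)^*).

(* X_t on regular functions, with the time integral taken coefficientwise. *)
Definition Xreg (R : realType) (d k : nat) (w : R -> R) (t : R)
    (phi : 'I_(k.*2.+1) -> fcoefs R d) : fcoefs R d :=
  fun n => - 'i%C * cintegral 0 t (fun tau =>
    Uop (fun r => - w r) tau
      (fourier_coef (nonlin (fun j => fourier_series (Uop w tau (phi j))))) n).

Definition set_slot (m : nat) (A : Type) (f : 'I_m -> A) (j : 'I_m) (a : A) :
    'I_m -> A :=
  fun i => if i == j then a else f i.

(* Linear in the even slots and conjugate-linear in the odd ones, on H^s. *)
Definition Hs_multilinear (R : realType) (d m : nat) (s : R)
    (B : ('I_m -> fcoefs R d) -> fcoefs R d) : Prop :=
  forall (f : 'I_m -> fcoefs R d) (j : 'I_m) (phi psi : fcoefs R d) (c : R[i]),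
    (forall i, in_Hs s (f i)) -> in_Hs s phi -> in_Hs s psi ->
    forall n, B (set_slot f j (fun m => c * phi m + psi m)) n =
      (if odd j then c^* else c) * B (set_slot f j phi) n + B (set_slot f j psi) n.

Definition Hs_bounded (R : realType) (d m : nat) (s : R)
    (B : ('I_m -> fcoefs R d) -> fcoefs R d) : Prop :=
  exists C : R, forall f, (forall j, in_Hs s (f j)) ->
    in_Hs s (B f) /\ Hs_norm s (B f) <= C * \prod_(j < m) Hs_norm s (f j).

Definition is_Xext (R : realType) (d k : nat) (s : R) (w : R -> R) (t : R)
    (B : ('I_(k.*2.+1) -> fcoefs R d) -> fcoefs R d) : Prop :=
  [/\ Hs_multilinear s B, Hs_bounded s B &
      forall (s1 : R) (f : 'I_(k.*2.+1) -> fcoefs R d),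
        d%:R / 2 < s1 -> s <= s1 -> (forall j, in_Hs s1 (f j)) ->
        B f = Xreg w t f].

(* The bounded multilinear extension of X_t to H^s. By density its values on
   H^s are uniquely determined; those off H^s are never used. *)
Definition Xext (R : realType) (d k : nat) (s : R) (w : R -> R) (t : R) :
    ('I_(k.*2.+1) -> fcoefs R d) -> fcoefs R d :=
  xget (fun _ _ => 0) [set B | is_Xext s w t B].

Definition mesh (R : realType) (a : R) (r : seq R) : R :=
  \big[Num.max/0]_(j < size r) (nth 0 (a :: r) j.+1 - nth 0 (a :: r) j).

Definition young_sum (R : realType) (d m : nat)
    (X : R -> ('I_m -> fcoefs R d) -> fcoefs R d)
    (g : 'I_m -> R -> fcoefs R d) (r : seq R) : fcoefs R d :=
  fun n => \sum_(j < size r)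
    let t0 := nth 0 (0 :: r) j in let t1 := nth 0 (0 :: r) j.+1 in
    (X t1 (fun i => g i t0) n - X t0 (fun i => g i t0) n).

(* [itv_partition 0 t r] : 0 :: r is strictly increasing with last element t. *)
Definition is_young_integral (R : realType) (d m : nat) (s : R)
    (X : R -> ('I_m -> fcoefs R d) -> fcoefs R d)
    (g : 'I_m -> R -> fcoefs R d) (t : R) (J : fcoefs R d) : Prop :=
  in_Hs s J /\
  forall eps : R, 0 < eps -> exists2 delta : R, 0 < delta &
    forall r : seq R, itv_partition 0 t r -> mesh 0 r < delta ->
      in_Hs s (fun n => young_sum X g r n - J n) /\
      Hs_norm s (fun n => young_sum X g r n - J n) < eps.

Definition sup_enorm (R : realType) (d : nat) (T s : R) (u : R -> fcoefs R d) :
    \bar R :=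
  ereal_sup [set y : \bar R | exists2 t : R, 0 <= t <= T &
    y = (Hs_norm s (u t))%:E].

Definition hoelder_seminorm (R : realType) (d : nat) (lambda T s : R)
    (u : R -> fcoefs R d) : \bar R :=
  ereal_sup [set y : \bar R | exists t1 t2 : R, [/\ 0 <= t1, t1 < t2, t2 <= T &
    y = (Hs_norm s (fun n => u t2 n - u t1 n) / `|t2 - t1| `^ lambda)%:E]].

Definition hoelder_enorm (R : realType) (d : nat) (lambda T s : R)
    (u : R -> fcoefs R d) : \bar R :=
  (sup_enorm T s u + hoelder_seminorm lambda T s u)%E.

Definition in_hoelder (R : realType) (d : nat) (lambda T s : R)
    (u : R -> fcoefs R d) : Prop :=
  (forall t, 0 <= t <= T -> in_Hs s (u t)) /\ (hoelder_enorm lambda T s u < +oo)%E.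

Definition is_solution (R : realType) (d k : nat) (s : R) (w : R -> R) (T : R)
    (psi : fcoefs R d) (u : R -> fcoefs R d) : Prop :=
  forall t, 0 <= t <= T ->
    exists2 J : fcoefs R d,
      is_young_integral s (@Xext R d k s w) (fun _ => u) t J &
      forall n, u t n = psi n + J n.

Definition is_unique_solution (R : realType) (d k : nat) (s lambda : R)
    (w : R -> R) (T : R) (psi : fcoefs R d) (u : R -> fcoefs R d) : Prop :=
  [/\ in_hoelder lambda T s u, is_solution k s w T psi u &
      forall v, in_hoelder lambda T s v -> is_solution k s w T psi v ->
        forall t, 0 <= t <= T -> v t = u t].

Definition in_Hs_ball (R : realType) (d : nat) (s r : R) (psi : fcoefs R d) :
    Prop :=
  in_Hs s psi /\ Hs_norm s psi <= r.

Definition solmap_continuous (R : realType) (d : nat) (s lambda T r : R)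
    (S : fcoefs R d -> R -> fcoefs R d) : Prop :=
  forall psi, in_Hs_ball s r psi -> forall eps : R, 0 < eps ->
    exists2 eta : R, 0 < eta & forall psi', in_Hs_ball s r psi' ->
      Hs_norm s (fun n => psi' n - psi n) < eta ->
      (hoelder_enorm lambda T s (fun t n => (S psi' t n - S psi t n)%R) <
         eps%:E)%E.

(* Main.v *)
Require Import Defs.
From mathcomp Require Import all_boot all_order all_algebra.
From mathcomp Require Import all_classical all_reals all_analysis.
From mathcomp Require Import complex.
From mathcomp Require Import zify ring lra.

Set Implicit Arguments.
Unset Strict Implicit.
Unset Printing Implicit Defensive.

Import Order.TTheory GRing.Theory Num.Theory.
Import numFieldNormedType.Exports.

Local Open Scope classical_set_scope.
Local Open Scope ring_scope.

(** In Fourier variables [X_t] is an explicit multilinear multiplier. The output frequency [n]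
    receives from a tuple [z] of input frequencies, of alternating signs and total [n], the
    product of the input coefficients times [- i Phi_t (omega)], where the integer
    [omega = |n|^2 - sum_j (+-) |z_j|^2] is the resonance function ([Xreg_multop]).
    Irregularity of the path bounds the increments of the symbol by
    [|t - s|^gamma (1 + |omega|)^(- rho)]. The proof has two halves: a multilinear estimate
    for such multipliers on [H^s], and a fixed point argument for a Young equation.

    The multilinear estimate ([multilinear_finite], [multop_bound]) needs only counting. On a
    level set of [omega] the output and the [2 k + 1] inputs form [2 k + 2] frequencies with
    prescribed signed sums of [n] and of [|n|^2]. The largest input pays for the weight of
    the output, these two go to different groups, each with [k] of the other inputs, and
    Cauchy-Schwarz separates the groups ([signed_form_le]). The energy of a group does not
    see its signs, because a term can be moved across an equation between two copies of the
    group ([energy_sign]); hence complex conjugation is irrelevant, and what remains is to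
    count [k]-tuples on a sphere with weights [<z_b>^(-2 s)], uniformly in the centre and the
    radius ([sum_sphere_tuples]). Fixing all scalar coordinates except the two largest leaves
    lattice points on a conic [x^2 + D y^2 = K] with [D = 1] or [D = 3]. There are at most
    [C_eps K^eps] of them by the divisor bound ([size_reps], [size_divisors_exp]), and at most
    two within distance [c K^(1/6)] of any given point ([ellipse_three_points]); so a weight
    of arbitrarily small negative power sums to a constant whatever [K] and the centre
    ([sum_ellipse_weight]). This settles [s > d/2 - 1/k] with the factor
    [(1 + |omega|)^(- 1 - eps)], which is summable over the level sets; without any help from
    [omega], [s > d/2] is needed, and interpolation between the two cases gives the range
    [s > d/2 - rho/k].

    Any bounded multilinear extension of [X_t] coincides with the multiplier because the
    truncations of a function to finitely many frequencies converge to it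
    ([multilinear_ext]). So [t |-> X_t] is [gamma]-Hoelder in operator norm with a constant
    proportional to the irregularity norm ([Xext_hoelder]).

    The Young integral is constructed by sewing: for a germ whose defect of additivity is
    [O(|t - s|^theta)] with [theta = gamma + lambda > 1], bisection bounds the difference
    between the germ and its sums over any partition ([sewing_maximal]). As [X_t] is
    multilinear, the maps [v |-> X_t (v, ..., v)] and their first and second differences are
    bounded on balls ([Xext_young_bounds]), hence the integral is a Lipschitz function of the
    path ([young_stability]), with a constant made small by [T^(gamma - lambda)]. Picard
    iteration gives the solution ([young_existence]), the same estimate on short pieces gives
    uniqueness among all Hoelder solutions ([young_unique]), and its version with two data
    gives a Lipschitz solution map on balls ([solution_lipschitz]). *)


(** * Representations by the forms x^2 + D y^2 *)

Section NatBounds.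
Local Open Scope nat_scope.

Lemma size_divisors_pfactor (p a m : nat) : prime p -> 0 < m -> ~~ (p %| m) ->
  size (divisors (p ^ a * m)) <= a.+1 * size (divisors m).
Proof.
move=> pp m0 pm.
have pa0 : 0 < p ^ a by rewrite expn_gt0 prime_gt0.
pose L := [seq p ^ i * e | i <- iota 0 a.+1, e <- divisors m].
have -> : a.+1 * size (divisors m) = size L by rewrite size_allpairs size_iota.
apply: uniq_leq_size; first exact: divisors_uniq.
move=> e; rewrite -dvdn_divisors ?muln_gt0 ?pa0 // => em.
have e0 : 0 < e by apply: dvdn_gt0 em; rewrite muln_gt0 pa0.
have [f fp ef] := pfactor_coprime pp e0.
have fm : f %| m.
  have : f %| p ^ a * m by apply: dvdn_trans em; rewrite ef dvdn_mulr.
  by rewrite Gauss_dvdr // coprime_sym coprimeXl.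
apply/allpairsP; exists (logn p e, f); split => /=.
- rewrite -[0 :: _]/(iota 0 a.+1) mem_iota leq0n add0n ltnS.
  have : logn p e <= logn p (p ^ a * m) by apply: dvdn_leq_log => //; rewrite muln_gt0 pa0.
  rewrite lognM // pfactorK //.
  by move: pm; rewrite -{1}(expn1 p) pfactor_dvdn // -leqNgt leqn0 => /eqP ->; rewrite addn0.
- by rewrite -dvdn_divisors.
- by rewrite mulnC.
Qed.

Lemma succ_exp_le_exp2 (j a : nat) : 0 < j -> (a.+1) ^ j <= j ^ j * 2 ^ a.
Proof.
move=> j0.
have h : a.+1 <= j * (a %/ j).+1 by rewrite mulnC ltn_ceil.
apply: (@leq_trans ((j * (2 ^ (a %/ j))) ^ j)).
  rewrite leq_exp2r //; apply: leq_trans h _; rewrite leq_mul2l ltn_expl // orbT //.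
rewrite expnMn leq_mul2l -expnM leq_exp2l //.
by rewrite leq_divM ?orbT.
Qed.

(** Each prime at least [2 ^ j] contributes at most its own size to the [j]-th
    power of the divisor count, because [a + 1 <= 2 ^ a]; each of the finitely many
    smaller primes costs a constant factor. *)
Lemma size_divisors_exp (j : nat) :
  exists C, forall K, 0 < K -> size (divisors K) ^ j <= C * K.
Proof.
case: (posnP j) => [-> | j0]; first by exists 1 => K K0; rewrite mul1n expn0.
have split_at p K : prime p -> 0 < K -> p %| K ->
    exists a m, [/\ 0 < a, 0 < m, ~~ (p %| m) & K = p ^ a * m].
  move=> pp K0 pK; have [m cm em] := pfactor_coprime pp K0.
  exists (logn p K), m; split; last by rewrite mulnC.
  - by rewrite logn_gt0 mem_primes pp K0.
  - by move: K0; rewrite em muln_gt0 => /andP[].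
  - by rewrite -prime_coprime.
suff H b : exists C, forall K, 0 < K ->
    (forall p, prime p -> p %| K -> p < 2 ^ j -> p < b) ->
    size (divisors K) ^ j <= C * K.
  have [C hC] := H (2 ^ j); exists C => K K0; exact: hC.
elim: b => [|b [C hC]].
  exists 1; elim/ltn_ind => K IH K0 hK; rewrite mul1n.
  case: (ltngtP K 1) => [|K1|->]; [by case: K K0 {IH hK}| |by rewrite exp1n].
  have pp := pdiv_prime K1.
  have [a [m [a0 m0 pm eK]]] := split_at _ _ pp K0 (pdiv_dvd K).
  set p := pdiv K in pp eK pm.
  have p2j : 2 ^ j <= p by rewrite leqNgt; apply/negP => /(hK p pp (pdiv_dvd K)).
  have mK : m < K by rewrite eK ltn_Pmull // -(exp1n a) ltn_exp2r // prime_gt1.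
  have IHm : size (divisors m) ^ j <= m.
    rewrite -[X in _ <= X]mul1n; apply: IH => // q pq qm.
    by apply: hK => //; rewrite eK dvdn_mull.
  apply: (@leq_trans ((a.+1 * size (divisors m)) ^ j)).
    by rewrite leq_exp2r // {1}eK size_divisors_pfactor.
  rewrite expnMn [X in _ <= X]eK leq_mul //.
    apply: (@leq_trans ((2 ^ a) ^ j)).
      by rewrite leq_exp2r // ltn_expl.
    by rewrite -expnM mulnC expnM leq_exp2r.
exists (C * j ^ j) => K K0 hK.
have [/andP[pb bK]|nb] := boolP (prime b && (b %| K)); last first.
  apply: (@leq_trans (C * K)).
    apply: hC => // p pp pK p2; move: (hK p pp pK p2); rewrite ltnS leq_eqVlt.
    by case: eqP => // epb; move: nb; rewrite -epb pp pK.
  by rewrite -mulnA leq_mul2l leq_pmull ?expn_gt0 ?j0 // orbT.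
have [a [m [a0 m0 pm eK]]] := split_at _ _ pb K0 bK.
apply: (@leq_trans ((a.+1 * size (divisors m)) ^ j)).
  by rewrite leq_exp2r // {1}eK size_divisors_pfactor.
have hm : size (divisors m) ^ j <= C * m.
  apply: hC => // p pp pm' p2.
  have : p < b.+1 by apply: hK => //; rewrite eK dvdn_mull.
  rewrite ltnS leq_eqVlt; case: eqP => // epb; by move: pm; rewrite -epb pm'.
rewrite expnMn [X in _ <= _ * X]eK.
apply: (@leq_trans (j ^ j * 2 ^ a * (C * m))).
  by rewrite leq_mul // succ_exp_le_exp2.
have : 2 ^ a <= b ^ a by rewrite leq_exp2r // prime_gt1.
move=> /(leq_mul (leqnn (j ^ j * (C * m)))).
set u := 2 ^ a; set v := b ^ a; set w := j ^ j.
have -> : w * u * (C * m) = w * (C * m) * u by ring.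
by have -> : C * w * (v * m) = w * (C * m) * v by ring.
Qed.

End NatBounds.

Lemma normr_le_sqr (R : realDomainType) (x y : R) : 0 <= y -> x ^+ 2 <= y ^+ 2 -> `|x| <= y.
Proof.
move=> y0 h; rewrite -(@ler_pXn2r _ 2%N) // ?nnegrE //.
by rewrite -normrX ger0_norm ?sqr_ge0.
Qed.

Lemma size_le_fibers (A B : eqType) (f : A -> B) (c : nat) (L : seq B) (S : seq A) :
  (forall x, x \in S -> f x \in L) ->
  (forall v, v \in L -> (size [seq x <- S | f x == v] <= c)%N) ->
  (size S <= c * size L)%N.
Proof.
elim: L S => [|v L IH] S hf hc.
  by case: S hf {hc} => // x S /(_ x); rewrite in_cons eqxx => /(_ isT).
rewrite -(count_predC (fun x => f x == v)) /= mulnS leq_add //.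
  by rewrite -size_filter hc // mem_head.
rewrite -size_filter; apply: IH => [x|u uL].
  rewrite mem_filter => /andP[/= nv /hf]; rewrite in_cons.
  by case: eqP nv.
apply: leq_trans (hc u _); last by rewrite in_cons uL orbT.
rewrite -filter_predI !size_filter; apply: sub_count => x /= /andP[-> //].
Qed.

(** By the composition identity, [D * (x y' - x' y) ^+ 2 <= K ^+ 2], so the divisibility
    leaves a bounded number of values for this determinant; together with the
    sign condition they determine the second representation. *)
Lemma rep_class_bound (D K : int) (S : seq (int * int)) : 0 < D -> 0 < K -> uniq S ->
  (forall z, z \in S -> [/\ 0 <= z.1, 0 <= z.2 & z.1 ^+ 2 + D * z.2 ^+ 2 = K]) ->
  (forall z z', z \in S -> z' \in S -> (K %| 4 * D * (z.1 * z'.2 - z'.1 * z.2))%Z) ->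
  (size S <= `|(8 * D + 1)%R|)%N.
Proof.
move=> D0 K0 uS hS hdvd.
case: S uS hS hdvd => [|[x1 y1] S'] // uS hS hdvd.
set S := _ :: S' in uS hS hdvd *.
have z1S : (x1, y1) \in S by rewrite mem_head.
have /= [x10 y10 e1] := hS _ z1S.
pose h (z : int * int) := `| ((4 * D * (x1 * z.2 - z.1 * y1) %/ K)%Z + 4 * D)%R |%N.
have hd z : z \in S -> - K <= x1 * z.2 - z.1 * y1 <= K.
  move=> zS; have [zx0 zy0 ez] := hS _ zS; set d := x1 * z.2 - _.
  have E : (x1 * z.1 + D * y1 * z.2) ^+ 2 + D * d ^+ 2 = K ^+ 2.
    have -> : K ^+ 2 = (x1 ^+ 2 + D * y1 ^+ 2) * (z.1 ^+ 2 + D * z.2 ^+ 2).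
      by rewrite e1 ez expr2.
    by rewrite /d; ring.
  have : d ^+ 2 <= K ^+ 2.
    rewrite -E; apply: le_trans (_ : D * d ^+ 2 <= _); last by rewrite lerDr sqr_ge0.
    by rewrite ler_peMl ?sqr_ge0 //; lia.
  by move=> dK; rewrite -ler_norml; apply: normr_le_sqr => //; apply: ltW.
have hb z : z \in S -> exists q : int, [/\ q * K = 4 * D * (x1 * z.2 - z.1 * y1),
   0 <= q + 4 * D, q <= 4 * D & h z = `|(q + 4 * D)%R|%N].
  move=> zS; have /= := hdvd _ _ z1S zS.
  move=> /divzK e; exists (4 * D * (x1 * z.2 - z.1 * y1) %/ K)%Z; rewrite e.
  have [zx0 zy0 ez] := hS _ zS.
  have D4 : 0 < 4 * D by rewrite mulr_gt0.
  set q := (_ %/ _)%Z in e *; split => //.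
    rewrite -(ler_pM2r K0) mul0r mulrDl e -mulrDr; have /andP[h1 h2] := hd z zS.
    by apply: mulr_ge0; [exact: ltW | rewrite -lerBlDr sub0r].
  by rewrite -(ler_pM2r K0) e ler_pM2l //; have /andP[] := hd z zS.
have hinj : {in S &, injective h}.
  move=> z z' zS z'S.
  have [q [eq q0 qD ->]] := hb z zS; have [q' [eq' q0' qD' ->]] := hb z' z'S.
  move=> /(congr1 Posz); rewrite !gez0_abs // => /addIr qq.
  have [zx0 zy0 ez] := hS _ zS; have [zx0' zy0' ez'] := hS _ z'S.
  have ed : x1 * z.2 - z.1 * y1 = x1 * z'.2 - z'.1 * y1.
    have D40 : (4 * D != 0 :> int) by rewrite mulf_neq0 // gt_eqF.
    by apply: (mulfI D40); rewrite -eq -eq' qq.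
  have ec : x1 * z.1 + D * y1 * z.2 = x1 * z'.1 + D * y1 * z'.2.
    have h1 : (x1 * z.1 + D * y1 * z.2) ^+ 2 = (x1 * z'.1 + D * y1 * z'.2) ^+ 2.
      have E a b : a ^+ 2 + D * b ^+ 2 = K ->
         (x1 * a + D * y1 * b) ^+ 2 = K ^+ 2 - D * (x1 * b - a * y1) ^+ 2.
        move=> e; have -> : K ^+ 2 = (x1 ^+ 2 + D * y1 ^+ 2) * (a ^+ 2 + D * b ^+ 2).
          by rewrite e1 e expr2.
        by ring.
      by rewrite !E // ed.
    by apply/eqP; rewrite -(eqrXn2 (n := 2)) // ?h1 // addr_ge0 // ?mulr_ge0 // ltW.
  have K_neq0 : K != 0 by rewrite gt_eqF.
  case: z z' ed ec {zS z'S ez ez' zx0 zy0 zx0' zy0' eq eq' } => [a b] [a' b'] /= ed ec.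
  congr pair; apply: (mulfI K_neq0).
    have E u v : K * u = x1 * (x1 * u + D * y1 * v) - D * y1 * (x1 * v - u * y1).
      by rewrite -e1; ring.
    by rewrite (E a b) (E a' b') ed ec.
  have E u v : K * v = y1 * (x1 * u + D * y1 * v) + x1 * (x1 * v - u * y1).
    by rewrite -e1; ring.
  by rewrite (E a b) (E a' b') ed ec.
suff : (size S <= `|(8 * D + 1)%R|)%N by [].
rewrite -(size_map h) -(size_iota 0 `|(8 * D + 1)%R|%N); apply: uniq_leq_size.
  by rewrite map_inj_in_uniq.
move=> _ /mapP[z zS ->]; rewrite mem_iota /= add0n.
by have [q [_ q0 qD ->]] := hb z zS; lia.
Qed.

Lemma dvdz_mul_gcd (m p q c : int) : (m %| p * c)%Z -> (m %| q * c)%Z -> (m %| gcdz p q * c)%Z.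
Proof.
move=> h1 h2; have : (m %| gcdz (p * c) (q * c))%Z by rewrite dvdz_gcd h1 h2.
by rewrite -mulz_gcdl !dvdzE !abszM absz_nat.
Qed.

(** All representations [(x, y)] are compared with a fixed one, [(x0, y0)]. As [K] divides
    [(x y0 - x0 y) (x y0 + x0 y)], they fall into classes indexed by the divisor
    [gcd (x y0 - x0 y, K)] of [K]; inside a class [K] divides [4 D] times each
    determinant, and [rep_class_bound] applies. *)
Lemma size_prim_reps (D K : int) (S : seq (int * int)) : 0 < D -> 0 < K -> uniq S ->
  (forall z, z \in S -> [/\ 0 <= z.1, 0 <= z.2 & z.1 ^+ 2 + D * z.2 ^+ 2 = K]) ->
  (forall z, z \in S -> coprimez z.2 K) ->
  (size S <= `|(8 * D + 1)%R| * size (divisors `|K|))%N.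
Proof.
move=> D0 K0 uS hS hc.
case: S uS hS hc => [|[x0 y0] S'] // uS hS hc.
set S := _ :: S' in uS hS hc *.
have z0S : (x0, y0) \in S by rewrite mem_head.
have [/= _ _ e0] := hS _ z0S.
have /= c0 := hc _ z0S.
have K_neq0 : K != 0 by rewrite gt_eqF.
pose a (z : int * int) := z.1 * y0 - x0 * z.2.
pose b (z : int * int) := z.1 * y0 + x0 * z.2.
have Kab z : z \in S -> (K %| a z * b z)%Z.
  move=> zS; have [_ _ ez] := hS _ zS.
  have -> : a z * b z = K * (y0 ^+ 2 - z.2 ^+ 2).
    have -> : K * (y0 ^+ 2 - z.2 ^+ 2) = K * y0 ^+ 2 - K * z.2 ^+ 2 by ring.
    by rewrite -{1}ez -{1}e0 /a /b; ring.
  exact: dvdz_mulr.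
have cop_dvd u v : (u %| K)%Z -> coprimez v K -> coprimez u v.
  by move=> uK; rewrite coprimez_sym; exact: coprimez_dvdl.
pose f z := `|gcdz (a z) K|%N.
suff : (size S <= `|(8 * D + 1)%R| * size (divisors `|K|))%N by [].
apply: (@size_le_fibers _ _ f) => [z zS|e]; rewrite -dvdn_divisors ?absz_gt0 //.
  by rewrite -dvdzE dvdz_gcdr.
move=> eK; apply: (rep_class_bound D0 K0); first exact: filter_uniq.
  by move=> z; rewrite mem_filter => /andP[_]; exact: hS.
have /dvdzP[K1 eK1] : (e%:Z %| K)%Z by rewrite dvdzE.
have e_neq0 : e%:Z != 0 by apply: contraNneq K_neq0 => e_0; rewrite eK1 e_0 mulr0.
have he z : z \in [seq z <- S | f z == e] -> [/\ z \in S, (e %| a z)%Z & (K1 %| b z)%Z].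
  rewrite mem_filter => /andP[/eqP fz zS]; split => //.
    by rewrite -fz; exact: dvdz_gcdl.
  have : (K %| gcdz (a z) K * b z)%Z.
    by apply: dvdz_mul_gcd; [exact: Kab | exact: dvdz_mulr].
  have -> : gcdz (a z) K = e%:Z by rewrite -fz.
  by rewrite eK1 (mulrC K1) dvdz_mul2l.
move=> z z' /he[zS ea Kb] /he[z'S ea' Kb'].
have [_ _ ez] := hS _ zS.
set dl := z.1 * z'.2 - z'.1 * z.2.
have eKd : (e%:Z %| K)%Z by rewrite eK1 dvdz_mull.
have K1Kd : (K1 %| K)%Z by rewrite eK1 dvdz_mulr.
have ed : (e %| dl)%Z.
  rewrite -(Gauss_dvdzr dl (cop_dvd _ _ eKd c0)).
  have -> : y0 * dl = a z * z'.2 - a z' * z.2 by rewrite /a /dl; ring.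
  by rewrite rpredB // dvdz_mulr.
have Kd : (K1 %| dl)%Z.
  rewrite -(Gauss_dvdzr dl (cop_dvd _ _ K1Kd c0)).
  have -> : y0 * dl = b z * z'.2 - b z' * z.2 by rewrite /b /dl; ring.
  by rewrite rpredB // dvdz_mulr.
set g := gcdz K1 e%:Z.
have gK : (g %| K)%Z by apply: dvdz_trans eKd; exact: dvdz_gcdr.
have g2x : (g %| 2 * z.1)%Z.
  rewrite -(Gauss_dvdzl _ (cop_dvd _ _ gK c0)).
  have -> : 2 * z.1 * y0 = a z + b z by rewrite /a /b; ring.
  rewrite rpredD //; first by apply: dvdz_trans ea; exact: dvdz_gcdr.
  by apply: dvdz_trans Kb; exact: dvdz_gcdl.
have g4D : (g %| 4 * D)%Z.
  have cz := cop_dvd _ _ gK (hc _ zS).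
  rewrite -(Gauss_dvdzl _ cz) -(Gauss_dvdzl _ cz).
  have -> : 4 * D * z.2 * z.2 = 4 * K - 2 * z.1 * (2 * z.1) by rewrite -ez; ring.
  by rewrite rpredB // ?(dvdz_mull _ gK) // dvdz_mulr.
have : (K %| g * dl)%Z.
  apply: dvdz_mul_gcd; rewrite eK1; first exact: dvdz_mul.
  by rewrite mulrC dvdz_mul.
by move=> h; apply: (dvdz_trans h); exact: dvdz_mul.
Qed.

(** Dividing out the common factor [g] of the two coordinates reduces to
    primitive representations of [K / g ^+ 2], and [g] is itself a divisor of [K]. *)
Lemma size_reps_nneg (D K : int) (S : seq (int * int)) : 0 < D -> 0 < K -> uniq S ->
  (forall z, z \in S -> [/\ 0 <= z.1, 0 <= z.2 & z.1 ^+ 2 + D * z.2 ^+ 2 = K]) ->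
  (size S <= `|(8 * D + 1)%R| * size (divisors `|K|) * size (divisors `|K|))%N.
Proof.
move=> D0 K0 uS hS.
have K_neq0 : K != 0 by rewrite gt_eqF.
pose f (z : int * int) := `|gcdz z.1 z.2|%N.
have g2 z : z \in S -> ((f z)%:Z ^+ 2 %| K)%Z.
  move=> zS; have [_ _ <-] := hS _ zS.
  have fg : (f z)%:Z = gcdz z.1 z.2 by [].
  apply: rpredD; first by apply: dvdz_exp2r; rewrite fg dvdz_gcdl.
  by apply: dvdz_mull; apply: dvdz_exp2r; rewrite fg dvdz_gcdr.
apply: (@size_le_fibers _ _ f) => [z zS|g]; rewrite -dvdn_divisors ?absz_gt0 //.
  by rewrite -[f z]absz_nat -dvdzE; apply: dvdz_trans (g2 z zS); rewrite expr2 dvdz_mulr.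
move=> gK; set S' := [seq x <- S | f x == g].
have [->|] := eqVneq S' [::]; first by [].
case E : S' => [|z0 S0] // _.
have : z0 \in S' by rewrite E mem_head.
rewrite -E {E}.
rewrite mem_filter => /andP[/eqP fz0 z0S].
have := g2 _ z0S; rewrite fz0 => /dvdzP[K' eK].
have g0 : 0 < g%:Z by rewrite ltz_nat; move: gK => /dvdn_gt0 ->//; rewrite absz_gt0.
have K'0 : 0 < K' by move: K0; rewrite eK pmulr_lgt0 // exprn_gt0.
pose h (z : int * int) : int * int := ((z.1 %/ g)%Z, (z.2 %/ g)%Z).
have hE z : z \in S' -> [/\ z \in S, (h z).1 * g = z.1, (h z).2 * g = z.2 & gcdz z.1 z.2 = g].
  rewrite mem_filter => /andP[/eqP fz zS]; split => //; last by rewrite -fz.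
    by rewrite divzK // -fz dvdz_gcdl.
  by rewrite divzK // -fz dvdz_gcdr.
apply: (@leq_trans (`|(8 * D + 1)%R| * size (divisors `|K'|))%N); last first.
  rewrite leq_mul2l; apply/orP; right; apply: uniq_leq_size; first exact: divisors_uniq.
  move=> d; rewrite -!dvdn_divisors ?absz_gt0 // ?gt_eqF // => dK.
  by rewrite eK abszM dvdn_mulr.
rewrite -(size_map h); apply: size_prim_reps => //.
- rewrite map_inj_in_uniq ?filter_uniq // => z z' /hE[_ h1 h2 _] /hE[_ h1' h2' _] hh.
  by rewrite (surjective_pairing z) (surjective_pairing z') -h1 -h2 -h1' -h2' hh.
- move=> _ /mapP[z /hE[zS h1 h2 _] ->]; have [z10 z20 ez] := hS _ zS.
  split; rewrite ?divz_ge0 //.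
  have g2_neq0 : g%:Z ^+ 2 != 0 by rewrite gt_eqF // exprn_gt0.
  by apply: (mulIf g2_neq0); rewrite -eK -ez -[in RHS]h1 -[in RHS]h2; ring.
- move=> _ /mapP[z /hE[zS h1 h2 hg] ->]; have [_ _ ez] := hS _ zS.
  have cop : coprimez (h z).1 (h z).2.
    have g_neq0 : g%:Z != 0 by rewrite gt_eqF.
    apply/eqP; apply: (mulIf g_neq0); rewrite mul1r -{2}hg -h1 -h2.
    by rewrite -mulz_gcdl absz_nat.
  have -> : K' = D * (h z).2 * (h z).2 + (h z).1 * (h z).1.
    have g2_neq0 : g%:Z ^+ 2 != 0 by rewrite gt_eqF // exprn_gt0.
    by apply: (mulIf g2_neq0); rewrite -eK -ez -[in LHS]h1 -[in LHS]h2; ring.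
  by rewrite /coprimez gcdzMDl -/(coprimez _ _) coprimezMr coprimez_sym cop.
Qed.

Lemma size_reps (D K : int) (S : seq (int * int)) : 0 < D -> 0 < K -> uniq S ->
  (forall z, z \in S -> z.1 ^+ 2 + D * z.2 ^+ 2 = K) ->
  (size S <= 4 * (`|(8 * D + 1)%R| * size (divisors `|K|) ^ 2))%N.
Proof.
move=> D0 K0 uS hS.
pose f (z : int * int) : int * int := (`|z.1|, `|z.2|).
apply: (@leq_trans (4 * size (undup (map f S)))%N).
  apply: (@size_le_fibers _ _ f) => [z zS|[a b] _].
    by rewrite mem_undup map_f.
  pose L := [:: (a, b); (a, - b); (- a, b); (- a, - b)].
  have -> : 4%N = size L by [].
  apply: uniq_leq_size; first exact: filter_uniq.
  move=> [x y]; rewrite mem_filter /f /= => /andP[/eqP[ea eb] _].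
  rewrite /L -ea -eb !inE !xpair_eqE.
  case: (ger0P x) => _; case: (ger0P y) => _; rewrite ?opprK !eqxx ?orbT //.
rewrite leq_mul2l /= expnS expn1 mulnA; apply: (size_reps_nneg D0 K0); first exact: undup_uniq.
by move=> z; rewrite mem_undup => /mapP[z' z'S ->]; rewrite !normr_ge0 /= !real_normK ?num_real ?hS.
Qed.

(** Two increments from a point of the ellipse give a linear system for that point;
    its determinant is a nonzero integer because a line meets the ellipse at most twice. *)
Lemma ellipse_three_points (D K N : int) (P0 P1 P2 : int * int) : 0 < D ->
  uniq [:: P0; P1; P2] ->
  {in [:: P0; P1; P2], forall z, z.1 ^+ 2 + D * z.2 ^+ 2 = K} ->
  {in [:: P1; P2], forall z, `|z.1 - P0.1| <= N /\ `|z.2 - P0.2| <= N} ->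
  K <= (1 + D) ^+ 3 * N ^+ 6.
Proof.
case: P0 P1 P2 => [u v] [u1 v1] [u2 v2] D0 /and3P[] h01 h12 _ hK hN.
have e0 := hK (u, v) (mem_head _ _).
have /= e1 := hK (u1, v1) ltac:(by rewrite !inE eqxx orbT).
have /= e2 := hK (u2, v2) ltac:(by rewrite !inE eqxx !orbT).
have /= [hp1 hq1] := hN (u1, v1) ltac:(by rewrite !inE eqxx).
have /= [hp2 hq2] := hN (u2, v2) ltac:(by rewrite !inE eqxx orbT).
rewrite /= in e0 {hK hN}.
have {h01} [n1 n2] : (u1 - u, v1 - v) != 0 /\ (u2 - u, v2 - v) != 0.
  by move: h01; rewrite !inE negb_or !xpair_eqE !subr_eq0 ![_ == u]eq_sym ![_ == v]eq_sym => /andP.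
have {h12} n12 : (u1 - u, v1 - v) != (u2 - u, v2 - v).
  by move: h12; rewrite inE !xpair_eqE !(inj_eq (addIr _)).
set p1 := u1 - u in hp1 n1 n12 *; set q1 := v1 - v in hq1 n1 n12 *.
set p2 := u2 - u in hp2 n2 n12 *; set q2 := v2 - v in hq2 n2 n12 *.
pose Q1 := p1 ^+ 2 + D * q1 ^+ 2; pose Q2 := p2 ^+ 2 + D * q2 ^+ 2.
have l1 : 2 * u * p1 + 2 * D * v * q1 = - Q1.
  by apply/eqP; rewrite -addr_eq0 /Q1 -(subrr K) -{1}e1 -e0 /p1 /q1; apply/eqP; ring.
have l2 : 2 * u * p2 + 2 * D * v * q2 = - Q2.
  by apply/eqP; rewrite -addr_eq0 /Q2 -(subrr K) -{1}e2 -e0 /p2 /q2; apply/eqP; ring.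
pose dl := p1 * q2 - p2 * q1.
have cu : dl * (2 * u) = Q2 * q1 - Q1 * q2.
  have -> : dl * (2 * u) = (2 * u * p1 + 2 * D * v * q1) * q2 - (2 * u * p2 + 2 * D * v * q2) * q1.
    by rewrite /dl; ring.
  by rewrite l1 l2; ring.
have cv : dl * (2 * D * v) = Q1 * p2 - Q2 * p1.
  have -> : dl * (2 * D * v) = (2 * u * p2 + 2 * D * v * q2) * p1 - (2 * u * p1 + 2 * D * v * q1) * p2.
    by rewrite /dl; ring.
  by rewrite l1 l2; ring.
have Dq0 (q : int) : 0 <= D * q ^+ 2 by apply: mulr_ge0; rewrite ?sqr_ge0 // ltW.
have Qgt0 (p q : int) : (p, q) != 0 -> 0 < p ^+ 2 + D * q ^+ 2.
  move=> n; rewrite lt0r addr_ge0 ?sqr_ge0 // andbT.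
  apply: contraNneq n => /eqP; rewrite paddr_eq0 ?sqr_ge0 //.
  by rewrite sqrf_eq0 => /andP[/eqP->]; rewrite mulf_eq0 gt_eqF //= sqrf_eq0 => /eqP->.
have Q10 : 0 < Q1 by exact: Qgt0.
have Q20 : 0 < Q2 by exact: Qgt0.
have dl_neq0 : dl != 0.
  apply: contraNneq n12 => dl0.
  move: cu cv; rewrite dl0 !mul0r => /esym/eqP; rewrite subr_eq0 => /eqP cu /esym/eqP.
  rewrite subr_eq0 => /eqP cv.
  have QQ : Q1 = Q2.
    have Q1Q2 : Q1 * Q2 != 0 by rewrite mulf_neq0 ?gt_eqF.
    apply: (mulfI Q1Q2).
    have -> : Q1 * Q2 * Q1 = (Q1 * p2) ^+ 2 + D * (Q1 * q2) ^+ 2 by rewrite /Q2; ring.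
    by rewrite cv -cu /Q1; ring.
  have Q1n0 : Q1 != 0 by rewrite gt_eqF.
  move: cu cv; rewrite -QQ => /(mulfI Q1n0) -> /(mulfI Q1n0) ->; exact: eqxx.
have dl1 : 1 <= `|dl| by rewrite -gtz0_ge1 normr_gt0.
have N0 : 0 <= N by apply: le_trans hp1.
have Qle p q : `|p| <= N -> `|q| <= N -> `|p ^+ 2 + D * q ^+ 2| <= (1 + D) * N ^+ 2.
  move=> hp hq; rewrite ger0_norm ?addr_ge0 ?sqr_ge0 //.
  rewrite mulrDl mul1r lerD ?ler_pM2l // -[leLHS]ger0_norm ?sqr_ge0 // normrX ler_pXn2r ?nnegrE //.
have key (s t Qa Qb w c : int) : `|s| <= N -> `|t| <= N -> `|Qa| <= (1 + D) * N ^+ 2 ->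
    `|Qb| <= (1 + D) * N ^+ 2 -> 1 <= c -> dl * (2 * c * w) = Qa * s - Qb * t ->
    w ^+ 2 <= ((1 + D) * N ^+ 3) ^+ 2.
  move=> hs ht ha hb c1 e.
  rewrite -[w ^+ 2]ger0_norm ?sqr_ge0 // normrX ler_pXn2r ?nnegrE ?mulr_ge0 ?exprn_ge0 ?addr_ge0 ?(ltW D0) //.
  have h2 : 2 * `|w| <= `|dl * (2 * c * w)|.
    rewrite !normrM (ger0_norm (_ : 0 <= 2)) // (ger0_norm (_ : 0 <= c)); last by apply: le_trans c1.
    apply: (@le_trans _ _ (1 * (2 * 1 * `|w|))); first by rewrite mul1r mulr1.
    by apply: ler_pM => //; rewrite ?mulr_ge0 // ler_pM // ler_pM2l.
  have h3 : `|Qa * s - Qb * t| <= 2 * ((1 + D) * N ^+ 3).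
    apply: le_trans (ler_normB _ _) _; rewrite !normrM.
    have -> : 2 * ((1 + D) * N ^+ 3) = (1 + D) * N ^+ 2 * N + (1 + D) * N ^+ 2 * N by ring.
    by apply: lerD; apply: ler_pM.
  by move: h2; rewrite e => /le_trans /(_ h3); rewrite ler_pM2l.
have hu : u ^+ 2 <= ((1 + D) * N ^+ 3) ^+ 2.
  apply: (key q1 q2 Q2 Q1 u 1) => //; rewrite ?mulr1 //; exact: Qle.
have hv : v ^+ 2 <= ((1 + D) * N ^+ 3) ^+ 2.
  apply: (key p2 p1 Q1 Q2 v D) => //; exact: Qle.
rewrite -e0; apply: (@le_trans _ _ ((1 + D) * ((1 + D) * N ^+ 3) ^+ 2)).
  by rewrite [leRHS]mulrDl mul1r lerD // ler_pM2l.
by rewrite le_eqVlt; apply/orP; left; apply/eqP; ring.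
Qed.

Lemma ler_sum_const (R : numDomainType) (I : Type) (r : seq I) (P : pred I) (F : I -> R) (b : R) :
  (forall i, P i -> F i <= b) -> \sum_(i <- r | P i) F i <= (count P r)%:R * b.
Proof.
move=> h; apply: le_trans (ler_sum _ h) _.
by rewrite big_const_seq iter_addr_0 mulr_natl.
Qed.

(** With [m z] the distance to the centre, either [c * m z ^+ 6 < K], which leaves
    room for two points only, or the weight is at most [(c / K) `^ (e / 6)] and beats
    the number of all lattice points of the ellipse. *)
Lemma sum_ellipse_weight (R : realType) (D : int) (e : R) : 0 < D -> 0 < e ->
  exists C : R, forall (K u0 v0 : int) (S : seq (int * int)), uniq S ->
    (forall z, z \in S -> z.1 ^+ 2 + D * z.2 ^+ 2 = K) ->
    \sum_(z <- S) ((1 + `|z.1 - u0| + `|z.2 - v0|)%:~R : R) `^ (- e) <= C.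
Proof.
move=> D0 e0.
(* [j > 12 / e] makes the squared divisor count of [K] at most a multiple of [K `^ (e / 6)] *)
pose j := Num.bound (12 / e).
have j12 : 12 / e < j%:R by apply: archi_boundP; rewrite divr_ge0 // ltW.
have j0 : (0 < j)%N by rewrite -(ltr0n R); apply: lt_trans j12; rewrite divr_gt0.
have [Cj hCj] := size_divisors_exp j.
(* [64 = 2 ^ 6], as points at distance [M] from the centre are [2 M]-close to each other *)
pose c : int := 64 * (1 + D) ^+ 3.
have c1 : 1 <= c by rewrite /c; nia.
pose c8 := `|(8 * D + 1)%R|%N.
pose far : R := (4 * c8)%:R * ((Cj.+1)%:R `^ (e / 6) * (c%:~R) `^ (e / 6)).
have far0 : 0 <= far by rewrite !mulr_ge0 // ?powR_ge0.
exists (2 + far) => K u0 v0 S uS hS.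
pose m (z : int * int) : int := 1 + `|z.1 - u0| + `|z.2 - v0|.
have m1 z : 1 <= m z by rewrite /m -addrA lerDl addr_ge0.
have mR1 z : 1 <= (m z)%:~R :> R by rewrite ler1z.
have mR0 z : 0 <= (m z)%:~R :> R by exact: le_trans ler01 (mR1 z).
have W1 z : ((m z)%:~R : R) `^ (- e) <= 1.
  rewrite powRN invf_le1 ?powR_gt0 ?(lt_le_trans ltr01) //.
  by rewrite -{1}(powRr0 (m z)%:~R) ler_powR // ltW.
have [K0|K0|K0] := ltgtP K 0.
- suff -> : S = [::] by rewrite big_nil addr_ge0.
  case: S uS hS => // z S _ /(_ z (mem_head _ _)) h; move: K0.
  by rewrite -h ltNge addr_ge0 ?sqr_ge0 // mulr_ge0 ?sqr_ge0 // ltW.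
- rewrite (bigID (fun z => c * m z ^+ 6 < K)) /=; apply: lerD.
    apply: le_trans (ler_sum_const _ (fun z _ => W1 z)) _; rewrite mulr1 ler_nat.
    rewrite -size_filter; case E : [seq z <- S | c * m z ^+ 6 < K] => [|P0 [|P1 [|P2 L]]] //; exfalso.
    have : {subset [:: P0, P1, P2 & L] <= [seq z <- S | c * m z ^+ 6 < K]} by rewrite E.
    have uF : uniq [:: P0, P1, P2 & L] by rewrite -E filter_uniq.
    move=> sub; pose M := Num.max (m P0) (Num.max (m P1) (m P2)).
    have hM : c * M ^+ 6 < K.
      have near_lt z : z \in [:: P0; P1; P2] -> c * m z ^+ 6 < K.
        move=> zL; suff : z \in [:: P0, P1, P2 & L] by move=> /sub; rewrite mem_filter => /andP[].
        by move: zL; rewrite !inE => /or3P[]->; rewrite ?orbT.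
      have [z zL ->] : exists2 z, z \in [:: P0; P1; P2] & M = m z; last exact: near_lt.
      rewrite /M; case: (leP (m P0) _) => _; last by exists P0; rewrite ?inE ?eqxx.
      by case: (leP (m P1) (m P2)) => _; [exists P2 | exists P1]; rewrite ?inE ?eqxx ?orbT.
    suff : K <= (1 + D) ^+ 3 * (2 * M) ^+ 6.
      apply/negP; rewrite -ltNge; apply: le_lt_trans hM; rewrite le_eqVlt; apply/orP; left.
      by apply/eqP; rewrite /c; ring.
    apply: (@ellipse_three_points D K (2 * M) P0 P1 P2) => //.
    + exact: (subseq_uniq (prefix_subseq [:: P0; P1; P2] L) uF).
    + move=> z zL; apply: hS.
      suff : z \in [:: P0, P1, P2 & L] by move=> /sub; rewrite mem_filter => /andP[].
      by move: zL; rewrite !inE => /or3P[]->; rewrite ?orbT.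
    + move=> z zL.
      have mz : m z <= M.
        by move: zL; rewrite /M !inE !le_max => /orP[]/eqP->; rewrite lexx ?orbT.
      have m0 : m P0 <= M by rewrite /M le_max lexx.
      move: mz m0; rewrite /m; clearbody M; case: (z) (P0) => [a b] [a0 b0] /=; lia.
  have KR0 : 0 < (K%:~R : R) by rewrite ltr0z.
  have cR1 : 1 <= (c%:~R : R) by rewrite ler1z.
  have cR0 : 0 <= (c%:~R : R) by exact: le_trans ler01 cR1.
  have e6 : 0 <= e / 6 by rewrite divr_ge0 // ltW.
  pose b : R := (c%:~R) `^ (e / 6) / (K%:~R) `^ (e / 6).
  apply: (@le_trans _ _ ((size S)%:R * b)).
    apply: (@le_trans _ _ ((count (fun z => ~~ (c * m z ^+ 6 < K)) S)%:R * b)); last first.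
      by rewrite ler_wpM2r ?ler_nat ?count_size // divr_ge0 ?powR_ge0.
    apply: ler_sum_const => z; rewrite -leNgt => hz.
    have hz' : (K%:~R : R) <= c%:~R * (m z)%:~R ^+ 6.
      by rewrite -rmorphXn /= -intrM ler_int.
    have mp : 0 < ((m z)%:~R : R) `^ e by rewrite powR_gt0 // (lt_le_trans ltr01).
    rewrite powRN -[leLHS]mul1r ler_pdivrMr // /b mulrAC ler_pdivlMr ?powR_gt0 // mul1r.
    have -> : ((m z)%:~R : R) `^ e = ((m z)%:~R ^+ 6) `^ (e / 6).
      by rewrite -powR_mulrn // -powRrM; congr (_ `^ _); field.
    rewrite -powRM ?exprn_ge0 //.
    by apply: ge0_ler_powR; rewrite // nnegrE ?mulr_ge0 ?exprn_ge0 // ltW.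
  have hd : ((size (divisors `|K|) ^ 2)%:R : R) <= (Cj.+1)%:R `^ (e / 6) * (K%:~R) `^ (e / 6).
    rewrite -powRM ?(ltW KR0) //.
    set d := size _; have dj : (d%:R : R) ^+ j <= (Cj.+1)%:R * K%:~R.
      have := hCj `|K|%N; rewrite absz_gt0 gt_eqF // => /(_ isT).
      rewrite -/d -(ler_nat R) natrX natrM => /le_trans; apply.
      rewrite (_ : (`|K|%N%:R : R) = K%:~R); last by rewrite natr_absz gtr0_norm.
      by rewrite ler_wpM2r ?ler_nat // ltW.
    have d0 : 0 <= (d%:R : R) by [].
    rewrite natrX.
    have -> : (d%:R : R) ^+ 2 = (d%:R ^+ j) `^ (2 / j%:R).
      rewrite -[in RHS]powR_mulrn // -powRrM -powR_mulrn //; congr (_ `^ _).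
      by rewrite mulrCA divff ?mulr1 // pnatr_eq0 -lt0n.
    apply: (@le_trans _ _ (((Cj.+1)%:R * K%:~R) `^ (2 / j%:R))).
      by apply: ge0_ler_powR; rewrite // ?nnegrE ?exprn_ge0 ?mulr_ge0 ?invr_ge0 // ltW.
    apply: ler_powR.
      by apply: mulr_ege1; rewrite ?ler1n // ler1z -gtz0_ge1.
    rewrite ler_pdivrMr ?ltr0n // -ler_pdivrMl ?divr_gt0 //.
    apply: ltW; apply: le_lt_trans j12; rewrite le_eqVlt; apply/orP; left; apply/eqP.
    by field; rewrite gt_eqF.
  have hsz : ((size S)%:R : R) <= (4 * c8)%:R * ((Cj.+1)%:R `^ (e / 6) * (K%:~R) `^ (e / 6)).
    apply: le_trans (_ : ((4 * c8) * size (divisors `|K|) ^ 2)%:R <= _).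
      by rewrite ler_nat -mulnA; apply: size_reps hS.
    by rewrite natrM ler_wpM2l.
  apply: le_trans (_ : (4 * c8)%:R * ((Cj.+1)%:R `^ (e / 6) * (K%:~R) `^ (e / 6)) * b <= _).
    by rewrite ler_wpM2r // divr_ge0 ?powR_ge0.
  rewrite /b /far le_eqVlt; apply/orP; left; apply/eqP.
  by field; rewrite gt_eqF // powR_gt0.
- apply: (@le_trans _ _ 1); last by clearbody far; lra.
  apply: le_trans (ler_sum_const _ (fun z _ => W1 z)) _; rewrite mulr1 count_predT lern1.
  apply: (@leq_trans (size [:: (0 : int, 0 : int)])) => //; apply: uniq_leq_size => // -[a b] /hS /=.
  rewrite K0 => /eqP; rewrite paddr_eq0 ?sqr_ge0 //; last by rewrite mulr_ge0 ?sqr_ge0 // ltW.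
  by rewrite sqrf_eq0 => /andP[/eqP->]; rewrite mulf_eq0 gt_eqF //= sqrf_eq0 => /eqP->.
Qed.

(** * Weighted counting of lattice points *)

Lemma ler_sum_subseq (R : numDomainType) (I : eqType) (S L : seq I) (F : I -> R) :
  uniq S -> {subset S <= L} -> (forall i, 0 <= F i) -> \sum_(i <- S) F i <= \sum_(i <- L) F i.
Proof.
elim: S L => [|x S IH] L /=; first by rewrite big_nil => _ _ F0; apply: sumr_ge0.
move=> /andP[xS uS] sub F0.
have xL : x \in L by apply: sub; rewrite mem_head.
rewrite big_cons (perm_big _ (perm_to_rem xL)) big_cons lerD2l; apply: IH => // y yS.
have : y \in L by apply: sub; rewrite in_cons yS orbT.
rewrite (perm_mem (perm_to_rem xL)) in_cons => /orP[/eqP yx|//].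
by move: xS; rewrite -yx yS.
Qed.

(** A bound on all finite subsums is how absolute summability is used throughout. *)
Definition sum_bounded (R : numDomainType) (I : eqType) (a : I -> R) (B : R) : Prop :=
  forall S : seq I, uniq S -> \sum_(i <- S) a i <= B.

Section TupleSums.
Variables (R : realType) (J : finType) (I : choiceType).

(** The list of all tuples with entries in [T]; such boxes are cofinal among the finite
    sets of tuples and sums of products over them factor. *)
Definition box (T : seq I) : seq {ffun J -> I} :=
  [seq [ffun c => val (g c)] | g : {ffun J -> seq_sub T}].

Lemma box_uniq T : uniq (box T).
Proof.
rewrite map_inj_uniq ?enum_uniq // => g g' /ffunP h; apply/ffunP => c; apply: val_inj.
by have := h c; rewrite !ffunE.
Qed.

Lemma mem_box T (z : {ffun J -> I}) : (forall c, z c \in T) -> z \in box T.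
Proof.
move=> hz; apply/mapP; exists [ffun c => SeqSub (hz c)]; first by rewrite mem_enum.
by apply/ffunP => c; rewrite !ffunE.
Qed.

Lemma sum_seq_sub (A : nmodType) (T : seq I) (F : I -> A) : uniq T ->
  \sum_(t : seq_sub T) F (val t) = \sum_(x <- T) F x.
Proof.
move=> uT; rewrite -(big_map val predT) /=.
apply: perm_big; apply: uniq_perm => //.
  by rewrite map_inj_uniq ?index_enum_uniq //; exact: val_inj.
move=> x; apply/mapP/idP => [[t _ ->]|xT]; first exact: valP.
by exists (SeqSub xT); rewrite ?mem_index_enum.
Qed.

Lemma sum_box (A : comPzSemiRingType) (T : seq I) (F : J -> I -> A) : uniq T ->
  \sum_(z <- box T) \prod_c F c (z c) = \prod_c \sum_(x <- T) F c x.
Proof.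
move=> uT; rewrite /box big_image /=.
under eq_bigr => g _ do under eq_bigr => c _ do rewrite ffunE.
rewrite -(bigA_distr_bigA (fun c (t : seq_sub T) => F c (val t))) /=.
by apply: eq_bigr => c _; rewrite sum_seq_sub.
Qed.

Definition entries (S : seq {ffun J -> I}) : seq I := undup [seq (z : {ffun J -> I}) c | z <- S, c <- enum J].

Lemma sub_box (S : seq {ffun J -> I}) (T : seq I) : {subset entries S <= T} -> {subset S <= box T}.
Proof.
move=> sub z zS; apply: mem_box => c; apply: sub; rewrite mem_undup.
by apply/allpairsP; exists (z, c); rewrite mem_enum.
Qed.

Lemma sum_bounded_prod (w : J -> I -> R) (C : J -> R) : (forall c x, 0 <= w c x) ->
  (forall c, sum_bounded (w c) (C c)) ->
  sum_bounded (fun z : {ffun J -> I} => \prod_c w c (z c)) (\prod_c C c).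
Proof.
move=> w0 hC S uS; pose T := entries S.
apply: le_trans (_ : \sum_(z <- box T) \prod_c w c (z c) <= _).
  apply: ler_sum_subseq => // [|z]; first exact: sub_box.
  exact: prodr_ge0.
rewrite sum_box ?undup_uniq //; apply: ler_prod => c _; rewrite sumr_ge0 //=.
by apply: hC; exact: undup_uniq.
Qed.

End TupleSums.

Lemma sum_fibers (R : numDomainType) (I J : eqType) (h : I -> J) (S : seq I)
    (F : I -> R) (G : J -> R) :
  (forall j, \sum_(i <- S | h i == j) F i <= G j) ->
  \sum_(i <- S) F i <= \sum_(j <- undup (map h S)) G j.
Proof.
move=> hG.
have -> : \sum_(i <- S) F i = \sum_(j <- undup (map h S)) \sum_(i <- S | h i == j) F i.
  rewrite (exchange_big_dep predT) //= [LHS]big_seq [RHS]big_seq; apply: eq_bigr => i iS.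
  rewrite -big_filter (_ : [seq j <- _ | h i == j] = [:: h i]) ?big_seq1 //.
  have : h i \in undup (map h S) by rewrite mem_undup map_f.
  move: (undup_uniq (map h S)); elim: (undup _) => //= j L IH /andP[jL uL].
  rewrite in_cons; case: eqP => [hj _|ne /= hL]; last exact: IH.
  rewrite hj; congr (_ :: _); apply/eqP; rewrite -size_eq0 size_filter -leqn0 leqNgt -has_count.
  by apply/hasPn => l lL; apply: contra jL => /eqP ->.
by apply: ler_sum.
Qed.

(** Comparing the terms [2 n] and [2 n + 1] with the term [n] shows that the sum is at most
    [1] plus [2 `^ (- e)] times itself. *)
Lemma sum_nat_weight (R : realType) (e : R) : 0 < e ->
  exists C : R, forall N, \sum_(0 <= n < N) (n.+1%:R : R) `^ (- (1 + e)) <= C.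
Proof.
move=> e0; pose w n : R := n.+1%:R `^ (- (1 + e)).
have w0 n : 0 <= w n by exact: powR_ge0.
have wmono m n : (m <= n)%N -> w n <= w m.
  move=> mn; rewrite /w !powRN lef_pV2 ?posrE ?powR_gt0 //.
  by apply: ge0_ler_powR; rewrite ?nnegrE ?ler_nat // ltW // addr_gt0.
pose q : R := 2 `^ (- e).
have q1 : q < 1.
  rewrite /q powRN invf_lt1 ?powR_gt0 //.
  have : 1 `^ e < 2 `^ e by rewrite gt0_ltr_powR ?nnegrE // ltr1n.
  by rewrite powR1.
have w2 n : w n.*2.+1 = q / 2 * w n.
  rewrite /w /q -doubleS -muln2 natrM powRM // mulrC; congr (_ * _).
  by rewrite opprD powRD ?pnatr_eq0 ?implybT // powR_inv1 // mulrC.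
exists ((1 - q)^-1) => N.
have hA M : \sum_(0 <= n < M.*2.+1) w n <= 1 + q * \sum_(0 <= n < M) w n.
  rewrite big_nat_recl // {1}/w powR1 lerD2l.
  elim: M => [|M IH]; first by rewrite !big_geq // mulr0.
  rewrite doubleS !big_nat_recr //= mulrDr -addrA lerD //.
  rewrite w2; have := wmono _ _ (leqnSn M.*2.+1); rewrite w2; lra.
have : \sum_(0 <= n < N.*2.+1) w n <= 1 + q * \sum_(0 <= n < N.*2.+1) w n.
  apply: le_trans (hA N) _; rewrite lerD2l ler_wpM2l ?powR_ge0 //.
  rewrite [leRHS](@big_cat_nat _ _ _ N) //=; first by rewrite lerDl sumr_ge0.
  by rewrite ltnW // ltnS -addnn leq_addr.
move=> h; apply: (@le_trans _ _ (\sum_(0 <= n < N.*2.+1) w n)).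
  rewrite [leRHS](@big_cat_nat _ _ _ N) //=; first by rewrite lerDl sumr_ge0.
  by rewrite ltnW // ltnS -addnn leq_addr.
rewrite -[leRHS]mul1r ler_pdivlMr ?subr_gt0 //; lra.
Qed.

Definition intw (R : realType) (e : R) (x : int) : R := (1 + `|x|)%:~R `^ (- (1 + e)).

Lemma intw_ge0 (R : realType) (e : R) x : 0 <= intw e x.
Proof. exact: powR_ge0. Qed.

Lemma sum_intw (R : realType) (e : R) : 0 < e ->
  exists C : R, forall S : seq int, uniq S -> \sum_(x <- S) intw e x <= C.
Proof.
move=> /sum_nat_weight[C hC]; exists (2 * C) => S uS.
have hN (T : seq nat) : uniq T -> \sum_(n <- T) (n.+1%:R : R) `^ (- (1 + e)) <= C.
  move=> uT; apply: le_trans (hC (\max_(n <- T) n).+1).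
  rewrite /index_iota subn0; apply: ler_sum_subseq => // n nT.
  by rewrite mem_iota add0n /= ltnS leq_bigmax_seq.
have hP (P : pred int) : {in P &, injective absz} -> \sum_(x <- S | P x) intw e x <= C.
  move=> inj; rewrite -big_filter.
  apply: le_trans (hN (map absz [seq x <- S | P x]) _).
    rewrite big_map le_eqVlt; apply/orP; left; apply/eqP; apply: eq_bigr => x _.
    by rewrite /intw -addn1 natrD natr_absz addrC intrD.
  rewrite map_inj_in_uniq ?filter_uniq // => x y.
  by rewrite !mem_filter => /andP[Px _] /andP[Py _]; apply: inj.
rewrite (bigID (fun x => 0 <= x)) /= mulr_natl mulr2n.
by apply: lerD; apply: hP => -[x|x] [y|y] // _ _ /= h; congr (_ _); lia.
Qed.

Lemma sum_prod_weight (R : realType) (J : finType) (w : int -> R) (C : R) :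
  (forall x, 0 <= w x) -> sum_bounded w C ->
  sum_bounded (fun z : {ffun J -> int} => \prod_c w (z c)) (C ^+ #|J|).
Proof.
move=> w0 hC; have := @sum_bounded_prod R J int (fun=> w) (fun=> C) (fun=> w0) (fun=> hC).
by rewrite prodr_const.
Qed.

(** Completing squares turns [2 x^2 + 2 y^2 + 2 kap x y - 2 al x - 2 be y] into
    [u^2 + v^2] when [kap = 0] and into [v^2 + 3 u^2] when [kap = 1]. *)
Lemma sum_conic_weight (R : realType) (e : R) : 0 < e ->
  exists C : R, forall (kap : bool) (al be c : int) (S : seq (int * int)), uniq S ->
    (kap -> al = be) ->
    (forall z, z \in S -> 2 * z.1 ^+ 2 + 2 * z.2 ^+ 2 + 2 * kap%:R * z.1 * z.2
                          - 2 * al * z.1 - 2 * be * z.2 = c) ->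
    \sum_(z <- S) ((1 + `|z.1| + `|z.2|)%:~R : R) `^ (- e) <= C.
Proof.
move=> e0.
have main (D : int) : 0 < D -> exists C : R, 0 <= C /\
    forall (K u0 v0 : int) (f : int * int -> int * int) (S : seq (int * int)),
    uniq S -> injective f -> (forall z, z \in S -> (f z).1 ^+ 2 + D * (f z).2 ^+ 2 = K) ->
    (forall z, `|(f z).1 - u0| + `|(f z).2 - v0| <= 4 * (`|z.1| + `|z.2|)) ->
    \sum_(z <- S) ((1 + `|z.1| + `|z.2|)%:~R : R) `^ (- e) <= C.
  move=> D0; have [C hC] := sum_ellipse_weight D0 e0.
  have C0 : 0 <= C by have := hC 0 0 0 [::] isT; rewrite big_nil; apply.
  exists (4 `^ e * C); split; first by rewrite mulr_ge0 ?powR_ge0.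
  move=> K u0 v0 f S uS inj hK hf.
  have := hC K u0 v0 (map f S); rewrite map_inj_uniq // => /(_ uS) h.
  apply: (@le_trans _ _ (4 `^ e * \sum_(z <- map f S)
      ((1 + `|z.1 - u0| + `|z.2 - v0|)%:~R : R) `^ (- e))); last first.
    by rewrite ler_wpM2l ?powR_ge0 //; apply: h => _ /mapP[z zS ->]; exact: hK.
  rewrite big_map mulr_sumr; apply: ler_sum => z _.
  set a := 1 + `|z.1| + `|z.2|; set b := 1 + _ + _.
  have a1 : 1 <= a by rewrite /a -addrA lerDl addr_ge0.
  have b1 : 1 <= b by rewrite /b -addrA lerDl addr_ge0.
  have ab : b <= 4 * a by have := hf z; rewrite /a /b; lia.
  have aR : 0 < (a%:~R : R) by rewrite ltr0z; lia.
  have bR : 0 < (b%:~R : R) by rewrite ltr0z; lia.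
  rewrite !powRN ler_pdivlMr ?powR_gt0 // mulrC ler_pdivrMr ?powR_gt0 //.
  rewrite -powRM // ?(ltW aR) //; apply: ge0_ler_powR; rewrite ?nnegrE ?mulr_ge0 ?(ltW e0) ?(ltW aR) ?(ltW bR) //.
  by rewrite -[4]/(4%:~R) -intrM ler_int.
have [C1 [C10 h1]] := main 1 isT; have [C3 [C30 h3]] := main 3 isT.
exists (C1 + C3) => -[] al be c S uS hab hS.
  have eab := hab isT; rewrite -{be hab}eab in hS *.
  apply: (@le_trans _ _ C3); last by rewrite lerDr.
  apply: (h3 (6 * c + 4 * al ^+ 2) (- al) (- al) (fun z => (3 * z.2 - al, 2 * z.1 + z.2 - al))) => //.
  - by move=> [a b] [a' b'] [/= h h']; congr pair; lia.
  - by move=> [a b] /hS /= <-; ring.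
  - by move=> [a b] /=; lia.
apply: (@le_trans _ _ C1); last by rewrite lerDl.
apply: (h1 (2 * c + al ^+ 2 + be ^+ 2) (- al) (- be) (fun z => (2 * z.1 - al, 2 * z.2 - be))) => //.
- by move=> [a b] [a' b'] [/= h h']; congr pair; lia.
- by move=> [a b] /hS /= <-; ring.
- by move=> [a b] /=; lia.
Qed.

(** This is [|sg - sum_b z_b|^2 + sum_b |z_b|^2] for [k] vectors [z_b], written over the
    [k * d] scalar coordinates so that any two of them can be singled out. *)
Definition quadform (k d : nat) (sg : 'I_d -> int) (z : {ffun 'I_k * 'I_d -> int}) : int :=
  \sum_i (sg i - \sum_b z (b, i)) ^+ 2 + \sum_c z c ^+ 2.

Lemma quadform_two_coords (k d : nat) (sg : 'I_d -> int) (z z0 : {ffun 'I_k * 'I_d -> int})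
    (p q : 'I_k * 'I_d) : p != q -> z0 p = 0 -> z0 q = 0 ->
  (forall c, c != p -> c != q -> z c = z0 c) ->
  let r i := sg i - \sum_b z0 (b, i) in
  quadform sg z = quadform sg z0 + (2 * z p ^+ 2 + 2 * z q ^+ 2 + 2 * (p.2 == q.2)%:R * z p * z q
    - 2 * r p.2 * z p - 2 * r q.2 * z q).
Proof.
move=> pq p0 q0 hz r.
have zE c : z c = z0 c + (c == p)%:R * z p + (c == q)%:R * z q.
  have [->|np] := eqVneq c p; first by rewrite (negbTE pq) p0 mul1r mul0r add0r addr0.
  have [->|nq] := eqVneq c q; first by rewrite q0 mul1r mul0r !add0r.
  by rewrite !mul0r !addr0 hz.
set x := z p in zE *; set y := z q in zE *.
have sumd (I : finType) (a : I) (F : I -> int) : \sum_i (i == a)%:R * F i = F a.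
  rewrite (bigD1 a) //= eqxx mul1r big1 ?addr0 // => i /negbTE ->; exact: mul0r.
have lin i : \sum_b z (b, i) = \sum_b z0 (b, i) + (i == p.2)%:R * x + (i == q.2)%:R * y.
  under eq_bigr => b _ do rewrite zE.
  rewrite !big_split /=; congr (_ + _ + _).
    case: p {pq p0 hz zE} @x => [p1 p2] x /=.
    rewrite (bigD1 p1) //= big1 ?addr0 ?xpair_eqE ?eqxx //= => b /negbTE bp.
    by rewrite xpair_eqE bp mul0r.
  case: q {pq q0 hz zE} @y => [p1 p2] y /=.
  rewrite (bigD1 p1) //= big1 ?addr0 ?xpair_eqE ?eqxx //= => b /negbTE bp.
  by rewrite xpair_eqE bp mul0r.
have s1 : \sum_i (sg i - \sum_b z (b, i)) ^+ 2 = \sum_i (r i) ^+ 2 + (x ^+ 2 + y ^+ 2 +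
    2 * (p.2 == q.2)%:R * x * y - 2 * r p.2 * x - 2 * r q.2 * y).
  have -> : \sum_i (sg i - \sum_b z (b, i)) ^+ 2 = \sum_i (r i) ^+ 2 +
     (\sum_i (i == p.2)%:R * (x ^+ 2 + 2 * (i == q.2)%:R * x * y - 2 * r i * x) +
      \sum_i (i == q.2)%:R * (y ^+ 2 - 2 * r i * y)).
    rewrite -!big_split /=; apply: eq_bigr => i _; rewrite lin /r.
    by case: (i == p.2); case: (i == q.2); rewrite ?mul1r ?mul0r ?mulr1 ?mulr0; ring.
  by rewrite !sumd; ring.
have s2 : \sum_c z c ^+ 2 = \sum_c z0 c ^+ 2 + (x ^+ 2 + y ^+ 2).
  have -> : \sum_c z c ^+ 2 = \sum_c z0 c ^+ 2 +
     (\sum_c (c == p)%:R * (x ^+ 2 + 2 * z0 c * x) + \sum_c (c == q)%:R * (y ^+ 2 + 2 * z0 c * y)).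
    rewrite -!big_split /=; apply: eq_bigr => c _; rewrite [in LHS]zE.
    have [->|np] := eqVneq c p; first by rewrite (negbTE pq) p0 !mul1r !mul0r; ring.
    by have [->|nq] := eqVneq c q; rewrite ?q0 ?mul1r ?mul0r; ring.
  by rewrite !sumd p0 q0; ring.
by rewrite /quadform s1 s2; ring.
Qed.

Lemma two_largest (R : realDomainType) (J : finType) (a : J -> R) : (1 < #|J|)%N ->
  (forall c, 1 <= a c) ->
  exists p q, p != q /\ (\prod_c a c) ^+ 2 <= (a p * a q) ^+ #|J|.
Proof.
move=> J1 a1; have a0 c : 0 <= a c by exact: le_trans ler01 (a1 c).
have [i0 [i1 [_ _ i01]]] := card_gt1P J1.
pose p := [arg max_(i > i0) a i]%O.
have hp c : a c <= a p by rewrite /p; case: arg_maxP => // i _; apply.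
have [j0 j0p] : exists j, j != p.
  by have [e|] := eqVneq i0 p; [exists i1; rewrite -e eq_sym | exists i0].
pose q := [arg max_(i > j0 | i != p) a i]%O.
have [qp hq] : q != p /\ forall c, c != p -> a c <= a q by rewrite /q; case: arg_maxP.
exists p, q; split; first by rewrite eq_sym.
have [N eN] : exists N, #|J| = N.+2 by case: #|J| J1 => [|[|N]] // _; exists N.
rewrite (bigD1 p) //= (bigD1 q) //= mulrA [leLHS]exprMn eN -[N.+2]/(2 + N)%N exprD.
apply: ler_wpM2l; first exact: sqr_ge0.
have : \prod_(c | (c != p) && (c != q)) a c <= a q ^+ N.
  apply: le_trans (_ : \prod_(c | (c != p) && (c != q)) a q <= _).
    by apply: ler_prod => c /andP[cp _]; rewrite a0 hq.
  rewrite prodr_const (_ : #|_| = N) //.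
  have := cardC [pred c | (c == p) || (c == q)]; rewrite eN.
  have -> : #|[pred c | (c == p) || (c == q)]| = 2%N.
    by have := card2 p q; rewrite eq_sym qp => <-; apply: eq_card => c; rewrite !inE.
  rewrite add2n => -[] <-; apply: eq_card => c; by rewrite !inE negb_or.
move=> h; apply: (@le_trans _ _ ((a q ^+ N) ^+ 2)).
  by rewrite lerXn2r ?nnegrE ?prodr_ge0 ?exprn_ge0.
rewrite -exprM mulnC exprM lerXn2r ?nnegrE ?exprn_ge0 ?mulr_ge0 //.
by rewrite expr2 ler_wpM2r.
Qed.

Definition zero2 (J : finType) (p q : J) (z : {ffun J -> int}) : {ffun J -> int} :=
  [ffun c => if (c == p) || (c == q) then 0 else z c].

Lemma prod_powR (R : realType) (I : Type) (r : seq I) (P : pred I) (a : I -> R) (x : R) :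
  (forall i, 0 <= a i) -> \prod_(i <- r | P i) (a i `^ x) = (\prod_(i <- r | P i) a i) `^ x.
Proof.
move=> a0; suff [] : 0 <= \prod_(i <- r | P i) a i /\
    \prod_(i <- r | P i) (a i `^ x) = (\prod_(i <- r | P i) a i) `^ x by [].
elim/big_rec2: _ => [|i y1 y2 _ [y0 ->]]; first by rewrite powR1.
by rewrite mulr_ge0 // powRM.
Qed.

(** The geometric mean of all coordinates is at most that of the two largest ones:
    summability of the remaining coordinates and a small power of the two largest
    ones can both be extracted from the weight. *)
Lemma weight_split (R : realType) (J : finType) (e : R) (z : {ffun J -> int}) :
  (1 < #|J|)%N -> 0 < e ->
  \prod_c ((1 + `|z c|)%:~R : R) `^ (- (1 - 2 / #|J|%:R + e)) <=
  \sum_(pq : J * J | pq.1 != pq.2) (\prod_c intw e (zero2 pq.1 pq.2 z c)) *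
     ((1 + `|z pq.1| + `|z pq.2|)%:~R : R) `^ (- e).
Proof.
move=> J1 e0; set N := #|J| in J1 *; have N0 : (N%:R : R) != 0 by rewrite pnatr_eq0; case: N J1.
pose a c : R := (1 + `|z c|)%:~R.
have a1 c : 1 <= a c by rewrite ler1z lerDl.
have a_gt0 c : 0 < a c by exact: lt_le_trans ltr01 (a1 c).
have a0 c : 0 <= a c by exact: ltW.
have [p [q [pq hpq]]] := two_largest J1 a1.
have P0 : 0 < \prod_c a c by exact: prodr_gt0.
have pq0 : 0 < a p * a q by exact: mulr_gt0.
have gm : (\prod_c a c) `^ (2 / N%:R) <= a p * a q.
  rewrite powRrM powR_mulrn ?(ltW P0) //.
  apply: (@le_trans _ _ (((a p * a q) ^+ N) `^ N%:R^-1)).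
    by apply: ge0_ler_powR; rewrite ?invr_ge0 ?nnegrE ?exprn_ge0 // ltW.
  by rewrite -powR_mulrn ?(ltW pq0) // -powRrM divff // powRr1 // ltW.
rewrite (bigD1 (p, q)) //=; apply: (@le_trans _ _ ((\prod_c intw e (zero2 p q z c)) *
     ((1 + `|z p| + `|z q|)%:~R : R) `^ (- e))); last first.
  rewrite lerDl; apply: sumr_ge0 => ? _; rewrite mulr_ge0 ?powR_ge0 //.
  by apply: prodr_ge0 => c _; exact: intw_ge0.
have -> : \prod_c intw e (zero2 p q z c) = (a p * a q) `^ (1 + e) * (\prod_c a c) `^ (- (1 + e)).
  rewrite -prod_powR // (bigD1 p) // (bigD1 q) 1?eq_sym //= [in RHS](bigD1 p) // [in RHS](bigD1 q) 1?eq_sym //=.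
  rewrite /intw !ffunE !eqxx orbT /= normr0 addr0 powR1 !mul1r.
  rewrite [in RHS]mulrA [in RHS]mulrA -mulrA -(powRM _ (ltW (a_gt0 p)) (ltW (a_gt0 q))) mulrA.
  rewrite -powRD ?(gt_eqF pq0) ?implybT // subrr powRr0 mul1r.
  by apply: eq_bigr => c /andP[/negbTE cp /negbTE cq]; rewrite ffunE cp cq.
rewrite prod_powR // (_ : - (1 - 2 / N%:R + e) = - (1 + e) + 2 / N%:R); last by ring.
rewrite powRD ?(gt_eqF P0) ?implybT // mulrAC mulrC ler_pM2r ?powR_gt0 //.
apply: le_trans gm _; set b : R := (1 + `|z p| + `|z q|)%:~R.
have b1 : 1 <= b by rewrite /b ler1z -addrA lerDl addr_ge0.
have b0 : 0 < b by exact: lt_le_trans b1.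
have bpq : b <= a p * a q.
  by rewrite /b /a -intrM ler_int; have := normr_ge0 (z p); have := normr_ge0 (z q); nia.
rewrite powRN powRD ?(gt_eqF pq0) ?implybT // powRr1 ?(ltW pq0) // -[leRHS]mulrA ler_peMr ?(ltW pq0) //.
rewrite ler_pdivlMr ?powR_gt0 // mul1r.
by apply: ge0_ler_powR; rewrite ?nnegrE // ltW.
Qed.

Lemma sum_quadform_coords (R : realType) (k d : nat) (e : R) : (1 < k * d)%N -> 0 < e ->
  exists C : R, forall (sg : 'I_d -> int) (tau : int) (S : seq {ffun 'I_k * 'I_d -> int}),
    uniq S -> (forall z, z \in S -> quadform sg z = tau) ->
    \sum_(z <- S) \prod_c ((1 + `|z c|)%:~R : R) `^ (- (1 - 2 / (k * d)%:R + e)) <= C.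
Proof.
move=> kd e0; have cardJ : #|{: 'I_k * 'I_d}| = (k * d)%N by rewrite card_prod !card_ord.
have [C hC] := sum_conic_weight e0; have [C' hC'] := sum_intw e0.
have C0 : 0 <= C by have := hC false 0 0 0 [::] isT; rewrite big_nil; apply.
pose N := #|{: 'I_k * 'I_d}|.
exists (\sum_(pq : ('I_k * 'I_d) * ('I_k * 'I_d) | pq.1 != pq.2) (C' ^+ N * C)) => sg tau S uS hS.
apply: le_trans (_ : \sum_(z <- S) \sum_(pq : ('I_k * 'I_d) * ('I_k * 'I_d) | pq.1 != pq.2)
   (\prod_c intw e (zero2 pq.1 pq.2 z c)) * ((1 + `|z pq.1| + `|z pq.2|)%:~R : R) `^ (- e) <= _).
  by apply: ler_sum => z _; rewrite -cardJ; apply: weight_split; rewrite ?cardJ.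
rewrite exchange_big /=; apply: ler_sum => -[p q] /= pq.
pose h (z : {ffun 'I_k * 'I_d -> int}) := zero2 p q z.
pose G (z0 : {ffun 'I_k * 'I_d -> int}) := (\prod_c intw e (z0 c)) * C.
apply: le_trans (sum_fibers (h := h) (G := G) _) _; last first.
  rewrite -mulr_suml ler_wpM2r //; apply: (sum_prod_weight (@intw_ge0 _ e) hC').
  exact: undup_uniq.
move=> z0.
rewrite (eq_bigr (fun z : {ffun 'I_k * 'I_d -> int} => (\prod_c intw e (z0 c)) *
    ((1 + `|z p| + `|z q|)%:~R : R) `^ (- e))); last by move=> z /eqP <-.
rewrite -mulr_sumr /G ler_wpM2l ?prodr_ge0 //; first by move=> c _; exact: intw_ge0.
rewrite -big_filter; set S0 := [seq z <- S | h z == z0].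
have [S0e|] := eqVneq S0 [::]; first by rewrite S0e big_nil.
case E : S0 => [|z1 S1] // _.
have : z1 \in S0 by rewrite E mem_head.
rewrite -E {E} => z1S.
have inS0 z : z \in S0 -> h z = z0 /\ quadform sg z = tau.
  by rewrite mem_filter => /andP[/eqP hz zS]; split=> //; exact: hS.
have hc z c : z \in S0 -> c != p -> c != q -> z c = z0 c.
  by move=> /inS0[<- _] /negbTE cp /negbTE cq; rewrite ffunE cp cq.
have z0p : z0 p = 0 by have [<- _] := inS0 _ z1S; rewrite ffunE eqxx.
have z0q : z0 q = 0 by have [<- _] := inS0 _ z1S; rewrite ffunE eqxx orbT.
pose r i := sg i - \sum_b z0 (b, i).
have := hC (p.2 == q.2) (r p.2) (r q.2) (tau - quadform sg z0) [seq (z p, z q) | z : {ffun 'I_k * 'I_d -> int} <- S0].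
rewrite big_map /=; apply.
- rewrite map_inj_in_uniq ?filter_uniq // => z z' zS z'S [ep eq]; apply/ffunP => c.
  have [->//|cp] := eqVneq c p; have [->//|cq] := eqVneq c q.
  by rewrite !hc.
- by move=> /eqP ->.
- move=> _ /mapP[z zS ->] /=; have [_ <-] := inS0 _ zS.
  rewrite (@quadform_two_coords _ _ sg z z0 p q) //; last by move=> c; exact: hc.
  by rewrite (addrC (quadform _ _)) addrK.
Qed.

Definition isq (d : nat) (n : 'rV[int]_d) : int := \sum_i (n 0 i) ^+ 2.

Lemma sqfreqE (R : realType) (d : nat) (n : 'rV[int]_d) : sqfreq R n = (isq n)%:~R.
Proof. by rewrite /sqfreq /isq rmorph_sum /=; apply: eq_bigr => i _; rewrite rmorphXn. Qed.

Lemma sqfreq_ge0 (R : realType) (d : nat) (n : 'rV[int]_d) : 0 <= sqfreq R n.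
Proof. by apply: sumr_ge0 => i _; exact: sqr_ge0. Qed.

Lemma japanese_ge1 (R : realType) (d : nat) (n : 'rV[int]_d) : 1 <= japanese R n.
Proof. by rewrite /japanese -[leLHS]sqrtr1 ler_wsqrtr // lerDl sqfreq_ge0. Qed.

Lemma japanese_gt0 (R : realType) (d : nat) (n : 'rV[int]_d) : 0 < japanese R n.
Proof. exact: lt_le_trans ltr01 (japanese_ge1 _ _). Qed.

Lemma coord_le_japanese (R : realType) (d : nat) (n : 'rV[int]_d) i :
  (1 + `|n 0 i|)%:~R <= 2 * japanese R n.
Proof.
rewrite intrD mulr_natl mulr2n lerD ?japanese_ge1 //.
rewrite /japanese -[leLHS]ger0_norm ?ler0z // -sqrtr_sqr ler_wsqrtr //.
rewrite -rmorphXn /= real_normK ?num_real // rmorphXn /= /sqfreq (bigD1 i) //= addrCA lerDl addr_ge0 //.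
by apply: sumr_ge0 => j _; exact: sqr_ge0.
Qed.

Lemma japanese_weight (R : realType) (d : nat) (t : R) (n : 'rV[int]_d) : 0 <= t ->
  japanese R n `^ (- (d%:R * t)) <=
    2 `^ (d%:R * t) * \prod_i ((1 + `|n 0 i|)%:~R : R) `^ (- t).
Proof.
move=> t0; have j0 := japanese_gt0 R n.
have : \prod_(i < d) (2 * japanese R n) `^ (- t) <= \prod_i ((1 + `|n 0 i|)%:~R : R) `^ (- t).
  apply: ler_prod => i _; rewrite powR_ge0 /= !powRN lef_pV2 ?posrE ?powR_gt0 ?mulr_gt0 ?ltr0z //.
    apply: ge0_ler_powR; rewrite ?nnegrE ?coord_le_japanese //.
    by rewrite mulr_ge0 // ltW.
rewrite prodr_const card_ord -powR_mulrn ?powR_ge0 // -powRrM mulNr (mulrC t) powRM ?(ltW j0) //.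
by rewrite [X in X * _ <= _]powRN ler_pdivrMl ?powR_gt0.
Qed.

Definition flat (k d : nat) (z : {ffun 'I_k -> 'rV[int]_d}) : {ffun 'I_k * 'I_d -> int} :=
  [ffun c => z c.1 0 c.2].

Lemma flat_inj (k d : nat) : injective (@flat k d).
Proof.
move=> z z' /ffunP h; apply/ffunP => b; apply/rowP => i.
by have := h (b, i); rewrite !ffunE.
Qed.

Lemma flat_weight (R : realType) (k d : nat) (t s : R) (z : {ffun 'I_k -> 'rV[int]_d}) :
  0 <= t -> 2 * s = d%:R * t ->
  \prod_b (japanese R (z b) `^ (- s)) ^+ 2 <=
    (2 `^ (d%:R * t)) ^+ k * \prod_c ((1 + `|flat z c|)%:~R : R) `^ (- t).
Proof.
move=> t0 e.
have -> : \prod_c ((1 + `|flat z c|)%:~R : R) `^ (- t) =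
    \prod_b \prod_i ((1 + `|z b 0 i|)%:~R : R) `^ (- t).
  by rewrite pair_bigA /=; apply: eq_bigr => c _; rewrite ffunE.
rewrite -[k in _ ^+ k]card_ord -prodr_const -big_split /=.
apply: ler_prod => b _; rewrite sqr_ge0 /=.
have := japanese_weight (z b) t0.
by rewrite -e (mulrC 2) -mulNr powRrM powR_mulrn ?powR_ge0.
Qed.

Lemma quadform_flat (k d : nat) (sg : 'rV[int]_d) (z : {ffun 'I_k -> 'rV[int]_d}) :
  quadform (fun i => sg 0 i) (flat z) = isq (sg - \sum_b z b) + \sum_b isq (z b).
Proof.
rewrite /quadform /isq; congr (_ + _).
  apply: eq_bigr => i _; rewrite !mxE summxE; congr ((_ - _) ^+ 2).
  by apply: eq_bigr => b _; rewrite ffunE.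
by rewrite pair_bigA /=; apply: eq_bigr => c _; rewrite ffunE.
Qed.

(** A quadratic equation saves two powers of the size of the tuple, which is why [s] may
    go down to [d / 2 - 1 / k] instead of [d / 2]. *)
Lemma sum_sphere_tuples (R : realType) (k d : nat) (s : R) : (1 < k * d)%N ->
  d%:R / 2 - 1 / k%:R < s ->
  exists C : R, forall (sg : 'rV[int]_d) (tau : int) (S : seq {ffun 'I_k -> 'rV[int]_d}),
    uniq S -> (forall z, z \in S -> isq (sg - \sum_b z b) + \sum_b isq (z b) = tau) ->
    \sum_(z <- S) \prod_b (japanese R (z b) `^ (- s)) ^+ 2 <= C.
Proof.
move=> kd hs.
have k0 : 0 < k%:R :> R by rewrite ltr0n; case: k kd {hs}.
have d0 : 0 < d%:R :> R by rewrite ltr0n; move: kd {hs k0}; case: d => //; rewrite muln0.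
pose e := (2 * s - (d%:R - 2 / k%:R)) / d%:R.
have e0 : 0 < e by rewrite divr_gt0 //; lra.
have [C hC] := sum_quadform_coords kd e0.
pose t := 1 - 2 / (k * d)%:R + e.
have t0 : 0 <= t.
  rewrite addr_ge0 ?(ltW e0) // subr_ge0 ler_pdivrMr ?ltr0n ?(ltn_trans _ kd) // mul1r ler_nat //.
have et : 2 * s = d%:R * t by rewrite /t /e natrM; field; rewrite !gt_eqF.
exists ((2 `^ (d%:R * t)) ^+ k * C) => sg tau S uS hS.
apply: le_trans (ler_sum _ (fun z _ => flat_weight z t0 et)) _.
rewrite -mulr_sumr ler_wpM2l ?exprn_ge0 ?powR_ge0 //.
rewrite -(big_map (@flat k d) predT (fun z => \prod_c ((1 + `|z c|)%:~R : R) `^ (- t))).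
apply: (hC (fun i => sg 0 i) tau); first by rewrite map_inj_uniq //; exact: flat_inj.
by move=> _ /mapP[z zS ->]; rewrite quadform_flat hS.
Qed.

Lemma sum_tuples (R : realType) (k d : nat) (s : R) : (0 < d)%N -> d%:R / 2 < s ->
  exists C : R, forall S : seq {ffun 'I_k -> 'rV[int]_d}, uniq S ->
    \sum_(z <- S) \prod_b (japanese R (z b) `^ (- s)) ^+ 2 <= C.
Proof.
move=> d0 hs; have d0' : 0 < d%:R :> R by rewrite ltr0n.
pose e := (2 * s - d%:R) / d%:R; have e0 : 0 < e by rewrite divr_gt0 //; lra.
have [C hC] := sum_intw e0; pose t := 1 + e.
have t0 : 0 <= t by rewrite addr_ge0 // ltW.
have et : 2 * s = d%:R * t by rewrite /t /e; field; rewrite gt_eqF.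
exists ((2 `^ (d%:R * t)) ^+ k * C ^+ #|{: 'I_k * 'I_d}|) => S uS.
apply: le_trans (ler_sum _ (fun z _ => flat_weight z t0 et)) _.
rewrite -mulr_sumr ler_wpM2l ?exprn_ge0 ?powR_ge0 //.
rewrite -(big_map (@flat k d) predT (fun z => \prod_c ((1 + `|z c|)%:~R : R) `^ (- t))).
apply: (sum_prod_weight (@intw_ge0 _ e) hC); rewrite map_inj_uniq //; exact: flat_inj.
Qed.

(** * The multilinear estimate for finitely many frequencies *)

Lemma sum_mul_sqr_le (R : realDomainType) (I : Type) (r : seq I) (a b : I -> R) :
  (\sum_(i <- r) a i * b i) ^+ 2 <= (\sum_(i <- r) a i ^+ 2) * (\sum_(i <- r) b i ^+ 2).
Proof.
have : 0 <= \sum_(i <- r) \sum_(j <- r) (a i * b j - a j * b i) ^+ 2.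
  by apply: sumr_ge0 => i _; apply: sumr_ge0 => j _; exact: sqr_ge0.
set A := \sum_(i <- r) a i ^+ 2; set B := \sum_(i <- r) b i ^+ 2; set P := \sum_(i <- r) a i * b i.
suff -> : \sum_(i <- r) \sum_(j <- r) (a i * b j - a j * b i) ^+ 2 = (A * B - P ^+ 2) *+ 2.
  by rewrite pmulrn_lge0 // subr_ge0.
have inner i : \sum_(j <- r) (a i * b j - a j * b i) ^+ 2 = a i ^+ 2 * B + b i ^+ 2 * A - a i * b i * P *+ 2.
  rewrite !mulr_sumr -sumrMnl -big_split -sumrB /=; apply: eq_bigr => j _; ring.
rewrite (eq_bigr _ (fun i _ => inner i)) sumrB big_split /= -!mulr_suml sumrMnl -mulr_suml -/A -/B -/P.
by rewrite mulrnBl [in RHS]mulr2n (mulrC B A) -expr2.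
Qed.

Definition sgz_if (G : zmodType) (b : bool) (x : G) : G := if b then - x else x.

Section Energy.
Variables (R : realFieldType) (T I : finType) (G : zmodType) (phi : T -> G).
Implicit Types (eps : I -> bool) (h : I -> T -> R) (z : {ffun I -> T}).

Definition sgsum eps z : G := \sum_i sgz_if (eps i) (phi (z i)).

(** The squared [l^2] norm of the map sending a value to the weighted number of
    tuples at which the signed sum [sgsum] takes it. *)
Definition energy eps h : R :=
  \sum_z \sum_z' (if sgsum eps z == sgsum eps z' then
    (\prod_i h i (z i)) * (\prod_i h i (z' i)) else 0).

Definition swap_at eps (zz : {ffun I -> T} * {ffun I -> T}) :=
  ([ffun i => if eps i then zz.2 i else zz.1 i],
   [ffun i => if eps i then zz.1 i else zz.2 i]).

Lemma swap_atK eps : involutive (swap_at eps).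
Proof. by move=> [z z']; rewrite /swap_at /=; congr pair; apply/ffunP => i; rewrite !ffunE; case: (eps i). Qed.

(** Exchanging the two copies of the entries carrying a minus sign moves them to the
    other side of the equation. Complex conjugation of a factor is therefore
    invisible in [L^2] norms of products. *)
Lemma energy_sign eps h : energy eps h = energy (fun=> false) h.
Proof.
rewrite /energy !pair_bigA /= (reindex_inj (inv_inj (swap_atK eps))) /=.
apply: eq_bigr => -[z z'] _ /=.
rewrite -subr_eq0 -[in RHS]subr_eq0 /sgsum -!sumrB.
have -> : \sum_i (sgz_if (eps i) (phi ([ffun i => if eps i then z' i else z i] i)) -
     sgz_if (eps i) (phi ([ffun i => if eps i then z i else z' i] i))) =
   \sum_i (sgz_if false (phi (z i)) - sgz_if false (phi (z' i))).
  apply: eq_bigr => i _; rewrite !ffunE /sgz_if; case: (eps i) => //.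
  by rewrite opprK addrC.
case: ifP => // _; rewrite -!big_split /=; apply: eq_bigr => i _; rewrite !ffunE.
by case: (eps i) => //; rewrite mulrC.
Qed.

(** The geometric mean of the crossed weights [(b z * w z') ^+ 2] and [(b z' * w z) ^+ 2]
    lets one copy of the tuple be summed freely and the other one over a level set. *)
Lemma energy_le (w b : I -> T -> R) (C : R) :
  (forall i t, 0 <= w i t) -> (forall i t, 0 <= b i t) ->
  (forall sg, \sum_(z | sgsum (fun=> false) z == sg) \prod_i w i (z i) ^+ 2 <= C) ->
  energy (fun=> false) (fun i t => w i t * b i t) <= C * \prod_i \sum_t b i t ^+ 2.
Proof.
move=> w0 b0 hC; rewrite /energy.
pose B z := \prod_i b i (z i) ^+ 2; pose W z := \prod_i w i (z i) ^+ 2.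
have B0 z : 0 <= B z by apply: prodr_ge0 => i _; exact: sqr_ge0.
have W0 z : 0 <= W z by apply: prodr_ge0 => i _; exact: sqr_ge0.
pose E (z z' : {ffun I -> T}) := sgsum (fun=> false) z == sgsum (fun=> false) z'.
apply: (@le_trans _ _ (\sum_z \sum_z' (if E z z' then (B z * W z' + B z' * W z) / 2 else 0))).
  apply: ler_sum => z _; apply: ler_sum => z' _; rewrite /E; case: ifP => // _.
  rewrite !big_split /=.
  set w1 := \prod_i w i (z i); set w2 := \prod_i w i (z' i).
  set b1 := \prod_i b i (z i); set b2 := \prod_i b i (z' i).
  have -> : B z = b1 ^+ 2 by rewrite /B prodrXl.
  have -> : B z' = b2 ^+ 2 by rewrite /B prodrXl.
  have -> : W z = w1 ^+ 2 by rewrite /W prodrXl.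
  have -> : W z' = w2 ^+ 2 by rewrite /W prodrXl.
  have : 0 <= (b1 * w2 - b2 * w1) ^+ 2 by exact: sqr_ge0.
  by lra.
have half : \sum_z \sum_z' (if E z z' then B z * W z' else 0) <= C * \prod_i \sum_t b i t ^+ 2.
  apply: (@le_trans _ _ (\sum_z B z * C)).
    apply: ler_sum => z _; rewrite -big_mkcond /= -mulr_sumr ler_wpM2l //.
    apply: le_trans (hC (sgsum (fun=> false) z)); rewrite le_eqVlt; apply/orP; left; apply/eqP.
    by apply: eq_bigl => z'; rewrite /E eq_sym.
  rewrite -mulr_suml mulrC ler_wpM2l //; last by rewrite bigA_distr_bigA.
  by apply: le_trans (hC 0); apply: sumr_ge0 => z _; exact: W0.
have half' : \sum_z \sum_z' (if E z z' then B z' * W z else 0) <= C * \prod_i \sum_t b i t ^+ 2.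
  rewrite exchange_big /=; apply: le_trans half; rewrite le_eqVlt; apply/orP; left; apply/eqP.
  by apply: eq_bigr => z _; apply: eq_bigr => z' _; rewrite /E eq_sym.
have -> : \sum_z \sum_z' (if E z z' then (B z * W z' + B z' * W z) / 2 else 0) =
   (\sum_z \sum_z' (if E z z' then B z * W z' else 0) +
    \sum_z \sum_z' (if E z z' then B z' * W z else 0)) / 2.
  rewrite -big_split mulr_suml /=; apply: eq_bigr => z _.
  rewrite -big_split mulr_suml /=; apply: eq_bigr => z' _; case: ifP => // _.
  by rewrite addr0 mul0r.
lra.
Qed.

End Energy.

(** Cauchy-Schwarz over the common values of [p] and [q]. *)
Lemma correlation_le (R : realFieldType) (Z Y : finType) (G : eqType) (p : Z -> G) (q : Y -> G)
    (H : Z -> R) (K : Y -> R) :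
  (\sum_z \sum_y (if p z == q y then H z * K y else 0)) ^+ 2 <=
  (\sum_z \sum_z' (if p z == p z' then H z * H z' else 0)) *
  (\sum_y \sum_y' (if q y == q y' then K y * K y' else 0)).
Proof.
pose V := undup (map p (enum Z) ++ map q (enum Y)).
have uV : uniq V by exact: undup_uniq.
have pV z : p z \in V by rewrite mem_undup mem_cat map_f ?mem_enum.
have qV y : q y \in V by rewrite mem_undup mem_cat (map_f q) ?orbT ?mem_enum.
pose A v := \sum_z (if p z == v then H z else 0).
pose B v := \sum_y (if q y == v then K y else 0).
have main (Z1 Z2 : finType) (f1 : Z1 -> G) (f2 : Z2 -> G) (F1 : Z1 -> R) (F2 : Z2 -> R) :
   (forall z, f1 z \in V) -> \sum_z \sum_y (if f1 z == f2 y then F1 z * F2 y else 0) =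
   \sum_(v <- V) (\sum_z (if f1 z == v then F1 z else 0)) * (\sum_y (if f2 y == v then F2 y else 0)).
  move=> f1V; under [RHS]eq_bigr => v _ do rewrite mulr_suml.
  rewrite [RHS]exchange_big /=; apply: eq_bigr => z _.
  rewrite (bigD1_seq (f1 z)) //= eqxx mulr_sumr [X in _ = _ + X]big1 ?addr0; last first.
    by move=> v /negbTE nv; rewrite eq_sym nv mul0r.
  by apply: eq_bigr => y _; rewrite (eq_sym (f2 y)); case: ifP => // _; rewrite mulr0.
by rewrite !main // -/A -/B; under [X in _ <= X * _]eq_bigr => v _ do rewrite -expr2;
  under [X in _ <= _ * X]eq_bigr => v _ do rewrite -expr2; exact: sum_mul_sqr_le.
Qed.

Lemma big_optionE (R : Type) (idx : R) (op : Monoid.com_law idx) (I : finType) (F : option I -> R) :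
  \big[op/idx]_i F i = op (F None) (\big[op/idx]_i F (Some i)).
Proof.
rewrite (bigD1 None) //=; congr (op _ _).
rewrite (reindex_omap Some id) /=; first by apply: eq_bigl => i; rewrite eqxx.
by case.
Qed.

Lemma split_two_anchors (k : nat) (I : finType) (i0 i1 : I) : i0 != i1 -> #|I| = k.*2.+2 ->
  exists2 th : option 'I_k + option 'I_k -> I, bijective th &
    th (inl None) = i0 /\ th (inr None) = i1.
Proof.
move=> i01 cI; pose s := enum [pred i | (i != i0) && (i != i1)].
have ss : size s = (k + k)%N.
  rewrite -cardE; have := cardC [pred i | (i == i0) || (i == i1)].
  have -> : #|[pred i | (i == i0) || (i == i1)]| = 2%N.
    by have := card2 i0 i1; rewrite i01 => <-; apply: eq_card => c; rewrite !inE.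
  rewrite cI add2n -addnn => -[] <-; apply: eq_card => c; by rewrite !inE negb_or.
have us : uniq s by exact: enum_uniq.
pose th (c : option 'I_k + option 'I_k) : I := match c with
  | inl None => i0 | inr None => i1
  | inl (Some b) => nth i0 s b | inr (Some b) => nth i0 s (k + b) end.
exists th => //; apply: inj_card_bij; last by rewrite cI card_sum card_option card_ord; lia.
have ns m : (m < k + k)%N -> nth i0 s m != i0 /\ nth i0 s m != i1.
  move=> mk; have : nth i0 s m \in s by rewrite mem_nth // ss.
  by rewrite mem_enum inE => /andP.
have b1 (b : 'I_k) : (b < k + k)%N by rewrite (leq_trans (ltn_ord b)) ?leq_addr.
have b2 (b : 'I_k) : (k + b < k + k)%N by rewrite ltn_add2l.
move=> [[b|]|[b|]] [[b'|]|[b'|]] //= /eqP; rewrite ?nth_uniq ?ss //.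
all: try by rewrite (negbTE (proj1 (ns _ (b1 _)))).
all: try by rewrite (negbTE (proj2 (ns _ (b1 _)))).
all: try by rewrite (negbTE (proj1 (ns _ (b2 _)))).
all: try by rewrite (negbTE (proj2 (ns _ (b2 _)))).
all: try by rewrite eq_sym (negbTE (proj1 (ns _ (b1 _)))).
all: try by rewrite eq_sym (negbTE (proj2 (ns _ (b1 _)))).
all: try by rewrite eq_sym (negbTE (proj1 (ns _ (b2 _)))).
all: try by rewrite eq_sym (negbTE (proj2 (ns _ (b2 _)))).
all: try by rewrite ?(negbTE i01) // eq_sym (negbTE i01).
- by move=> /eqP /val_inj ->.
- by move=> /eqP e; have := ltn_ord b; rewrite e ltnNge leq_addr.
- by move=> /eqP e; have := ltn_ord b'; rewrite -e ltnNge leq_addr.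
- by rewrite eqn_add2l => /eqP /val_inj ->.
Qed.

(** Two of the factors carry no weight. Each of them is grouped with [k] of the other
    factors, and Cauchy-Schwarz separates the groups; by [energy_sign] the signs inside
    a group do not matter, so the two groups are arbitrary. *)
Lemma signed_form_le (R : realFieldType) (k : nat) (T I : finType) (G : zmodType) (phi : T -> G)
    (w : T -> R) (C : R) (i0 i1 : I) (eps : I -> bool) (g0 : G) (b : I -> T -> R) (N : I -> R) :
  i0 != i1 -> #|I| = k.*2.+2 -> (forall t, 0 <= w t) ->
  (forall sg, \sum_(z : {ffun option 'I_k -> T} | sgsum phi (fun=> false) z == sg)
      \prod_c w (z (Some c)) ^+ 2 <= C) ->
  (forall i t, 0 <= b i t) -> (forall i, 0 <= N i) ->
  (forall i, \sum_t b i t ^+ 2 <= N i ^+ 2) ->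
  \sum_(zeta : {ffun I -> T} | sgsum phi eps zeta == g0)
     (\prod_(i | (i != i0) && (i != i1)) w (zeta i)) * \prod_i b i (zeta i) <= C * \prod_i N i.
Proof.
move=> i01 cI w0 hC b0 N0 hb.
have C0 : 0 <= C.
  by apply: le_trans (hC 0); apply: sumr_ge0 => z _; apply: prodr_ge0 => c _; exact: sqr_ge0.
have [th [th' thK thK'] [th0 th1]] := split_two_anchors i01 cI.
pose X := option 'I_k.
pose w1 (c : X) t := if c is Some _ then w t else 1.
pose h (s : X -> X + X) c t := w1 c t * b (th (s c)) t.
pose e (s : X -> X + X) c := eps (th (s c)).
pose Hh (s : X -> X + X) (z : {ffun X -> T}) := \prod_c h s c (z c).
pose glue (zy : {ffun X -> T} * {ffun X -> T}) : {ffun I -> T} :=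
  [ffun i => match th' i with inl c => zy.1 c | inr c => zy.2 c end].
pose unglue (ze : {ffun I -> T}) : {ffun X -> T} * {ffun X -> T} :=
  ([ffun c => ze (th (inl c))], [ffun c => ze (th (inr c))]).
have glueK : cancel glue unglue.
  by move=> [z y]; rewrite /unglue /glue; congr pair; apply/ffunP => c; rewrite !ffunE thK.
have unglueK : cancel unglue glue.
  move=> ze; apply/ffunP => i; rewrite ffunE -{2}(thK' i).
  by case: (th' i) => c; rewrite ffunE.
set F := \sum_(_ | _) _.
have thinj : injective th by exact: can_inj thK.
have w1l c t : (if (th (inl c) != i0) && (th (inl c) != i1) then w t else 1) = w1 c t.
  by rewrite -{1}th0 -{1}th1 !(inj_eq thinj); case: c.
have w1r c t : (if (th (inr c) != i0) && (th (inr c) != i1) then w t else 1) = w1 c t.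
  by rewrite -{1}th0 -{1}th1 !(inj_eq thinj); case: c.
have FE : F = \sum_z \sum_y (if sgsum phi (e inl) z == g0 - sgsum phi (e inr) y
     then Hh inl z * Hh inr y else 0).
  rewrite /F big_mkcond pair_bigA /= (reindex glue) /=; last by exists unglue => x _.
  apply: eq_bigr => -[z y] _ /=.
  have thbij : {on predT, bijective th} by exists th' => x _.
  have -> : sgsum phi eps (glue (z, y)) = sgsum phi (e inl) z + sgsum phi (e inr) y.
    rewrite /sgsum (reindex th) //= big_sumType /=; congr (_ + _); apply: eq_bigr => c _;
    by rewrite ffunE thK.
  rewrite -[_ == g0 - _]subr_eq0 opprB addrA [_ + _ - g0]addrAC -[_ + _ == g0]subr_eq0 [_ - g0]addrAC.
  case: ifP => // _.
  rewrite big_mkcond -big_split /= (reindex th) //= big_sumType /=; congr (_ * _); apply: eq_bigr => c _;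
  by rewrite ffunE thK /h /= ?w1l ?w1r.
have F0 : 0 <= F by apply: sumr_ge0 => ze _; rewrite mulr_ge0 // prodr_ge0.
have E s : s = inl \/ s = inr -> energy phi (e s) (h s) <= C * \prod_c N (th (s c)) ^+ 2.
  move=> hs; rewrite energy_sign.
  apply: le_trans (energy_le (C := C) _ _ _) _ => //.
  - by move=> [c|] t /=.
  - move=> sg; apply: le_trans (hC sg); apply: ler_sum => z _.
    have -> : \prod_i w1 i (z i) ^+ 2 = \prod_c w (z (Some c)) ^+ 2; last by [].
    by rewrite big_optionE /= expr1n mul1r.
  - by rewrite ler_wpM2l //; apply: ler_prod => c _; rewrite hb sumr_ge0 // => t _; exact: sqr_ge0.
have F2 : F ^+ 2 <= (C * \prod_i N i) ^+ 2.
  rewrite FE; apply: le_trans (correlation_le _ _ _ _) _.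
  have -> : (C * \prod_i N i) ^+ 2 = (C * \prod_c N (th (inl c)) ^+ 2) * (C * \prod_c N (th (inr c)) ^+ 2).
    have -> : \prod_i N i = \prod_c N (th (inl c)) * \prod_c N (th (inr c)).
      by rewrite (reindex th) ?big_sumType //; exists th' => x _.
    by rewrite !prodrXl; ring.
  apply: ler_pM.
  - by apply: sumr_ge0 => z _; apply: sumr_ge0 => z' _; case: ifP => // _; rewrite mulr_ge0 // prodr_ge0 // => -[c|] _; rewrite mulr_ge0.
  - by apply: sumr_ge0 => z _; apply: sumr_ge0 => z' _; case: ifP => // _; rewrite mulr_ge0 // prodr_ge0 // => -[c|] _; rewrite mulr_ge0.
  - by have := E inl (or_introl erefl).
  - have := E inr (or_intror erefl); apply: le_trans; rewrite le_eqVlt; apply/orP; left; apply/eqP.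
    apply: eq_bigr => y _; apply: eq_bigr => y' _.
    by rewrite (inj_eq (addrI _)) (inj_eq oppr_inj).
by move: F2; rewrite ler_pXn2r // nnegrE // mulr_ge0 // prodr_ge0.
Qed.

(** Slot [None] stands for the output frequency, moved to the left of the convolution
    constraint; the conjugated inputs sit in the odd slots. *)
Definition slot_sign (m : nat) (i : option 'I_m) : bool := if i is Some j then odd j else true.

Lemma sgsum_map (T I : finType) (G G' : zmodType) (f : {additive G -> G'}) (phi : T -> G)
    (eps : I -> bool) (z : {ffun I -> T}) : sgsum (f \o phi) eps z = f (sgsum phi eps z).
Proof.
rewrite /sgsum raddf_sum; apply: eq_bigr => i _; rewrite /sgz_if /=.
by case: (eps i) => //; rewrite raddfN.
Qed.

Lemma japanese_le_max (R : realType) (d m : nat) (n : 'rV[int]_d) (z : 'I_m -> 'rV[int]_d) (j0 : 'I_m) :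
  n = \sum_(j < m) sgz_if (odd j) (z j) ->
  exists j, japanese R n <= m%:R * japanese R (z j).
Proof.
move=> ->; pose j := [arg max_(i > j0) japanese R (z i)]%O; exists j.
have hj i : japanese R (z i) <= japanese R (z j) by rewrite /j; case: arg_maxP => // l _; apply.
have jp := japanese_gt0 R (z j).
have m1 : 1 <= m%:R :> R by rewrite ler1n; case: m j0 {z j hj jp} => // -[].
rewrite -(@ler_pXn2r _ 2) ?nnegrE ?mulr_ge0 ?(ltW jp) ?(ltW (japanese_gt0 _ _)) //.
have sq l : japanese R l ^+ 2 = 1 + sqfreq R l by rewrite sqr_sqrtr // addr_ge0 // sqfreq_ge0.
have -> : (m%:R * japanese R (z j)) ^+ 2 = \sum_(i < m) m%:R * japanese R (z j) ^+ 2.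
  by rewrite sumr_const card_ord -[RHS]mulr_natr; ring.
apply: (@le_trans _ _ (\sum_(i < m) m%:R * japanese R (z i) ^+ 2)); last first.
  by apply: ler_sum => i _; rewrite ler_pM2l ?(lt_le_trans ltr01) // ler_pXn2r ?nnegrE ?(ltW (japanese_gt0 _ _)).
rewrite sq; under [leRHS]eq_bigr => i _ do rewrite sq mulrDr mulr1.
rewrite big_split /= lerD //.
  by rewrite sumr_const card_ord -[leRHS]mulr_natr mulr_ege1.
rewrite /sqfreq -mulr_sumr exchange_big mulr_sumr /=; apply: ler_sum => i _.
rewrite summxE rmorph_sum /=.
have := sum_mul_sqr_le (index_enum 'I_m) (fun=> 1 : R) (fun l => (sgz_if (odd l) (z l) 0 i)%:~R).
under [X in X ^+ 2 <= _]eq_bigr => l _ do rewrite mul1r.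
under [X in _ <= X * _]eq_bigr => l _ do rewrite expr1n.
rewrite sumr_const card_ord => /le_trans; apply; rewrite ler_wpM2l // ler_sum // => l _.
by rewrite /sgz_if; case: (odd l) => //; rewrite mxE rmorphN sqrrN.
Qed.

(** Interpolation between the full gain [x^-(1+e)] at the weight [s1] and no gain at
    the weight [s0], without Hoelder's inequality: a geometric mean is at most the sum. *)
Lemma interpolate_weight (R : realType) (x P rho s s0 s1 e th : R) : 1 <= x -> 1 <= P ->
  0 <= th <= 1 -> th * (1 + e) <= rho -> th * s1 + (1 - th) * s0 <= s ->
  x `^ (- rho) * P `^ (- s) <= x `^ (- (1 + e)) * P `^ (- s1) + P `^ (- s0).
Proof.
move=> x1 P1 /andP[th0 th1] hrho hs.
have x0 : 0 <= x by exact: le_trans x1.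
have P0 : 0 <= P by exact: le_trans P1.
set A := x `^ (- (1 + e)) * P `^ (- s1); set B := P `^ (- s0).
have A0 : 0 <= A by rewrite mulr_ge0 ?powR_ge0.
have B0 : 0 <= B by exact: powR_ge0.
apply: (@le_trans _ _ (A `^ th * B `^ (1 - th))).
  rewrite /A /B powRM ?powR_ge0 // -!powRrM.
  have -> : x `^ (- (1 + e) * th) * P `^ (- s1 * th) * P `^ (- s0 * (1 - th)) =
      x `^ (- (th * (1 + e))) * P `^ (- (th * s1 + (1 - th) * s0)).
    rewrite -mulrA -powRD ?(gt_eqF (lt_le_trans ltr01 P1)) ?implybT //.
    by congr (_ `^ _ * _ `^ _); ring.
  by apply: ler_pM; rewrite ?powR_ge0 // ler_powR // lerN2.
pose M := Num.max A B.
have M0 : 0 <= M by rewrite le_max A0.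
apply: (@le_trans _ _ M); last by rewrite /M ge_max lerDl lerDr A0 B0.
have -> : M = M `^ th * M `^ (1 - th).
  have [->|Mn0] := eqVneq M 0; last by rewrite -powRD ?Mn0 ?implybT // addrC subrK powRr1.
  have [->|t0] := eqVneq th 0; first by rewrite subr0 powRr1 // mulr0.
  by rewrite powR0 // mul0r.
by apply: ler_pM; rewrite ?powR_ge0 // ge0_ler_powR ?nnegrE ?subr_ge0 // le_max lexx ?orbT.
Qed.

Definition resonance (T : finType) (d m : nat) (e : T -> 'rV[int]_d) (z : {ffun option 'I_m -> T}) : int :=
  sgsum (fun t => isq (e t)) (@slot_sign m) z.

Section FiniteEstimate.
Variables (R : realType) (d k : nat) (rho s : R).
Let m := k.*2.+1.

Lemma card_slots : #|{: option 'I_m}| = k.*2.+2.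
Proof. by rewrite card_option card_ord. Qed.

(** Any tuple is determined by its values on the weighted slots and by the value of
    the sum, so a count over the weighted slots applies. *)
Lemma fiber_sum_le (T : finType) (e : T -> 'rV[int]_d) (G : zmodType) (phi : T -> G) (t C : R)
    (F : pred {ffun 'I_k -> 'rV[int]_d}) (sg : G) :
  injective e ->
  (forall z z' : {ffun option 'I_k -> T}, sgsum phi (fun=> false) z = sg -> sgsum phi (fun=> false) z' = sg ->
     (forall c, z (Some c) = z' (Some c)) -> z = z') ->
  (forall z : {ffun option 'I_k -> T}, sgsum phi (fun=> false) z = sg -> F [ffun c => e (z (Some c))]) ->
  (forall S : seq {ffun 'I_k -> 'rV[int]_d}, uniq S -> (forall z, z \in S -> F z) ->
     \sum_(z <- S) \prod_b (japanese R (z b) `^ (- t)) ^+ 2 <= C) ->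
  \sum_(z : {ffun option 'I_k -> T} | sgsum phi (fun=> false) z == sg)
     \prod_c (japanese R (e (z (Some c))) `^ (- t)) ^+ 2 <= C.
Proof.
move=> inj hz hF hC.
pose f (z : {ffun option 'I_k -> T}) : {ffun 'I_k -> 'rV[int]_d} := [ffun c => e (z (Some c))].
pose S := [seq f z | z <- enum [pred z | sgsum phi (fun=> false) z == sg]].
have := hC S; rewrite /S map_inj_in_uniq ?enum_uniq; last first.
  move=> z z'; rewrite !mem_enum !inE => /eqP e1 /eqP e2 /ffunP ff.
  by apply: hz => // c; have := ff c; rewrite !ffunE => /inj.
move=> /(_ isT); rewrite big_map big_enum /= => h.
apply: le_trans (h _); last first.
  by move=> _ /mapP[z zS ->]; apply: hF; move: zS; rewrite mem_enum inE => /eqP.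
rewrite le_eqVlt; apply/orP; left; apply/eqP; apply: eq_bigr => z _.
by apply: eq_bigr => c _; rewrite ffunE.
Qed.

Lemma unweighted_slot_determined (T : finType) (e : T -> 'rV[int]_d) (sg : 'rV[int]_d)
    (z z' : {ffun option 'I_k -> T}) : injective e ->
  sgsum e (fun=> false) z = sg -> sgsum e (fun=> false) z' = sg ->
  (forall c, z (Some c) = z' (Some c)) -> z = z'.
Proof.
move=> inj; rewrite /sgsum !big_optionE /sgz_if /= => h h' hc.
apply/ffunP => -[c|]; first exact: hc.
apply: inj; move: h; rewrite -h'.
by rewrite (eq_bigr (fun c => e (z' (Some c)))) ?(inj_eq (addIr _)) => [/addIr|c _]; rewrite ?hc.
Qed.

Hypotheses (d0 : (0 < d)%N) (k0 : (0 < k)%N) (dk : (d, k) <> (1%N, 1%N)).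
Hypotheses (rho0 : 0 < rho) (rho1 : rho <= 1) (hs : d%:R / 2 - rho / k%:R < s).

Lemma regularity_gt0 : 0 < s.
Proof.
apply: le_lt_trans hs; rewrite subr_ge0.
have dk2 : (2 <= d * k)%N by case: d d0 dk => [|[|d']] //; case: k k0 => [|[|k']] // _ _; lia.
rewrite ler_pdivrMr ?ltr0n // mulrAC -natrM ler_pdivlMr // (le_trans _ (_ : 2%:R <= _)) ?ler_nat //.
by rewrite ler_piMl.
Qed.

(** Counting alone bounds the part of the form on one level set of the resonance function
    at the weight [s1 > d/2 - 1/k], and the whole form at the weight [s0 > d/2]. The factor
    [x `^ (- rho)] is what lets [s] lie between the two. The largest input frequency pays
    for the weight of the output, which leaves two of the factors without weight. *)
Lemma multilinear_finite : exists2 C : R, 0 <= C &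
  forall (T : finType) (e : T -> 'rV[int]_d) (b : option 'I_m -> T -> R) (N : option 'I_m -> R),
    injective e -> (forall i t, 0 <= b i t) -> (forall i, 0 <= N i) ->
    (forall i, \sum_t b i t ^+ 2 <= N i ^+ 2) ->
    \sum_(z : {ffun option 'I_m -> T} | sgsum e (@slot_sign m) z == 0)
       ((1 + `|resonance e z|)%:~R `^ (- rho) *
        (japanese R (e (z None)) `^ s * \prod_j japanese R (e (z (Some j))) `^ (- s))) *
       \prod_i b i (z i) <= C * \prod_i N i.
Proof.
have dk2 : (1 < k * d)%N by case: d d0 dk => [|[|d']] //; case: k k0 => [|[|k']] // _ _; lia.
have k0R : 0 < k%:R :> R by rewrite ltr0n.
have d0R : 0 < d%:R :> R by rewrite ltr0n.
(* [s1] and [s0] lie [eta] above their thresholds; half of the room left by [s] pays for this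
   and the other half for [th < rho] *)
pose eta := (s - (d%:R / 2 - rho / k%:R)) / 2.
have eta0 : 0 < eta by rewrite divr_gt0 // subr_gt0.
pose s1 := d%:R / 2 - 1 / k%:R + eta; pose s0 := d%:R / 2 + eta.
pose th := rho / (1 + eta).
have e1 : 0 < 1 + eta by rewrite addr_gt0.
have th01 : 0 <= th <= 1.
  by rewrite divr_ge0 ?(ltW rho0) ?(ltW e1) //= ler_pdivrMr // mul1r (le_trans rho1) // lerDl ltW.
have hth : th * (1 + eta) <= rho by rewrite /th divfK // gt_eqF.
have hs01 : th * s1 + (1 - th) * s0 <= s.
  have -> : th * s1 + (1 - th) * s0 = d%:R / 2 + eta - th / k%:R by rewrite /s1 /s0; ring.
  have hh : rho / k%:R - th / k%:R <= eta.
    rewrite -mulrBl ler_pdivrMr // /th.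
    have -> : rho - rho / (1 + eta) = rho * (eta / (1 + eta)) by field; rewrite gt_eqF.
    apply: (@le_trans _ _ (1 * eta)).
      apply: ler_pM => //; [exact: ltW | by rewrite divr_ge0 // ltW |].
      by rewrite ler_pdivrMr // ler_peMr ?lerDl // ltW.
    by rewrite mul1r ler_peMr ?ler1n // ltW.
  have : s = d%:R / 2 - rho / k%:R + 2 * eta by rewrite (mulrC 2) /eta divfK // addrC subrK.
  move: hh; lra.
have [C1 hC1] := sum_sphere_tuples dk2 (s := s1) ltac:(by rewrite /s1 ltrDl).
have [C0 hC0] := sum_tuples k d0 (s := s0) ltac:(by rewrite /s0 ltrDl).
have [Cw hCw] := sum_intw eta0.
have C1p : 0 <= C1 by have := hC1 0 0 [::] isT; rewrite big_nil; apply.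
have C0p : 0 <= C0 by have := hC0 [::] isT; rewrite big_nil; apply.
have Cwp : 0 <= Cw by have := hCw [::] isT; rewrite big_nil; apply.
pose CT := Cw * C1 + C0; pose K : R := m%:R `^ s.
have s_gt0 := regularity_gt0.
exists (K * (m%:R * CT)); first by rewrite !mulr_ge0 ?powR_ge0 // addr_ge0 ?mulr_ge0.
move=> T e b N inj b0 N0 hb.
pose J t := japanese R (e t).
have J0 t : 0 < J t by exact: japanese_gt0.
pose PN := \prod_i N i; have PN0 : 0 <= PN by exact: prodr_ge0.
pose lin (z : {ffun option 'I_m -> T}) := sgsum e (@slot_sign m) z == 0.
pose Pj (j : 'I_m) (z : {ffun option 'I_m -> T}) := \prod_(i | (i != None) && (i != Some j)) J (z i).
have Pj1 j z : 1 <= Pj j z by rewrite /Pj; elim/big_ind: _ => // [x y|i _]; [exact: mulr_ege1 | exact: japanese_ge1].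
pose x (z : {ffun option 'I_m -> T}) : R := (1 + `|resonance e z|)%:~R.
have x1 z : 1 <= x z by rewrite ler1z lerDl.
pose B (z : {ffun option 'I_m -> T}) := \prod_i b i (z i).
have B0 z : 0 <= B z by exact: prodr_ge0.
have PjE j z t : Pj j z `^ (- t) = \prod_(i | (i != None) && (i != Some j)) J (z i) `^ (- t).
  by rewrite prod_powR // => i; exact: ltW.
(* the part of the form where slot [j] carries the largest input frequency *)
have slot j : \sum_(z | lin z) x z `^ (- rho) * Pj j z `^ (- s) * B z <= CT * PN.
  apply: (@le_trans _ _ (\sum_(z | lin z) x z `^ (- (1 + eta)) * Pj j z `^ (- s1) * B z +
                         \sum_(z | lin z) Pj j z `^ (- s0) * B z)).
    rewrite -big_split /=; apply: ler_sum => z _; rewrite -mulrDl ler_wpM2r //.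
    exact: interpolate_weight th01 hth hs01.
  rewrite [CT * _]mulrDl; apply: lerD.
    pose phi t : 'rV[int]_d * int := (e t, isq (e t)).
    have phi1 (X : finType) eps (z : {ffun X -> T}) : (sgsum phi eps z).1 = sgsum e eps z.
      by rewrite -(sgsum_map fst).
    have phi2 (X : finType) eps (z : {ffun X -> T}) : (sgsum phi eps z).2 = sgsum (fun t => isq (e t)) eps z.
      by rewrite -(sgsum_map snd).
    have level r : \sum_(z | lin z && (resonance e z == r)) Pj j z `^ (- s1) * B z <= C1 * PN.
      have := @signed_form_le R k T (option 'I_m) _ phi (fun t => J t `^ (- s1)) C1 None (Some j)
        (@slot_sign m) (0, r) b N isT card_slots (fun t => powR_ge0 _ _).
      have H : forall sg, \sum_(z : {ffun option 'I_k -> T} | sgsum phi (fun=> false) z == sg)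
          \prod_c (J (z (Some c)) `^ (- s1)) ^+ 2 <= C1.
        move=> sg; rewrite /J; apply: (fiber_sum_le (t := s1) (F := fun z => isq (sg.1 - \sum_b z b) + \sum_b isq (z b) == sg.2) inj).
        - move=> z z' /(congr1 fst) h /(congr1 fst) h'; apply: (@unweighted_slot_determined _ _ sg.1 _ _ inj).
            by rewrite -h phi1.
          by rewrite -h' phi1.
        - move=> z hz /=; rewrite -hz phi1 phi2 /sgsum !big_optionE /sgz_if /=.
          apply/eqP; congr (isq _ + _); last by apply: eq_bigr => c _; rewrite ffunE.
          rewrite [X in _ - X](eq_bigr (fun c => e (z (Some c)))) ?addrK // => c _; by rewrite ffunE.
        - by move=> S uS hS; apply: (hC1 sg.1 sg.2 S uS) => z /hS /eqP.
      move=> /(_ H b0 N0 hb); apply: le_trans; rewrite le_eqVlt; apply/orP; left; apply/eqP.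
      apply: eq_big => [z|z _]; last by rewrite PjE.
      by rewrite /lin /resonance -phi1 -phi2; case: (sgsum phi _ z) => u v; rewrite xpair_eqE.
    rewrite -big_filter.
    apply: le_trans (sum_fibers (h := @resonance T d m e) (G := fun r => intw eta r * (C1 * PN)) _) _.
      move=> r; rewrite big_filter_cond.
      rewrite (eq_bigr (fun z => intw eta r * (Pj j z `^ (- s1) * B z))); last first.
        by move=> z /andP[_ /eqP <-]; rewrite mulrA.
      by rewrite -mulr_sumr ler_wpM2l ?intw_ge0.
    by rewrite -mulr_suml -mulrA ler_wpM2r ?mulr_ge0 ?hCw ?undup_uniq.
  have := @signed_form_le R k T (option 'I_m) _ e (fun t => J t `^ (- s0)) C0 None (Some j)
        (@slot_sign m) 0 b N isT card_slots (fun t => powR_ge0 _ _).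
  have H : forall sg, \sum_(z : {ffun option 'I_k -> T} | sgsum e (fun=> false) z == sg)
          \prod_c (J (z (Some c)) `^ (- s0)) ^+ 2 <= C0.
    move=> sg; apply: (fiber_sum_le (F := predT) inj) => // [z z'|S uS _]; last exact: hC0.
    exact: unweighted_slot_determined.
  move=> /(_ H b0 N0 hb); apply: le_trans; rewrite le_eqVlt; apply/orP; left; apply/eqP.
  by apply: eq_bigr => z _; rewrite PjE.
apply: (@le_trans _ _ (\sum_(z | lin z) \sum_j K * (x z `^ (- rho) * Pj j z `^ (- s) * B z))).
  apply: ler_sum => z /eqP hz.
  have [j hj] : exists j, J (z None) <= m%:R * J (z (Some j)).
    apply: (japanese_le_max R (z := fun j => e (z (Some j))) ord0).
    move: hz; rewrite /sgsum big_optionE /= => /eqP; rewrite addrC subr_eq0 => /eqP <-.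
    by [].
  rewrite [leRHS](bigD1 j) //=; apply: ler_wpDr.
    by apply: sumr_ge0 => i _; rewrite !mulr_ge0 ?powR_ge0.
  rewrite -/(B z) (_ : K * _ = x z `^ (- rho) * (K * Pj j z `^ (- s)) * B z); last by ring.
  apply: ler_wpM2r; first exact: B0.
  apply: ler_wpM2l; first exact: powR_ge0.
  rewrite PjE.
  have -> : \prod_(i | (i != None) && (i != Some j)) J (z i) `^ (- s) =
      J (z (Some j)) `^ s * \prod_i J (z (Some i)) `^ (- s).
    rewrite big_mkcond big_optionE /= mul1r [in RHS](bigD1 j) //= mulrA.
    rewrite -powRD ?(gt_eqF (J0 _)) ?implybT // subrr powRr0 mul1r [in RHS]big_mkcond /=.
    by apply: eq_bigr => i _; rewrite (inj_eq (@Some_inj _)).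
  rewrite mulrA ler_wpM2r ?prodr_ge0 // => [i _|]; first exact: powR_ge0.
  rewrite -powRM ?(ltW (J0 _)) //; apply: ge0_ler_powR => //; rewrite ?nnegrE ?mulr_ge0 ?(ltW (J0 _)) //.
  exact: ltW.
rewrite exchange_big /=; apply: (@le_trans _ _ (\sum_(j < m) K * (CT * PN))).
  by apply: ler_sum => j _; rewrite -mulr_sumr ler_wpM2l ?powR_ge0 ?slot.
rewrite sumr_const card_ord -[leLHS]mulr_natl -/PN (_ : K * _ * _ = m%:R * (K * (CT * PN))) //; ring.
Qed.

End FiniteEstimate.

(** * Unconditional sums and Sobolev norms *)

Notation cmod := (@Normc.normc _).

Section Modulus.
Variable R : rcfType.
Implicit Types x y z : R[i].

Lemma cmod_ge0 z : 0 <= cmod z.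
Proof. by case: z => a b; exact: sqrtr_ge0. Qed.

Lemma cmodN z : cmod (- z) = cmod z.
Proof. by case: z => a b /=; rewrite !sqrrN. Qed.

Lemma cmodD x y : cmod (x + y) <= cmod x + cmod y.
Proof. exact: (@le_normcD R x y). Qed.

Lemma cmodB x y : cmod (x - y) <= cmod x + cmod y.
Proof. by rewrite -(cmodN y) cmodD. Qed.

Lemma cmod_distC x y : cmod (x - y) = cmod (y - x).
Proof. by rewrite -cmodN opprB. Qed.

Lemma cmod_conj z : cmod (z^*)%C = cmod z.
Proof. by case: z => a b /=; rewrite sqrrN. Qed.

Lemma cmod_re z : `|complex.Re z| <= cmod z.
Proof. by case: z => a b /=; rewrite -sqrtr_sqr ler_wsqrtr // lerDl sqr_ge0. Qed.

Lemma cmod_im z : `|complex.Im z| <= cmod z.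
Proof. by case: z => a b /=; rewrite -sqrtr_sqr ler_wsqrtr // lerDr sqr_ge0. Qed.

Lemma cmod_le z : cmod z <= `|complex.Re z| + `|complex.Im z|.
Proof.
case: z => a b /=; have h : 0 <= `|a| + `|b| by rewrite addr_ge0.
rewrite -[leRHS](ger0_norm h) -[leRHS]sqrtr_sqr.
by rewrite ler_wsqrtr // sqrrD !real_normK ?num_real // -addrA lerD2l lerDr mulrn_wge0 // mulr_ge0.
Qed.

Lemma cmod_sum (I : Type) (r : seq I) (P : pred I) (F : I -> R[i]) :
  cmod (\sum_(i <- r | P i) F i) <= \sum_(i <- r | P i) cmod (F i).
Proof.
elim/big_rec2: _ => [|i y1 y2 _ h]; first by rewrite (Normc.normc0 R).
by apply: le_trans (cmodD _ _) _; rewrite lerD2l.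
Qed.

Lemma cmod_prod (I : Type) (r : seq I) (P : pred I) (F : I -> R[i]) :
  cmod (\prod_(i <- r | P i) F i) = \prod_(i <- r | P i) cmod (F i).
Proof. exact: (big_morph _ (@Normc.normcM R) (Normc.normc1 R)). Qed.

Lemma re_sum (I : Type) (r : seq I) (P : pred I) (F : I -> R[i]) :
  complex.Re (\sum_(i <- r | P i) F i) = \sum_(i <- r | P i) complex.Re (F i).
Proof.
elim/big_rec2: _ => // i y1 y2 _ <-; by case: (F i) y2 => a b [].
Qed.

Lemma im_sum (I : Type) (r : seq I) (P : pred I) (F : I -> R[i]) :
  complex.Im (\sum_(i <- r | P i) F i) = \sum_(i <- r | P i) complex.Im (F i).
Proof.
elim/big_rec2: _ => // i y1 y2 _ <-; by case: (F i) y2 => a b [].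
Qed.

Lemma re_sub x y : complex.Re (x - y) = complex.Re x - complex.Re y.
Proof. by case: x y => a b []. Qed.

Lemma im_sub x y : complex.Im (x - y) = complex.Im x - complex.Im y.
Proof. by case: x y => a b []. Qed.

Lemma cmod_le_eq x y : (forall e : R, 0 < e -> cmod (x - y) <= e) -> x = y.
Proof.
move=> h; apply/eqP; rewrite -subr_eq0; apply/eqP; apply: (@Normc.eq0_normc R).
apply/eqP; rewrite eq_le cmod_ge0 andbT leNgt; apply/negP => p.
have := h (cmod (x - y) / 2) (divr_gt0 p (ltr0Sn _ 1)); rewrite leNgt => /negP; apply.
by rewrite ltr_pdivrMr // mulr_natr mulr2n ltrDl.
Qed.

End Modulus.

Section SumOfNonneg.
Variables (R : realType) (I : choiceType) (a : I -> R).
Hypothesis a0 : forall i, 0 <= a i.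
Let s := \esum_(i in [set: I]) (a i)%:E.

Lemma esum_ge_sum (S : seq I) : uniq S -> ((\sum_(i <- S) a i)%:E <= s)%E.
Proof.
move=> uS; apply: esum_ge; exists [set` S]; first by split.
rewrite (@fsbig_fwiden _ _ _ _ S) ?sumEFin //; by move=> i [hS nS]; case: (nS hS).
Qed.

Lemma esum_le_bound (B : R) : sum_bounded a B -> (s <= B%:E)%E.
Proof.
move=> hB; apply: ge_ereal_sup => _ [A [fA _] <-].
by rewrite fsbig_finite // sumEFin lee_fin hB //; exact: finmap.fset_uniq.
Qed.

Lemma esum_fin_bounded : (s < +oo)%E -> sum_bounded a (fine s) /\ s = (fine s)%:E.
Proof.
move=> sfin; have sf : s \is a fin_num.
  by rewrite ge0_fin_numE // esum_ge0 // => i _; rewrite lee_fin.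
split; last by rewrite fineK.
by move=> S uS; rewrite -lee_fin fineK // esum_ge_sum.
Qed.

Lemma esum_approx (e : R) : (s < +oo)%E -> 0 < e ->
  exists S : seq I, uniq S /\ fine s - e < \sum_(i <- S) a i.
Proof.
move=> sfin e0; have [_ se] := esum_fin_bounded sfin.
have : (s - e%:E < s)%E by rewrite se -EFinB lte_fin ltrBlDr ltrDl.
move=> /ereal_sup_gt[_ [A [fA _] <-]].
rewrite fsbig_finite // sumEFin se -EFinB lte_fin => h.
by exists (finmap.enum_fset (fset_set A)); rewrite finmap.fset_uniq.
Qed.

End SumOfNonneg.

Lemma ler_sum_bounded_tail (R : numDomainType) (I : eqType) (a : I -> R) (B : R) (S0 S : seq I) :
  (forall i, 0 <= a i) -> uniq S0 -> uniq S -> {subset S0 <= S} ->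
  \sum_(i <- S) a i <= B -> \sum_(i <- S | i \notin S0) a i <= B - \sum_(i <- S0) a i.
Proof.
move=> a0 u0 u sub; rewrite (bigID (mem S0)) /= => h; rewrite lerBrDl.
apply: le_trans h; rewrite lerD2r -[leRHS]big_filter ler_sum_subseq // => i iS0.
by rewrite mem_filter iS0 sub.
Qed.

Section Csum.
Variable R : realType.
Implicit Types I : choiceType.

Lemma rsum_approx I (a : I -> R) (B e : R) : sum_bounded (fun i => `|a i|) B -> 0 < e ->
  exists S0 : seq I, uniq S0 /\ forall S, uniq S -> {subset S0 <= S} ->
    `|\sum_(i <- S) a i - rsum a| <= e.
Proof.
move=> hB e0; rewrite /rsum.
pose p i := Num.max (a i) 0; pose q i := Num.max (- a i) 0.
have p0 i : 0 <= p i by rewrite le_max lexx orbT.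
have q0 i : 0 <= q i by rewrite le_max lexx orbT.
have pq i : a i = p i - q i.
  by rewrite /p /q !maxEle; case: ifP => h1; case: ifP => h2; lra.
have pB : sum_bounded p B.
  by move=> S /hB; apply: le_trans; apply: ler_sum => i _; rewrite ge_max normr_ge0 ler_norm.
have qB : sum_bounded q B.
  by move=> S /hB; apply: le_trans; apply: ler_sum => i _; rewrite ge_max normr_ge0 -normrN ler_norm.
have fp := le_lt_trans (esum_le_bound pB) (ltry _).
have fq := le_lt_trans (esum_le_bound qB) (ltry _).
set P := fine (\esum_(i in [set: I]) (Num.max (a i) 0)%:E).
set Q := fine (\esum_(i in [set: I]) (Num.max (- a i) 0)%:E).
have [S1 [u1 h1]] := esum_approx p0 fp e0; have [S2 [u2 h2]] := esum_approx q0 fq e0.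
have [bp _] := esum_fin_bounded p0 fp; have [bq _] := esum_fin_bounded q0 fq.
exists (undup (S1 ++ S2)); split; first exact: undup_uniq.
move=> S uS sub.
have -> : \sum_(i <- S) a i = \sum_(i <- S) p i - \sum_(i <- S) q i.
  by rewrite -sumrB; apply: eq_bigr => i _; exact: pq.
have := bp S uS; have := bq S uS; rewrite -/P -/Q in h1 h2 *.
have : \sum_(i <- S1) p i <= \sum_(i <- S) p i.
  by apply: ler_sum_subseq => // i iS; apply: sub; rewrite mem_undup mem_cat iS.
have : \sum_(i <- S2) q i <= \sum_(i <- S) q i.
  by apply: ler_sum_subseq => // i iS; apply: sub; rewrite mem_undup mem_cat iS orbT.
rewrite ler_norml; move: h1 h2; rewrite -/P -/Q; lra.
Qed.

(** [L] is the limit of the finite subsums of [f] along the directed set of finite sets;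
    [csum f] is characterised by this for absolutely summable families. *)
Definition sums_to I (f : I -> R[i]) (L : R[i]) : Prop :=
  forall e : R, 0 < e -> exists S0 : seq I, uniq S0 /\ forall S, uniq S -> {subset S0 <= S} ->
    cmod (\sum_(i <- S) f i - L) <= e.

Lemma sums_to_csum I (f : I -> R[i]) (B : R) : sum_bounded (fun i => cmod (f i)) B ->
  sums_to f (csum f).
Proof.
move=> hB e e0.
have hre : sum_bounded (fun i => `|complex.Re (f i)|) B.
  by move=> S /hB; apply: le_trans; apply: ler_sum => i _; exact: cmod_re.
have him : sum_bounded (fun i => `|complex.Im (f i)|) B.
  by move=> S /hB; apply: le_trans; apply: ler_sum => i _; exact: cmod_im.
have e2 : 0 < e / 2 by rewrite divr_gt0.
have [S1 [u1 h1]] := rsum_approx hre e2; have [S2 [u2 h2]] := rsum_approx him e2.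
exists (undup (S1 ++ S2)); split; first exact: undup_uniq.
move=> S uS sub; apply: le_trans (cmod_le _) _; rewrite re_sub im_sub /= re_sum im_sum.
have i1 : {subset S1 <= S} by move=> i iS; apply: sub; rewrite mem_undup mem_cat iS.
have i2 : {subset S2 <= S} by move=> i iS; apply: sub; rewrite mem_undup mem_cat iS orbT.
have := h1 S uS i1; have := h2 S uS i2; lra.
Qed.

Lemma sums_to_unique I (f : I -> R[i]) L L' : sums_to f L -> sums_to f L' -> L = L'.
Proof.
move=> h h'; apply: cmod_le_eq => e e0; have e2 : 0 < e / 2 by rewrite divr_gt0.
have [S1 [u1 h1]] := h _ e2; have [S2 [u2 h2]] := h' _ e2.
pose S := undup (S1 ++ S2).
have := h1 S (undup_uniq _) ltac:(by move=> i iS; rewrite mem_undup mem_cat iS).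
have := h2 S (undup_uniq _) ltac:(by move=> i iS; rewrite mem_undup mem_cat iS orbT).
have := cmodD (L - \sum_(i <- S) f i) (\sum_(i <- S) f i - L').
rewrite addrA subrK (cmod_distC L (\sum_(i <- S) f i)); lra.
Qed.

Lemma csum_eq I (f : I -> R[i]) (B : R) L : sum_bounded (fun i => cmod (f i)) B ->
  sums_to f L -> csum f = L.
Proof. by move=> /sums_to_csum; exact: sums_to_unique. Qed.

Lemma sums_toD I (f g : I -> R[i]) L M : sums_to f L -> sums_to g M ->
  sums_to (fun i => f i + g i) (L + M).
Proof.
move=> h h' e e0; have e2 : 0 < e / 2 by rewrite divr_gt0.
have [S1 [u1 h1]] := h _ e2; have [S2 [u2 h2]] := h' _ e2.
exists (undup (S1 ++ S2)); split; first exact: undup_uniq.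
move=> S uS sub; rewrite big_split /= opprD addrACA; apply: le_trans (cmodD _ _) _.
have i1 : {subset S1 <= S} by move=> i iS; apply: sub; rewrite mem_undup mem_cat iS.
have i2 : {subset S2 <= S} by move=> i iS; apply: sub; rewrite mem_undup mem_cat iS orbT.
have := h1 S uS i1; have := h2 S uS i2; lra.
Qed.

Lemma sums_toZ I (f : I -> R[i]) L (c : R[i]) : sums_to f L -> sums_to (fun i => c * f i) (c * L).
Proof.
move=> h e e0; have c1 : 0 < cmod c + 1 by rewrite ltr_wpDl ?cmod_ge0.
have [S0 [u0 h0]] := h (e / (cmod c + 1)) (divr_gt0 e0 c1); exists S0; split => // S uS sub.
rewrite -mulr_sumr -mulrBr Normc.normcM.
apply: (@le_trans _ _ ((cmod c + 1) * (e / (cmod c + 1)))).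
  by apply: ler_pM; rewrite ?cmod_ge0 ?h0 // lerDl.
by rewrite mulrC divfK // gt_eqF.
Qed.

Lemma sums_to_conj I (f : I -> R[i]) L : sums_to f L -> sums_to (fun i => (f i)^*%C) (L^*)%C.
Proof.
move=> h e /h[S0 [u0 h0]]; exists S0; split => // S uS sub.
by rewrite -rmorph_sum -rmorphB cmod_conj; exact: h0.
Qed.

Lemma cmod_sums_to I (f : I -> R[i]) L B : sum_bounded (fun i => cmod (f i)) B -> sums_to f L ->
  cmod L <= B.
Proof.
move=> hB h; apply/ler_addgt0Pr => e /h[S0 [u0 /(_ S0 u0) h0]].
have := h0 (fun i => id); have := hB S0 u0; have := cmod_sum S0 xpredT f.
have := cmodB (\sum_(i <- S0) f i) (\sum_(i <- S0) f i - L); rewrite subKr; lra.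
Qed.

Lemma eq_sums_to I (f g : I -> R[i]) L : f =1 g -> sums_to f L -> sums_to g L.
Proof. by move=> /funext ->. Qed.

End Csum.

Lemma fct_addE (R : realType) (d : nat) (f g : fcoefs R d) n : (f + g) n = f n + g n.
Proof. by []. Qed.

Lemma fct_subE (R : realType) (d : nat) (f g : fcoefs R d) n : (f - g) n = f n - g n.
Proof. by []. Qed.

Section Sobolev.
Variables (R : realType) (d : nat) (s : R).
Implicit Types phi psi : fcoefs R d.

Let w (n : 'rV[int]_d) : R := japanese R n `^ s.
Let w_gt0 n : 0 < w n.
Proof. by apply: powR_gt0; exact: japanese_gt0. Qed.

Lemma Hs_norm_ge0 phi : 0 <= Hs_norm s phi.
Proof. exact: sqrtr_ge0. Qed.

Lemma Hs_sum phi : in_Hs s phi ->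
  sum_bounded (fun n => (japanese R n `^ s * cmod (phi n)) ^+ 2) (Hs_norm s phi ^+ 2).
Proof.
move=> h; have [hb he] := esum_fin_bounded (fun n => sqr_ge0 (japanese R n `^ s * cmod (phi n))) h.
move=> S uS; rewrite /Hs_norm sqr_sqrtr; first exact: hb.
by apply: le_trans (hb [::] isT); rewrite big_nil.
Qed.

Lemma Hs_intro phi (B : R) : 0 <= B ->
  sum_bounded (fun n => (japanese R n `^ s * cmod (phi n)) ^+ 2) (B ^+ 2) ->
  in_Hs s phi /\ Hs_norm s phi <= B.
Proof.
move=> B0 hB; have h := esum_le_bound hB.
have hin : in_Hs s phi by exact: le_lt_trans h (ltry _).
split=> //; have [_ he] := esum_fin_bounded (fun n => sqr_ge0 (japanese R n `^ s * cmod (phi n))) hin.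
by rewrite -(ger0_norm B0) -sqrtr_sqr /Hs_norm ler_wsqrtr // -lee_fin -he.
Qed.

Lemma Hs_coef phi n : in_Hs s phi -> japanese R n `^ s * cmod (phi n) <= Hs_norm s phi.
Proof.
move=> h; have := Hs_sum h (S := [:: n]) isT; rewrite big_seq1.
by rewrite ler_pXn2r // nnegrE ?Hs_norm_ge0 // mulr_ge0 ?cmod_ge0 ?powR_ge0.
Qed.

Lemma sum_sqrD_le (I : Type) (S : seq I) (a b : I -> R) (A B : R) : 0 <= A -> 0 <= B ->
  \sum_(i <- S) a i ^+ 2 <= A ^+ 2 -> \sum_(i <- S) b i ^+ 2 <= B ^+ 2 ->
  \sum_(i <- S) (a i + b i) ^+ 2 <= (A + B) ^+ 2.
Proof.
move=> A0 B0 hA hB; under eq_bigr => i _ do rewrite sqrrD.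
rewrite !big_split /= sqrrD; apply: lerD => //; apply: lerD => //.
suff key : \sum_(i <- S) a i * b i <= A * B by rewrite mulr2n lerD.
apply: le_trans (ler_norm _) _.
apply: normr_le_sqr; first exact: mulr_ge0.
apply: le_trans (sum_mul_sqr_le _ _ _) _; rewrite exprMn.
by apply: ler_pM => //; apply: sumr_ge0 => i _; exact: sqr_ge0.
Qed.

(** This carries bounds on finite sums of squares over to infinite sums and limits, whose
    values are known up to arbitrarily small errors only. *)
Lemma sum_sqr_perturb (I : eqType) (S : seq I) (x : I -> R) (B : R) : 0 <= B ->
  (forall i, 0 <= x i) ->
  (forall eta, 0 < eta -> exists y : I -> R, \sum_(i <- S) y i ^+ 2 <= B ^+ 2 /\
     forall i, i \in S -> 0 <= y i /\ x i <= y i + eta) ->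
  \sum_(i <- S) x i ^+ 2 <= B ^+ 2.
Proof.
move=> B0 x0 h; apply/ler_addgt0Pr => e' e'0.
suff hr r : 0 < r -> \sum_(i <- S) x i ^+ 2 <= (B + r) ^+ 2.
  have e1 : 0 < 2 * B + 1 by rewrite ltr_wpDl // mulr_ge0.
  pose r := Num.min 1 (e' / (2 * B + 1)).
  have r0 : 0 < r by rewrite lt_min ltr01 divr_gt0.
  have r1 : r <= 1 by rewrite ge_min lexx.
  have re : r * (2 * B + 1) <= e' by rewrite -ler_pdivlMr // ge_min lexx orbT.
  apply: le_trans (hr r r0) _; rewrite sqrrD -addrA lerD2l.
  have r2 : r ^+ 2 <= r by rewrite expr2 ler_piMl // ltW.
  by move: re r2; clearbody r; lra.
move=> r0; pose M := (size S).+1.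
have M0 : 0 < M%:R :> R by rewrite ltr0n.
have [y [hy hxy]] := h (r / M%:R) (divr_gt0 r0 M0).
have t2 : \sum_(i <- S) (r / M%:R) ^+ 2 <= r ^+ 2.
  apply: le_trans (@ler_sum_const _ _ S predT _ ((r / M%:R) ^+ 2) _) _ => //.
  apply: (@le_trans _ _ (M%:R * (r / M%:R) ^+ 2)).
    by rewrite ler_wpM2r ?sqr_ge0 // ler_nat /M ltnW // ltnS count_size.
  rewrite expr_div_n mulrCA ler_piMr ?sqr_ge0 // ler_pdivrMr ?exprn_gt0 // mul1r -natrX ler_nat.
  by rewrite -{1}(expn1 M) leq_pexp2l.
apply: le_trans (sum_sqrD_le B0 (ltW r0) hy t2).
rewrite big_seq [leRHS]big_seq; apply: ler_sum => i /hxy[yi xy].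
by rewrite ler_pXn2r ?nnegrE ?(le_trans (x0 i) xy).
Qed.

Lemma Hs_add phi psi : in_Hs s phi -> in_Hs s psi ->
  in_Hs s (phi + psi) /\ Hs_norm s (phi + psi) <= Hs_norm s phi + Hs_norm s psi.
Proof.
move=> h1 h2; apply: Hs_intro; first by rewrite addr_ge0 ?Hs_norm_ge0.
move=> S uS; apply: le_trans (sum_sqrD_le (Hs_norm_ge0 phi) (Hs_norm_ge0 psi) (Hs_sum h1 uS) (Hs_sum h2 uS)).
apply: ler_sum => n _; rewrite ler_pXn2r ?nnegrE ?addr_ge0 ?mulr_ge0 ?cmod_ge0 ?powR_ge0 //.
by rewrite -mulrDr; apply: ler_wpM2l; [exact: powR_ge0 | exact: cmodD].
Qed.

Lemma Hs_dom phi psi : (forall n, cmod (phi n) <= cmod (psi n)) -> in_Hs s psi ->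
  in_Hs s phi /\ Hs_norm s phi <= Hs_norm s psi.
Proof.
move=> hle h; apply: Hs_intro; first exact: Hs_norm_ge0.
move=> S uS; apply: le_trans (Hs_sum h uS); apply: ler_sum => n _.
by rewrite ler_pXn2r ?nnegrE ?mulr_ge0 ?cmod_ge0 ?powR_ge0 // ler_wpM2l ?powR_ge0.
Qed.

Lemma Hs_zero : in_Hs s (0 : fcoefs R d) /\ Hs_norm s (0 : fcoefs R d) = 0.
Proof.
have [h1 h2] : in_Hs s (0 : fcoefs R d) /\ Hs_norm s (0 : fcoefs R d) <= 0.
  apply: Hs_intro => // S uS; rewrite expr0n /= big1 // => n _.
  by rewrite /= expr0n /= addr0 sqrtr0 mulr0 expr0n.
by split => //; apply/eqP; rewrite eq_le h2 Hs_norm_ge0.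
Qed.

Lemma Hs_opp phi : in_Hs s phi -> in_Hs s (- phi) /\ Hs_norm s (- phi) = Hs_norm s phi.
Proof.
move=> h; have [h1 h2] := Hs_dom (phi := - phi) (psi := phi) (fun n => eq_ind_r (fun x => x <= _) (lexx _) (cmodN (phi n))) h.
split=> //; apply/eqP; rewrite eq_le h2 /=.
have [_] := Hs_dom (phi := phi) (psi := - phi) (fun n => eq_ind_r (fun x => _ <= x) (lexx _) (cmodN (phi n))) h1.
by [].
Qed.

Lemma Hs_sub phi psi : in_Hs s phi -> in_Hs s psi -> in_Hs s (phi - psi).
Proof. by move=> h1 h2; have [h _] := Hs_add h1 (proj1 (Hs_opp h2)). Qed.

Lemma Hs_norm_eq0 phi : in_Hs s phi -> Hs_norm s phi <= 0 -> phi = 0.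
Proof.
move=> h h0; apply/funext => n; apply: (@Normc.eq0_normc R); apply/eqP.
have := le_trans (Hs_coef n h) h0; rewrite pmulr_rle0 ?w_gt0 // => c0.
by rewrite eq_le c0 cmod_ge0.
Qed.

Lemma real_cauchy (u : nat -> R) :
  (forall e, 0 < e -> exists N, forall i j, (N <= i)%N -> (N <= j)%N -> `|u i - u j| <= e) ->
  exists l, forall e, 0 < e -> exists N, forall i, (N <= i)%N -> `|u i - l| <= e.
Proof.
move=> h; have cu : cvgn u.
  apply/cauchy_cvgP; apply: cauchy_exP => e e0.
  have [N hN] := h (e / 2) (divr_gt0 e0 (ltr0Sn _ 1)); exists (u N); exists N => // i /= Ni.
  apply: le_lt_trans (hN N i (leqnn _) Ni) _.
  by rewrite ltr_pdivrMr // mulr_natr mulr2n ltrDl.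
exists (limn u) => e e0; have /cvgrPdist_le /(_ e e0) [N _ hN] := cu.
by exists N => i Ni; rewrite distrC; exact: hN.
Qed.

Lemma complex_cauchy (u : nat -> R[i]) :
  (forall e, 0 < e -> exists N, forall i j, (N <= i)%N -> (N <= j)%N -> cmod (u i - u j) <= e) ->
  exists l, forall e, 0 < e -> exists N, forall i, (N <= i)%N -> cmod (u i - l) <= e.
Proof.
move=> h.
have [a ha] : exists l, forall e, 0 < e -> exists N, forall i, (N <= i)%N -> `|complex.Re (u i) - l| <= e.
  apply: real_cauchy => e /h[N hN]; exists N => i j Ni Nj; rewrite -re_sub.
  exact: le_trans (cmod_re _) (hN i j Ni Nj).
have [b hb] : exists l, forall e, 0 < e -> exists N, forall i, (N <= i)%N -> `|complex.Im (u i) - l| <= e.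
  apply: real_cauchy => e /h[N hN]; exists N => i j Ni Nj; rewrite -im_sub.
  exact: le_trans (cmod_im _) (hN i j Ni Nj).
exists (a +i* b)%C => e e0; have e2 : 0 < e / 2 by rewrite divr_gt0.
have [N1 h1] := ha _ e2; have [N2 h2] := hb _ e2; exists (maxn N1 N2) => i.
rewrite geq_max => /andP[i1 i2]; apply: le_trans (cmod_le _) _; rewrite re_sub im_sub /=.
have := h1 i i1; have := h2 i i2; lra.
Qed.

Lemma Hs_complete (u : nat -> fcoefs R d) : (forall i, in_Hs s (u i)) ->
  (forall e, 0 < e -> exists N, forall i j, (N <= i)%N -> (N <= j)%N -> Hs_norm s (u i - u j) <= e) ->
  exists2 l, in_Hs s l & forall e, 0 < e -> exists N, forall i, (N <= i)%N -> Hs_norm s (u i - l) <= e.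
Proof.
move=> hu hc.
have /choice[l hl] : forall n, exists l, forall e, 0 < e -> exists N, forall i, (N <= i)%N -> cmod (u i n - l) <= e.
  move=> n; apply: complex_cauchy => e e0.
  have [N hN] := hc (e * w n) (mulr_gt0 e0 (w_gt0 n)); exists N => i j Ni Nj.
  have := le_trans (Hs_coef n (Hs_sub (hu i) (hu j))) (hN i j Ni Nj).
  by rewrite -/(w n) mulrC ler_pM2r.
have main e : 0 < e -> exists N, forall i, (N <= i)%N -> in_Hs s (u i - l) /\ Hs_norm s (u i - l) <= e.
  move=> e0; have [N hN] := hc e e0; exists N => i Ni; apply: Hs_intro; first exact: ltW.
  move=> S uS; apply: sum_sqr_perturb => [|n|eta eta0]; first exact: ltW.
    by rewrite mulr_ge0 ?cmod_ge0 ?powR_ge0.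
  (* the finite sums for [u i - u j] converge to those for [u i - l] *)
  have [j [Nj hj]] : exists j, (N <= j)%N /\ forall n, n \in S -> w n * cmod (u j n - l n) <= eta.
    have hS (S' : seq 'rV[int]_d) : exists j0, forall j n, (j0 <= j)%N -> n \in S' -> w n * cmod (u j n - l n) <= eta.
      elim: S' => [|n0 S' [j0 IH]]; first by exists 0%N.
      have q0 : 0 < eta / w n0 by rewrite divr_gt0.
      have [j1 h1] := hl n0 _ q0; exists (maxn j0 j1) => j n; rewrite geq_max => /andP[ij0 ij1].
      rewrite in_cons => /orP[/eqP ->|]; last exact: IH.
      by have := h1 j ij1; rewrite ler_pdivlMr // mulrC.
    have [j0 hj0] := hS S; exists (maxn N j0); split; first exact: leq_maxl.
    by move=> n; apply: hj0; exact: leq_maxr.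
  exists (fun n => w n * cmod ((u i - u j) n)); split.
    apply: le_trans (Hs_sum (Hs_sub (hu i) (hu j)) uS) _.
    by rewrite ler_pXn2r ?nnegrE ?Hs_norm_ge0 ?(ltW e0) //; exact: hN.
  move=> n nS; split; first by rewrite mulr_ge0 ?cmod_ge0 ?powR_ge0.
  apply: le_trans (_ : w n * cmod ((u i - u j) n) + w n * cmod (u j n - l n) <= _).
    rewrite -mulrDr; apply: ler_wpM2l; first exact: powR_ge0.
    apply: le_trans (cmodD _ _).
    by rewrite !fct_subE addrA subrK.
  by rewrite lerD2l hj.
have [N0 h0] := main 1 ltr01; have [hd _] := h0 N0 (leqnn _).
exists l; last by move=> e /main[N hN]; exists N => i Ni; have [] := hN i Ni.
have := Hs_sub (hu N0) hd; by rewrite opprB addrCA subrr addr0.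
Qed.

Definition truncate (F : seq 'rV[int]_d) phi : fcoefs R d := fun n => if n \in F then phi n else 0.

Lemma Hs_finite_support (F : seq 'rV[int]_d) phi : in_Hs s (truncate F phi).
Proof.
pose B := \sum_(n <- undup F) (w n * cmod (phi n)) ^+ 2.
have B0 : 0 <= B by apply: sumr_ge0 => n _; exact: sqr_ge0.
have [] // := @Hs_intro (truncate F phi) (Num.sqrt B) (sqrtr_ge0 _).
move=> S uS; rewrite sqr_sqrtr //.
apply: le_trans (_ : \sum_(n <- S | n \in F) (w n * cmod (phi n)) ^+ 2 <= _).
  rewrite [leRHS]big_mkcond; apply: ler_sum => n _; rewrite /truncate; case: ifP => // _.
  by rewrite (Normc.normc0 R) mulr0 expr0n.
rewrite -big_filter; apply: ler_sum_subseq => [|n|n]; rewrite ?filter_uniq ?sqr_ge0 //.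
by rewrite mem_filter mem_undup => /andP[].
Qed.

Lemma Hs_truncate_approx phi (e : R) : in_Hs s phi -> 0 < e ->
  exists F, in_Hs s (phi - truncate F phi) /\ Hs_norm s (phi - truncate F phi) <= e.
Proof.
move=> h e0; have a0 n : 0 <= (japanese R n `^ s * cmod (phi n)) ^+ 2 by exact: sqr_ge0.
have [F [uF hF]] := esum_approx a0 h (exprn_gt0 2 e0).
have [hb _] := esum_fin_bounded a0 h; exists F; apply: Hs_intro; first exact: ltW.
move=> S uS; pose S' := undup (S ++ F).
have u' : uniq S' by exact: undup_uniq.
have sub : {subset F <= S'} by move=> n nF; rewrite mem_undup mem_cat nF orbT.
have := ler_sum_bounded_tail a0 uF u' sub (hb S' u') => ht.
apply: le_trans (_ : \sum_(n <- S' | n \notin F) (w n * cmod (phi n)) ^+ 2 <= _); last first.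
  by apply: le_trans ht _; move: hF; rewrite ltrBlDr lerBlDr addrC => /ltW.
rewrite -[leRHS]big_filter; apply: le_trans (_ : \sum_(n <- [seq n <- S | n \notin F]) (w n * cmod (phi n)) ^+ 2 <= _).
  rewrite [leRHS]big_filter [leRHS]big_mkcond; apply: ler_sum => n _.
  rewrite fct_subE /truncate; case: (n \in F) => /=; last by rewrite subr0.
  by rewrite subrr (Normc.normc0 R) mulr0 expr0n.
apply: ler_sum_subseq => [|n|n]; rewrite ?filter_uniq ?sqr_ge0 //.
by rewrite !mem_filter mem_undup mem_cat => /andP[-> ->].
Qed.

End Sobolev.

Lemma Hs_l1 (R : realType) (d : nat) (s : R) (phi : fcoefs R d) : (0 < d)%N -> d%:R / 2 < s ->
  in_Hs s phi -> exists B, sum_bounded (fun n => cmod (phi n)) B.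
Proof.
move=> d0 hs h; have [C hC] := sum_tuples 1 d0 hs.
exists (Num.sqrt (C * Hs_norm s phi ^+ 2)) => S uS.
pose c (n : 'rV[int]_d) : {ffun 'I_1 -> 'rV[int]_d} := [ffun=> n].
have := hC (map c S); rewrite map_inj_uniq; last by move=> n n' /ffunP/(_ ord0); rewrite !ffunE.
move=> /(_ uS); rewrite big_map; under eq_bigr => n _ do rewrite big_ord1 ffunE.
move=> hw; apply: le_trans (ler_norm _) _; rewrite -sqrtr_sqr ler_wsqrtr //.
have := sum_mul_sqr_le S (fun n => japanese R n `^ (- s)) (fun n => japanese R n `^ s * cmod (phi n)).
under eq_bigr => n _ do rewrite mulrA -powRD ?(gt_eqF (japanese_gt0 _ _)) ?implybT // addNr powRr0 mul1r.
move=> /le_trans; apply; apply: ler_pM => //; last exact: Hs_sum.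
  by apply: sumr_ge0 => n _; exact: sqr_ge0.
by apply: sumr_ge0 => n _; exact: sqr_ge0.
Qed.


Section TupleProducts.
Variables (R : realType) (J : finType) (I : choiceType).

Lemma prod_diff_le (r : seq J) (x y : J -> R[i]) (B : R) : 1 <= B ->
  (forall c, cmod (x c) <= B) -> (forall c, cmod (y c) <= B) ->
  cmod (\prod_(c <- r) x c - \prod_(c <- r) y c) <= B ^+ size r * \sum_(c <- r) cmod (x c - y c).
Proof.
move=> B1 hx hy; have B0 : 0 <= B by exact: le_trans B1.
elim: r => [|c r IH]; first by rewrite !big_nil subrr (Normc.normc0 R) mulr0.
rewrite !big_cons /=; set X := \prod_(c <- r) x c in IH *; set Y := \prod_(c <- r) y c in IH *.
have hX : cmod X <= B ^+ size r.
  rewrite cmod_prod; elim: (r) => [|a s IHs]; first by rewrite big_nil.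
  by rewrite big_cons exprS; apply: ler_pM => //; rewrite ?cmod_ge0 // prodr_ge0 // => i _; exact: cmod_ge0.
have -> : x c * X - y c * Y = (x c - y c) * X + y c * (X - Y) by ring.
apply: le_trans (cmodD _ _) _; rewrite !Normc.normcM mulrDr; apply: lerD.
  rewrite mulrC; apply: ler_pM; rewrite ?cmod_ge0 // (le_trans hX) // exprS ler_peMl ?exprn_ge0 //.
by rewrite exprS -mulrA; apply: ler_pM; rewrite ?cmod_ge0.
Qed.

(** Over a box of tuples the sum of products is the product of the sums, and boxes are
    cofinal; the limit along boxes is therefore the product of the limits. *)
Lemma sums_to_prod (g : J -> I -> R[i]) (L : J -> R[i]) (B : J -> R) :
  (forall c, sum_bounded (fun x => cmod (g c x)) (B c)) ->
  (forall c, sums_to (g c) (L c)) ->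
  sums_to (fun z : {ffun J -> I} => \prod_c g c (z c)) (\prod_c L c).
Proof.
move=> hB hL.
have hb : sum_bounded (fun z : {ffun J -> I} => cmod (\prod_c g c (z c))) (\prod_c B c).
  have -> : (fun z : {ffun J -> I} => cmod (\prod_c g c (z c))) = (fun z => \prod_c cmod (g c (z c))).
    by apply/funext => z; exact: cmod_prod.
  by apply: (sum_bounded_prod (w := fun c x => cmod (g c x))) => // c x; exact: cmod_ge0.
have hM := sums_to_csum hb; set M := csum _ in hM.
suff <- : M = \prod_c L c by [].
have Bc0 c : 0 <= B c by have := hB c [::] isT; rewrite big_nil.
pose BB := 1 + \sum_c B c.
have BB1 : 1 <= BB by rewrite lerDl sumr_ge0.
have BcB c : B c <= BB.
  by rewrite /BB (bigD1 c) //= addrCA lerDl addr_ge0 // sumr_ge0.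
pose K := BB ^+ #|J| * #|J|%:R + 1.
have K0 : 0 < K by rewrite ltr_wpDl // mulr_ge0 // exprn_ge0 // (le_trans ler01).
apply: cmod_le_eq => e e0; have e2 : 0 < e / 2 by rewrite divr_gt0.
have [S0 [u0 h0]] := hM _ e2.
have /choice[F hF] : forall c, exists Fc : seq I, uniq Fc /\ forall S, uniq S -> {subset Fc <= S} ->
    cmod (\sum_(i <- S) g c i - L c) <= e / 2 / K.
  by move=> c; apply: hL; rewrite divr_gt0.
pose T := undup (entries S0 ++ flatten [seq F c | c <- enum J]).
have uT : uniq T by exact: undup_uniq.
have FT c : {subset F c <= T}.
  move=> x xF; rewrite mem_undup mem_cat; apply/orP; right; apply/flattenP; exists (F c) => //.
  by apply: map_f; rewrite mem_enum.
have hd : cmod (\prod_c \sum_(x <- T) g c x - \prod_c L c) <= e / 2.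
  apply: le_trans (@prod_diff_le (index_enum J) _ _ BB BB1 _ _) _.
  - move=> c; apply: le_trans (cmod_sum _ _ _) _; exact: le_trans (hB c T uT) (BcB c).
  - by move=> c; apply: le_trans (cmod_sums_to (hB c) (hL c)) (BcB c).
  have szJ : size (index_enum J) = #|J| by rewrite -sum1_size -[RHS]sum1_card.
  rewrite szJ.
  apply: (@le_trans _ _ (BB ^+ #|J| * (#|J|%:R * (e / 2 / K)))).
    rewrite ler_wpM2l ?exprn_ge0 ?(le_trans ler01) //.
    apply: le_trans (ler_sum_const _ (b := e / 2 / K) _) _ => [c _|].
      by have [_] := hF c; apply.
    by rewrite count_predT szJ.
  pose q := e / 2 / K; have qE : e / 2 = K * q by rewrite /q (mulrC K) divfK // gt_eqF.
  have q0 : 0 <= q by rewrite divr_ge0 // ltW.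
  by rewrite -/q qE mulrA ler_wpM2r // /K lerDl.
have := h0 (box J T) (box_uniq J T) ltac:(by apply: sub_box => x xS; rewrite mem_undup mem_cat xS).
rewrite sum_box // => hd2.
have := cmodB (\prod_c \sum_(x <- T) g c x - \prod_c L c) (\prod_c \sum_(x <- T) g c x - M).
rewrite opprB addrC addrA subrK => /le_trans; apply; lra.
Qed.

End TupleProducts.

(** * The explicit multiplier *)

Definition cj (R : rcfType) (b : bool) (c : R[i]) : R[i] := if b then (c^*)%C else c.

Lemma cmod_cj (R : rcfType) (b : bool) (c : R[i]) : cmod (cj b c) = cmod c.
Proof. by case: b => //; exact: cmod_conj. Qed.

Section Operator.
Variables (R : realType) (d m : nat).
Implicit Types (z : {ffun 'I_m -> 'rV[int]_d}) (mu : int -> R[i]) (f : 'I_m -> fcoefs R d).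

Definition conv_freq z : 'rV[int]_d := \sum_(j < m) sgz_if (odd j) (z j).

Definition omega (n : 'rV[int]_d) z : int := isq n - \sum_(j < m) sgz_if (odd j) (isq (z j)).

Definition op_term mu n f z : R[i] :=
  if conv_freq z == n then mu (omega n z) * \prod_(j < m) cj (odd j) (f j (z j)) else 0.

(** The multilinear Fourier multiplier whose symbol depends on the resonance function
    only; the operator [X_t] is the case [mu = - i Phi_t]. *)
Definition multop mu f : fcoefs R d := fun n => csum (op_term mu n f).

Lemma slot_sgsum (A : zmodType) (T : finType) (phi : T -> A) (ze : {ffun option 'I_m -> T}) :
  sgsum phi (@slot_sign m) ze =
  \sum_(j < m) sgz_if (odd j) (phi (ze (Some j))) - phi (ze None).
Proof. by rewrite /sgsum big_optionE /= addrC. Qed.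

End Operator.

Section OperatorBound.
Variables (R : realType) (d k : nat) (rho s : R).
Let m := k.*2.+1.
Hypotheses (d0 : (0 < d)%N) (k0 : (0 < k)%N) (dk : (d, k) <> (1%N, 1%N)).
Hypotheses (rho0 : 0 < rho) (rho1 : rho <= 1) (hs : d%:R / 2 - rho / k%:R < s).
Let w (n : 'rV[int]_d) : R := japanese R n `^ s.

(** The finite estimate is applied on the finite set of all frequencies that occur; the
    powers of the frequencies move from the form to the inputs and the test function [g]. *)
Lemma op_finite_sum : exists2 C : R, 0 <= C &
  forall (mu : int -> R[i]) (K : R) (f : 'I_m -> fcoefs R d) (S : seq 'rV[int]_d)
    (Z : 'rV[int]_d -> seq {ffun 'I_m -> 'rV[int]_d}) (g : 'rV[int]_d -> R) (G : R),
    0 <= K -> (forall a : int, cmod (mu a) <= K * (1 + `|a|)%:~R `^ (- rho)) ->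
    (forall j, in_Hs s (f j)) -> uniq S -> (forall n, uniq (Z n)) ->
    (forall n, 0 <= g n) -> 0 <= G -> \sum_(n <- S) g n ^+ 2 <= G ^+ 2 ->
    \sum_(n <- S) g n * (w n * \sum_(z <- Z n) cmod (op_term mu n f z)) <=
      C * K * G * \prod_j Hs_norm s (f j).
Proof.
have [C C0 hC] := multilinear_finite d0 k0 dk rho0 rho1 hs; exists C => // mu K f S Z g G K0 hmu hf uS uZ g0 G0 hG.
have w0 n : 0 < w n by apply: powR_gt0; exact: japanese_gt0.
pose U := undup (S ++ flatten [seq entries (Z n) | n <- S]).
have uU : uniq U by exact: undup_uniq.
pose T := seq_sub U.
pose g' n := if n \in S then g n else 0.
have g'0 n : 0 <= g' n by rewrite /g'; case: ifP.
pose b (i : option 'I_m) (t : T) : R :=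
  if i is Some j then w (val t) * cmod (f j (val t)) else g' (val t).
pose N (i : option 'I_m) : R := if i is Some j then Hs_norm s (f j) else G.
have b0 i t : 0 <= b i t by case: i => [j|] /=; rewrite ?mulr_ge0 ?cmod_ge0 ?(ltW (w0 _)).
have N0 i : 0 <= N i by case: i => [j|] //=; exact: Hs_norm_ge0.
have hb i : \sum_t b i t ^+ 2 <= N i ^+ 2.
  case: i => [j|] /=.
    rewrite (sum_seq_sub (fun n => (w n * cmod (f j n)) ^+ 2)) //; exact: Hs_sum.
  rewrite (sum_seq_sub (fun n => g' n ^+ 2)) //; apply: le_trans hG.
  have -> : \sum_(n <- U) g' n ^+ 2 = \sum_(n <- U | n \in S) g n ^+ 2.
    by rewrite [RHS]big_mkcond; apply: eq_bigr => n _; rewrite /g'; case: ifP => // _; rewrite expr0n.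
  rewrite -big_filter; apply: ler_sum_subseq => [|n|n]; rewrite ?filter_uniq ?sqr_ge0 //.
  by rewrite mem_filter => /andP[].
have := hC T val b N val_inj b0 N0 hb.
have -> : \prod_i N i = G * \prod_j Hs_norm s (f j) by rewrite big_optionE.
move=> main.
pose F (nz : 'rV[int]_d * {ffun 'I_m -> 'rV[int]_d}) : R := if conv_freq nz.2 == nz.1 then
   K * (((1 + `|omega nz.1 nz.2|)%:~R `^ (- rho) *
    (w nz.1 * \prod_j japanese R (nz.2 j) `^ (- s))) * (g' nz.1 * \prod_j (w (nz.2 j) * cmod (f j (nz.2 j))))) else 0.
have F0 nz : 0 <= F nz.
  rewrite /F; case: ifP => // _; rewrite !mulr_ge0 ?powR_ge0 ?(ltW (w0 _)) //.
    by apply: prodr_ge0 => j _; exact: powR_ge0.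
  by apply: prodr_ge0 => j _; rewrite mulr_ge0 ?cmod_ge0 ?(ltW (w0 _)).
pose h (ze : {ffun option 'I_m -> T}) : 'rV[int]_d * {ffun 'I_m -> 'rV[int]_d} :=
  (val (ze None), [ffun j => val (ze (Some j))]).
pose P := [seq (n, z) | n <- S, z <- Z n].
have uP : uniq P.
  apply: allpairs_uniq_dep => // -[n z] [n' z'] _ _ /= [-> ->] //.
have PF : \sum_(n <- S) g n * (w n * \sum_(z <- Z n) cmod (op_term mu n f z)) <= \sum_(nz <- P) F nz.
  rewrite /P big_allpairs_dep /= big_seq [leRHS]big_seq; apply: ler_sum => n nS.
  rewrite mulr_sumr mulr_sumr; apply: ler_sum => z _; rewrite /F /op_term /=.
  case: ifP => _; last by rewrite (Normc.normc0 R) !mulr0.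
  rewrite /g' nS Normc.normcM cmod_prod; under eq_bigr => j _ do rewrite cmod_cj.
  rewrite big_split /=.
  have -> : K * ((1 + `|omega n z|)%:~R `^ (- rho) * (w n * \prod_(i < m) japanese R (z i) `^ (- s)) *
       (g n * (\prod_(i < m) w (z i) * \prod_(i < m) cmod (f i (z i))))) =
      g n * (w n * (K * (1 + `|omega n z|)%:~R `^ (- rho) * \prod_(i < m) cmod (f i (z i)))).
    have -> : \prod_(i < m) w (z i) = (\prod_(i < m) japanese R (z i) `^ (- s))^-1.
      rewrite -prodfV; apply: eq_bigr => i _; by rewrite powRN invrK.
    have p0 : \prod_(i < m) japanese R (z i) `^ (- s) != 0.
      by rewrite gt_eqF // prodr_gt0 // => i _; rewrite powR_gt0 ?japanese_gt0.
    by field.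
  apply: ler_wpM2l => //; apply: ler_wpM2l; first exact: ltW.
  by apply: ler_wpM2r; [apply: prodr_ge0 => i _; exact: cmod_ge0 | exact: hmu].
apply: le_trans PF _; apply: (@le_trans _ _ (\sum_(nz <- [seq h ze | ze : {ffun option 'I_m -> T}]) F nz)).
  apply: ler_sum_subseq => // -[n z] /allpairsPdep[n' [z' [nS zZ [-> ->]]]].
  have nU : n' \in U by rewrite mem_undup mem_cat nS.
  have zU j : z' j \in U.
    rewrite mem_undup mem_cat; apply/orP; right; apply/flattenP; exists (entries (Z n')).
      exact: map_f.
    by rewrite mem_undup; apply/allpairsP; exists (z', j); rewrite mem_enum.
  apply/mapP; exists [ffun i => if i is Some j then SeqSub (zU j) else SeqSub nU]; first by rewrite mem_enum.
  by rewrite /h !ffunE /=; congr pair; apply/ffunP => j; rewrite !ffunE.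
rewrite big_image /= (_ : C * K * G * _ = K * (C * (G * \prod_j Hs_norm s (f j)))); last by ring.
apply: le_trans (ler_wpM2l K0 main); rewrite mulr_sumr [leRHS]big_mkcond /=; apply: ler_sum => ze _.
rewrite /F /h /= slot_sgsum subr_eq0 /conv_freq.
rewrite [X in X == _](eq_bigr (fun j : 'I_m => sgz_if (odd j) (val (ze (Some j))))); last by move=> j _; rewrite ffunE.
case: ifP => // _; apply: ler_wpM2l => //.
have -> : \prod_i b i (ze i) = g' (val (ze None)) * \prod_j (w (val (ze (Some j))) * cmod (f j (val (ze (Some j))))).
  by rewrite big_optionE.
have -> : `|omega (val (ze None)) [ffun j : 'I_m => val (ze (Some j))]| = `|resonance val ze|.
  rewrite /resonance slot_sgsum -normrN opprB /omega; congr (`|_ - _|).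
  by apply: eq_bigr => j _; rewrite ffunE.
rewrite (eq_bigr (fun j : 'I_m => japanese R (val (ze (Some j))) `^ (- s))); last by move=> j _; rewrite ffunE.
rewrite [X in _ * (g' _ * X) <= _](eq_bigr (fun j : 'I_m => w (val (ze (Some j))) * cmod (f j (val (ze (Some j)))))); last by move=> j _; rewrite ffunE.
exact: lexx.
Qed.

(** The square sum of the output is tested against itself, and absolute convergence at one
    frequency is the case of a test function supported there. *)
Lemma multop_bound : exists2 C : R, 0 <= C &
  forall (mu : int -> R[i]) (K : R) (f : 'I_m -> fcoefs R d),
    0 <= K -> (forall a : int, cmod (mu a) <= K * (1 + `|a|)%:~R `^ (- rho)) ->
    (forall j, in_Hs s (f j)) ->
    [/\ forall n, exists B, sum_bounded (fun z => cmod (op_term mu n f z)) B,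
        in_Hs s (multop mu f) & Hs_norm s (multop mu f) <= C * K * \prod_j Hs_norm s (f j)].
Proof.
have [C C0 hC] := op_finite_sum; exists C => // mu K f K0 hmu hf.
have w0 n : 0 < w n by apply: powR_gt0; exact: japanese_gt0.
set P := \prod_j Hs_norm s (f j); have P0 : 0 <= P by apply: prodr_ge0 => j _; exact: Hs_norm_ge0.
have Q0 : 0 <= C * K * P by rewrite !mulr_ge0.
have hsum n : exists B, sum_bounded (fun z => cmod (op_term mu n f z)) B.
  exists (C * K * P / w n) => S uS; rewrite ler_pdivlMr // mulrC.
  have := hC mu K f [:: n] (fun=> S) (fun=> 1) 1 K0 hmu hf isT (fun=> uS) (fun=> ler01) ler01.
  by rewrite !big_seq1 !mul1r mulr1; apply; rewrite expr1n.
suff [h1 h2] : in_Hs s (multop mu f) /\ Hs_norm s (multop mu f) <= C * K * P by split.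
apply: Hs_intro => // S uS.
apply: sum_sqr_perturb => // [n|eta eta0]; first by rewrite mulr_ge0 ?cmod_ge0 ?powR_ge0.
have /choice[Z hZ] : forall n, exists Zn, uniq Zn /\
    w n * cmod (multop mu f n) <= w n * \sum_(z <- Zn) cmod (op_term mu n f z) + eta.
  move=> n; have [B hB] := hsum n.
  have [Zn [uZ /(_ Zn uZ (fun=> id)) hZ]] := sums_to_csum hB (divr_gt0 eta0 (w0 n)).
  exists Zn; split => //.
  have := cmodB (\sum_(z <- Zn) op_term mu n f z) (\sum_(z <- Zn) op_term mu n f z - multop mu f n).
  rewrite subKr => h; have : cmod (multop mu f n) <= \sum_(z <- Zn) cmod (op_term mu n f z) + eta / w n.
    by apply: le_trans h _; apply: lerD => //; exact: cmod_sum.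
  by move=> /(ler_wpM2l (ltW (w0 n))); rewrite mulrDr (mulrC (w n) (eta / _)) divfK // gt_eqF.
pose y n := w n * \sum_(z <- Z n) cmod (op_term mu n f z).
have y0 n : 0 <= y n by rewrite mulr_ge0 ?(ltW (w0 _)) // sumr_ge0 // => z _; exact: cmod_ge0.
exists y; split; last by move=> n _; split => //; have [] := hZ n.
pose G := Num.sqrt (\sum_(n <- S) y n ^+ 2).
have S0 : 0 <= \sum_(n <- S) y n ^+ 2 by apply: sumr_ge0 => n _; exact: sqr_ge0.
have G2 : G ^+ 2 = \sum_(n <- S) y n ^+ 2 by rewrite sqr_sqrtr.
have := hC mu K f S Z y G K0 hmu hf uS (fun n => proj1 (hZ n)) y0 (sqrtr_ge0 _).
rewrite G2 => /(_ (lexx _)); rewrite -/P -/y.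
have -> : \sum_(n <- S) y n * (w n * \sum_(z <- Z n) cmod (op_term mu n f z)) = G ^+ 2.
  by rewrite G2; apply: eq_bigr => n _; rewrite expr2.
move=> hG; have [G0|G0] := eqVneq G 0; first by rewrite G0 expr0n sqr_ge0.
have Gp : 0 < G by rewrite lt0r G0 sqrtr_ge0.
have : G <= C * K * P by move: hG; rewrite expr2 mulrAC ler_pM2r.
by move=> h; rewrite ler_pXn2r ?nnegrE ?(ltW Gp).
Qed.

End OperatorBound.

(** * The operator on regular functions *)

Lemma csum_tail (R : realType) (I : choiceType) (b f : I -> R[i]) (B : R) (S : seq I) :
  sum_bounded (fun i => cmod (b i)) B -> (forall i, cmod (f i) <= cmod (b i)) -> uniq S ->
  cmod (\sum_(i <- S) f i - csum f) <=
    fine (\esum_(i in [set: I]) (cmod (b i))%:E) - \sum_(i <- S) cmod (b i).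
Proof.
move=> hB hf uS; have c0 i : 0 <= cmod (b i) by exact: cmod_ge0.
have [hb _] := esum_fin_bounded c0 (le_lt_trans (esum_le_bound hB) (ltry _)).
have hfB : sum_bounded (fun i => cmod (f i)) B.
  by move=> S' /hB; apply: le_trans; apply: ler_sum.
apply/ler_addgt0Pr => e e0; have [S0 [u0 h0]] := sums_to_csum hfB e0.
pose S' := undup (S ++ S0).
have uS' : uniq S' by exact: undup_uniq.
have := h0 S' uS' ltac:(by move=> i iS; rewrite mem_undup mem_cat iS orbT) => h1.
have sub : {subset S <= S'} by move=> i iS; rewrite mem_undup mem_cat iS.
have h2 := ler_sum_bounded_tail c0 uS uS' sub (hb S' uS').
have h3 : cmod (\sum_(i <- S) f i - \sum_(i <- S') f i) <= \sum_(i <- S' | i \notin S) cmod (b i).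
  rewrite [X in _ - X](bigID (mem S)) /= opprD addrA.
  have -> : \sum_(i <- S) f i = \sum_(i <- S' | i \in S) f i.
    rewrite -[RHS]big_filter; apply: perm_big; apply: uniq_perm => //; first exact: filter_uniq.
    by move=> i; rewrite mem_filter; case: (boolP (i \in S)) => // /sub ->.
  rewrite subrr sub0r cmodN; apply: le_trans (cmod_sum _ _ _) _.
  by apply: ler_sum.
have := cmodD (\sum_(i <- S) f i - \sum_(i <- S') f i) (\sum_(i <- S') f i - csum f).
by rewrite addrA subrK; lra.
Qed.

Section ComplexIntegral.
Variables (R : realType) (a b : R).
Hypothesis ab : a <= b.
Notation mu := (@lebesgue_measure R).
Let D : set R := `[a, b]%classic.

Definition bounded_measurable (f : R -> R[i]) (B : R) : Prop :=
  [/\ measurable_fun D (fun x => complex.Re (f x)), measurable_fun D (fun x => complex.Im (f x))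
    & forall x, a <= x <= b -> cmod (f x) <= B].

Let mD : measurable D. Proof. exact: measurable_itv. Qed.

Let muD : mu D = (b - a)%:E.
Proof.
rewrite lebesgue_measure_itv /= lte_fin; case: ltP => // ba.
have -> : b = a by apply/eqP; rewrite eq_le ab ba.
by rewrite subrr.
Qed.

Lemma real_integrable (f : R -> R) (B : R) : measurable_fun D f ->
  (forall x, a <= x <= b -> `|f x| <= B) -> mu.-integrable D (EFin \o f).
Proof.
move=> mf hB; apply: measurable_bounded_integrable => //; first by apply: (@le_lt_trans _ _ (b - a)%:E); [rewrite -muD; exact: lexx | exact: ltry].
exists B; split; first exact: num_real.
by move=> M BM x; rewrite /D /= in_itv => /hB h; apply: le_trans h (ltW BM).
Qed.

Lemma real_integral_le (f : R -> R) (B : R) : measurable_fun D f ->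
  (forall x, a <= x <= b -> `|f x| <= B) -> `|Rintegral mu D f| <= B * (b - a).
Proof.
move=> mf hB; have fi := real_integrable mf hB.
have := @le_normr_Rintegral _ _ _ mu D f mD fi => hh; apply: le_trans hh _.
have -> : B * (b - a) = Rintegral mu D (fun=> B) by rewrite Rintegral_cst // -[fine _]/(fine (mu D)) muD.
apply: le_Rintegral => //.
- apply: (@real_integrable _ B); first exact: measurableT_comp.
  by move=> x /hB; rewrite normr_id.
- by apply: (@real_integrable _ `|B|) => //; exact: measurable_cst.
Qed.

Lemma bm_re f B : bounded_measurable f B -> mu.-integrable D (EFin \o (fun x => complex.Re (f x))).
Proof.
by move=> [m1 _ h]; apply: (real_integrable m1 (B := B)) => x /h; apply: le_trans; exact: cmod_re.
Qed.

Lemma bm_im f B : bounded_measurable f B -> mu.-integrable D (EFin \o (fun x => complex.Im (f x))).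
Proof.
by move=> [_ m2 h]; apply: (real_integrable m2 (B := B)) => x /h; apply: le_trans; exact: cmod_im.
Qed.

Lemma cintegral_le f B : bounded_measurable f B -> cmod (cintegral a b f) <= 2 * B * (b - a).
Proof.
move=> [m1 m2 h]; apply: le_trans (cmod_le _) _; rewrite -mulrA mulr_natl mulr2n; apply: lerD.
  by apply: real_integral_le => // x /h; apply: le_trans; exact: cmod_re.
by apply: real_integral_le => // x /h; apply: le_trans; exact: cmod_im.
Qed.

Lemma bmD f g B C : bounded_measurable f B -> bounded_measurable g C ->
  bounded_measurable (fun x => f x + g x) (B + C) /\
  cintegral a b (fun x => f x + g x) = cintegral a b f + cintegral a b g.
Proof.
move=> bf bg; have [m1 m2 h] := bf; have [n1 n2 h'] := bg.
have er : (fun x => complex.Re (f x + g x)) = (fun x => complex.Re (f x) + complex.Re (g x)).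
  by apply/funext => x; case: (f x) (g x) => ? ? [].
have ei : (fun x => complex.Im (f x + g x)) = (fun x => complex.Im (f x) + complex.Im (g x)).
  by apply/funext => x; case: (f x) (g x) => ? ? [].
split.
  split; rewrite ?er ?ei; [exact: measurable_realfun.measurable_funD | exact: measurable_realfun.measurable_funD |].
  by move=> x xab; apply: le_trans (cmodD _ _) _; apply: lerD; [exact: h | exact: h'].
rewrite /cintegral er ei !RintegralD //; [exact: bm_im bf | exact: bm_im bg | exact: bm_re bf | exact: bm_re bg].
Qed.

Lemma bmZ (c : R[i]) f B : bounded_measurable f B ->
  bounded_measurable (fun x => c * f x) (cmod c * B) /\
  cintegral a b (fun x => c * f x) = c * cintegral a b f.
Proof.
move=> bf; have [m1 m2 h] := bf.
have er : (fun x => complex.Re (c * f x)) =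
    (fun x => complex.Re c * complex.Re (f x) - complex.Im c * complex.Im (f x)).
  by apply/funext => x; case: c (f x) => ? ? [].
have ei : (fun x => complex.Im (c * f x)) =
    (fun x => complex.Re c * complex.Im (f x) + complex.Im c * complex.Re (f x)).
  by apply/funext => x; case: c {er} (f x) => ? ? [].
have mZ r (g : R -> R) : measurable_fun D g -> measurable_fun D (fun x => r * g x).
  by move=> mg; apply: measurable_realfun.measurable_funM => //; exact: measurable_cst.
have iZ r (g : R -> R) : measurable_fun D g -> (forall x, a <= x <= b -> `|g x| <= B) ->
    mu.-integrable D (EFin \o (fun x => r * g x)).
  move=> mg hg; apply: (@real_integrable _ (`|r| * B)); first exact: mZ.
  by move=> x /hg; rewrite normrM => ?; exact: ler_wpM2l.
have hr x : a <= x <= b -> `|complex.Re (f x)| <= B by move=> /h; apply: le_trans; exact: cmod_re.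
have hi x : a <= x <= b -> `|complex.Im (f x)| <= B by move=> /h; apply: le_trans; exact: cmod_im.
split.
  split; rewrite ?er ?ei; [by apply: measurable_realfun.measurable_funB; exact: mZ | by apply: measurable_realfun.measurable_funD; exact: mZ |].
  by move=> x /h; rewrite Normc.normcM => ?; apply: ler_wpM2l => //; exact: cmod_ge0.
rewrite /cintegral er ei RintegralB ?RintegralD //; try exact: iZ.
rewrite !RintegralZl //; try (by [exact: bm_re bf | exact: bm_im bf]).
by case: c {er ei}.
Qed.

Lemma bm0 : bounded_measurable (fun=> 0) 0 /\ cintegral a b (fun=> 0 : R[i]) = 0.
Proof.
split; first by split; [exact: measurable_cst | exact: measurable_cst | by move=> x _; rewrite (Normc.normc0 R)].
by rewrite /cintegral /= !Rintegral_cst // mul0r.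
Qed.

Lemma bm_sum (I : Type) (S : seq I) (F : I -> R -> R[i]) (B : I -> R) :
  (forall i, bounded_measurable (F i) (B i)) ->
  bounded_measurable (fun x => \sum_(i <- S) F i x) (\sum_(i <- S) B i) /\
  cintegral a b (fun x => \sum_(i <- S) F i x) = \sum_(i <- S) cintegral a b (F i).
Proof.
move=> h; elim: S => [|i S [IH1 IH2]].
  have -> : (fun x => \sum_(i <- [::]) F i x) = (fun=> 0) by apply/funext => x; rewrite big_nil.
  by rewrite !big_nil; exact: bm0.
have -> : (fun x => \sum_(i <- i :: S) F i x) = (fun x => F i x + \sum_(i <- S) F i x).
  by apply/funext => x; rewrite big_cons.
have [h1 h2] := bmD (h i) IH1; rewrite !big_cons h2 IH2; split => //.
Qed.

(** The tails of the series are bounded, uniformly in [x], by those of the sum of the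
    [cmod (c i)]; this yields the measurability of the sum and the exchange of limits. *)
Lemma cintegral_csum (I : choiceType) (c : I -> R[i]) (e : I -> R -> R[i]) (B : R) :
  sum_bounded (fun i => cmod (c i)) B -> (forall i, bounded_measurable (e i) 1) ->
  bounded_measurable (fun x => csum (fun i => c i * e i x)) B /\
  sums_to (fun i => c i * cintegral a b (e i)) (cintegral a b (fun x => csum (fun i => c i * e i x))).
Proof.
move=> hB he; set g := fun x => csum _.
pose t := fine (\esum_(i in [set: I]) (cmod (c i))%:E).
have c0 i : 0 <= cmod (c i) by exact: cmod_ge0.
have tfin := le_lt_trans (esum_le_bound hB) (ltry _).
have ce x i : a <= x <= b -> cmod (c i * e i x) <= cmod (c i).
  by move=> xab; have [_ _ /(_ x xab) h] := he i; rewrite Normc.normcM ler_piMr.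
have hfin S x : a <= x <= b -> uniq S ->
    cmod (\sum_(i <- S) c i * e i x - g x) <= t - \sum_(i <- S) cmod (c i).
  move=> xab uS; apply: (csum_tail hB) => // i; exact: ce.
have gB x : a <= x <= b -> cmod (g x) <= B.
  move=> xab; have hfB : sum_bounded (fun i => cmod (c i * e i x)) B.
    by move=> S uS; apply: le_trans (hB S uS); apply: ler_sum => i _; exact: ce.
  exact: cmod_sums_to hfB (sums_to_csum hfB).
have /choice[S hS] : forall k : nat, exists S, uniq S /\ t - k.+1%:R^-1 < \sum_(i <- S) cmod (c i).
  by move=> k; apply: esum_approx => //; rewrite invr_gt0.
have bmS L := @bm_sum I L (fun i x => c i * e i x) _ (fun i => proj1 (bmZ (c i) (he i))).
have lim x k : a <= x <= b -> cmod (\sum_(i <- S k) c i * e i x - g x) <= k.+1%:R^-1.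
  move=> xab; have [uS hk] := hS k; apply: le_trans (hfin _ _ xab uS) _.
  by rewrite lerBlDr addrC -lerBlDr ltW.
have cvgk (u : nat -> R) (l : R) : (forall k, `|u k - l| <= k.+1%:R^-1) -> u @ \oo --> l.
  move=> h; apply/cvgrPdist_le => e' e'0.
  have := @near_infty_natSinv_lt R (PosNum e'0); apply: filterS => k /= hk.
  by rewrite distrC; apply: le_trans (h k) (ltW hk).
have mre : measurable_fun D (fun x => complex.Re (g x)).
  apply: (@measurable_realfun.measurable_fun_cvg _ _ _ _ (fun k x => complex.Re (\sum_(i <- S k) c i * e i x))).
    by move=> k; have [[]] := bmS (S k).
  move=> x Dx; have xab : a <= x <= b by move: Dx; rewrite /D /= in_itv.
  apply: (cvgk _ (complex.Re (g x))) => k; have := cmod_re (\sum_(i <- S k) c i * e i x - g x).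
  by rewrite re_sub => h; apply: le_trans h (lim x k xab).
have mim : measurable_fun D (fun x => complex.Im (g x)).
  apply: (@measurable_realfun.measurable_fun_cvg _ _ _ _ (fun k x => complex.Im (\sum_(i <- S k) c i * e i x))).
    by move=> k; have [[]] := bmS (S k).
  move=> x Dx; have xab : a <= x <= b by move: Dx; rewrite /D /= in_itv.
  apply: (cvgk _ (complex.Im (g x))) => k; have := cmod_im (\sum_(i <- S k) c i * e i x - g x).
  by rewrite im_sub => h; apply: le_trans h (lim x k xab).
have bg : bounded_measurable g B by split.
split=> // eps eps0.
pose K := 2 * (b - a) + 1.
have K0 : 0 < K by rewrite ltr_wpDl // mulr_ge0 // subr_ge0.
have [S0 [u0 h0]] := esum_approx c0 tfin (divr_gt0 eps0 K0); exists S0; split => // L uL sub.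
have hL : t - \sum_(i <- L) cmod (c i) <= eps / K.
  have : \sum_(i <- S0) cmod (c i) <= \sum_(i <- L) cmod (c i) by exact: ler_sum_subseq.
  move: h0; rewrite -/t; lra.
have [b1 e1] := bmS L.
have [b2 e2] := bmZ (-1) bg.
have [[n1 n2 _] e3] := bmD b1 b2.
have b3 : bounded_measurable (fun x => \sum_(i <- L) c i * e i x + -1 * g x) (eps / K).
  split => // x xab; rewrite mulN1r; exact: le_trans (hfin L x xab uL) hL.
have := cintegral_le b3; rewrite e3 e1 e2 mulN1r.
rewrite (eq_bigr (fun i => c i * cintegral a b (e i))); last first.
  by move=> i _; have [_ ->] := bmZ (c i) (he i).
move=> h; apply: le_trans h _; rewrite mulrAC -mulrA; apply: (@le_trans _ _ (K * (eps / K))).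
  by rewrite mulrA ler_wpM2r ?divr_ge0 ?(ltW eps0) ?(ltW K0) // /K lerDl.
by rewrite mulrC divfK // gt_eqF.
Qed.

End ComplexIntegral.

Section Cexpi.
Variable R : realType.
Implicit Types x y : R.

Lemma cexpi0 : cexpi (0 : R) = 1.
Proof. by rewrite /cexpi cos0 sin0. Qed.

Lemma cexpiD x y : cexpi (x + y) = cexpi x * cexpi y.
Proof. by rewrite /cexpi cosD sinD; simpc; congr (_ +i* _)%C; rewrite addrC. Qed.

Lemma cexpiN x : cexpi (- x) = (cexpi x)^*%C.
Proof. by rewrite /cexpi cosN sinN. Qed.

Lemma cj_cexpi b x : cj b (cexpi x) = cexpi (sgz_if b x).
Proof. by case: b => //=; rewrite cexpiN. Qed.

Lemma cmod_cexpi x : cmod (cexpi x) = 1.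
Proof. by rewrite /= cos2Dsin2 sqrtr1. Qed.

Lemma cexpi_sum (I : Type) (r : seq I) (F : I -> R) :
  cexpi (\sum_(i <- r) F i) = \prod_(i <- r) cexpi (F i).
Proof. exact: (big_morph _ cexpiD cexpi0). Qed.

Lemma bounded_measurable_cexpi (a b : R) (g : R -> R) :
  measurable_fun (`[a, b]%classic : set R) g -> bounded_measurable a b (fun x => cexpi (g x)) 1.
Proof.
move=> mg; split; last by move=> x _; rewrite cmod_cexpi.
- apply: (@measurableT_comp _ _ _ _ _ _ (@cos R)) => //.
  exact: measurable_realfun.continuous_measurable_fun (@continuous_cos R).
- apply: (@measurableT_comp _ _ _ _ _ _ (@sin R)) => //.
  exact: measurable_realfun.continuous_measurable_fun (@continuous_sin R).
Qed.

Lemma Rintegral_derive (f F : R -> R) (a b : R) : a < b -> (forall x, is_derive x 1 F (f x)) ->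
  continuous f -> Rintegral lebesgue_measure `[a, b]%classic f = F b - F a.
Proof.
move=> ab dF cf; have cF x : {for x, continuous F}.
  by apply: differentiable_continuous; apply/derivable1_diffP; have [] := dF x.
rewrite /Rintegral (@continuous_FTC2 _ f F) //.
- exact: continuous_subspaceT.
- split; first by move=> x _; have [] := dF x.
    by apply: cvg_at_right_filter; exact: cF.
  by apply: cvg_at_left_filter; exact: cF.
- by move=> x _; rewrite derive1E; have [_ ->] := dF x.
Qed.

Lemma sin_cos_period (n : nat) : sin (n%:R * (pi *+ 2) : R) = 0 /\ cos (n%:R * (pi *+ 2) : R) = 1.
Proof.
elim: n => [|n [IH1 IH2]]; first by rewrite mul0r sin0 cos0.
by rewrite mulrS mulrDl mul1r addrC sinD2pi cosD2pi.
Qed.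

Lemma sin_cos_int_period (n : int) : sin (n%:~R * (pi *+ 2) : R) = 0 /\ cos (n%:~R * (pi *+ 2) : R) = 1.
Proof.
case: n => n; first exact: sin_cos_period.
have [h1 h2] := sin_cos_period n.+1.
by rewrite NegzE mulrNz mulNr sinN cosN h1 h2 oppr0.
Qed.

Lemma cintegral_character (n : int) :
  cintegral 0 (2 * pi) (fun x : R => cexpi (n%:~R * x)) = if n == 0 then (2 * pi)%:C%C else 0.
Proof.
have pi0 : 0 < 2 * pi :> R by rewrite mulr_gt0 // pi_gt0.
rewrite /cintegral /cexpi /=; have [->|n0] := eqVneq n 0.
  have -> : (fun x : R => cos (0%:~R * x)) = fun=> 1 by apply/funext => x; rewrite mul0r cos0.
  have -> : (fun x : R => sin (0%:~R * x)) = fun=> 0 by apply/funext => x; rewrite mul0r sin0.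
  rewrite !Rintegral_cst // mul0r mul1r /= lebesgue_measure_itv /= lte_fin pi0.
  by rewrite -EFinD /= subr0.
have q0 : n%:~R != 0 :> R by rewrite intr_eq0.
have cm : continuous (fun x : R => n%:~R * x) by move=> x; apply: cvgM => //; exact: cvg_cst.
have [s0 c1] := sin_cos_int_period n.
have dm (x : R) : is_derive x 1 (fun y : R => n%:~R * y) n%:~R.
  have -> : (fun y : R => n%:~R * y) = n%:~R *: (id : R -> R) by [].
  by apply: is_derive_eq; rewrite scaler1.
have dc (x : R) : is_derive x 1 (fun y => n%:~R^-1 * sin (n%:~R * y)) (cos (n%:~R * x)).
  have h := @is_derive1_comp R sin (fun y => n%:~R * y) x _ _ (is_derive_sin _) (dm x).
  apply: (@is_derive_eq _ _ _ _ _ _ _ _ (is_deriveZ n%:~R^-1 h)).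
  by rewrite /GRing.scale /= mulrCA mulVf // mulr1.
have ds (x : R) : is_derive x 1 (fun y => - n%:~R^-1 * cos (n%:~R * y)) (sin (n%:~R * x)).
  have h := @is_derive1_comp R cos (fun y => n%:~R * y) x _ _ (is_derive_cos _) (dm x).
  apply: (@is_derive_eq _ _ _ _ _ _ _ _ (is_deriveZ (- n%:~R^-1) h)).
  by rewrite /GRing.scale /= !mulNr mulrN opprK mulrCA mulVf // mulr1.
have c_c : continuous (fun x : R => cos (n%:~R * x)).
  by move=> x; apply: continuous_comp; [exact: cm | exact: continuous_cos].
have c_s : continuous (fun x : R => sin (n%:~R * x)).
  by move=> x; apply: continuous_comp; [exact: cm | exact: continuous_sin].
have -> := Rintegral_derive pi0 dc c_c; have -> := Rintegral_derive pi0 ds c_s.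
have -> : 2 * pi = pi *+ 2 :> R by rewrite mulr_natl.
by rewrite s0 c1 !mulr0 sin0 cos0 mulr0 !subrr.
Qed.

End Cexpi.

Section Torus.
Variable R : realType.

Lemma dotfreqD d (n n' : 'rV[int]_d) (x : 'rV[R]_d) : dotfreq (n + n') x = dotfreq n x + dotfreq n' x.
Proof. by rewrite /dotfreq -big_split; apply: eq_bigr => i _; rewrite mxE rmorphD mulrDl. Qed.

Lemma dotfreqN d (n : 'rV[int]_d) (x : 'rV[R]_d) : dotfreq (- n) x = - dotfreq n x.
Proof. by rewrite /dotfreq -sumrN; apply: eq_bigr => i _; rewrite mxE rmorphN mulNr. Qed.

Lemma dotfreq0 d (x : 'rV[R]_d) : dotfreq 0 x = 0.
Proof. by rewrite /dotfreq big1 // => i _; rewrite mxE mul0r. Qed.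

Lemma dotfreq_row_mx d (n : 'rV[int]_d.+1) (x : R) (y : 'rV[R]_d) :
  dotfreq n (row_mx (x%:M : 'rV[R]_1) y) =
  (n 0 ord0)%:~R * x + dotfreq (\row_i n 0 (lift ord0 i)) y.
Proof.
rewrite /dotfreq big_ord_recl; congr (_ + _).
  have -> : ord0 = lshift d ord0 :> 'I_(1 + d) by apply/val_inj.
  by rewrite [X in _ * X = _](@row_mxEl R 1 1 d x%:M y 0 ord0) mxE mulr1n.
apply: eq_bigr => i _; have -> : lift ord0 i = rshift 1 i :> 'I_(1 + d) by apply/val_inj.
rewrite [X in _ * X = _](@row_mxEr R 1 1 d x%:M y 0 i) [in RHS]mxE; congr (_%:~R * _).
by congr (n 0 _); apply/val_inj.
Qed.

(** The integral is peeled off one coordinate at a time; each coordinate retains the terms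
    whose frequency vanishes there. *)
Lemma torus_integral_series d (I : choiceType) (a : I -> R[i]) (nu : I -> 'rV[int]_d) (B : R) :
  sum_bounded (fun z => cmod (a z)) B ->
  torus_integral (fun x => csum (fun z => a z * cexpi (dotfreq (nu z) x))) =
  ((2 * pi) ^+ d)%:C%C * csum (fun z => if nu z == 0 then a z else 0).
Proof.
elim: d I a nu B => [|d IH] I a nu B hB /=.
  rewrite expr0 mul1r; congr csum; apply/funext => z.
  by rewrite /dotfreq big_ord0 cexpi0 mulr1 [nu z]thinmx0 eqxx.
have pi0 : 0 <= 2 * pi :> R by rewrite mulr_ge0 // pi_ge0.
pose nu' z : 'rV[int]_d := \row_i nu z 0 (lift ord0 i).
pose c z := if nu' z == 0 then a z else 0.
have cB : sum_bounded (fun z => cmod (c z)) B.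
  move=> S /hB; apply: le_trans; apply: ler_sum => z _; rewrite /c; case: ifP => // _.
  by rewrite (Normc.normc0 R) cmod_ge0.
pose e z (x : R) := cexpi ((nu z 0 ord0)%:~R * x).
have he z : bounded_measurable 0 (2 * pi) (e z) 1.
  apply: bounded_measurable_cexpi; apply: measurable_realfun.measurable_funM => //.
have [bm st] := cintegral_csum pi0 cB he.
have -> : (fun x : R => torus_integral (fun y : 'rV_d => csum (fun z => a z *
     cexpi (dotfreq (nu z) (row_mx x%:M y))))) =
   (fun x => ((2 * pi) ^+ d)%:C%C * csum (fun z => c z * e z x)).
  apply/funext => x; have hx : sum_bounded (fun z => cmod (a z * e z x)) B.
    by move=> S /hB; apply: le_trans; apply: ler_sum => z _; rewrite Normc.normcM cmod_cexpi mulr1.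
  have := IH I (fun z => a z * e z x) nu' B hx.
  have -> : (fun y : 'rV_d => csum (fun z => a z * e z x * cexpi (dotfreq (nu' z) y))) =
      (fun y : 'rV_d => csum (fun z => a z * cexpi (dotfreq (nu z) (row_mx x%:M y)))).
    apply/funext => y; congr csum; apply/funext => z.
    by rewrite dotfreq_row_mx cexpiD mulrA.
  move=> ->; congr (_ * csum _); apply/funext => z; rewrite /c.
  by case: ifP => // _; rewrite mul0r.
have [_ ->] := bmZ pi0 ((2 * pi) ^+ d)%:C%C bm.
rewrite exprSr rmorphM /= -mulrA; congr (_ * _).
apply: sums_to_unique st _.
have aB : sum_bounded (fun z => cmod (if nu z == 0 then a z else 0)) B.
  move=> S /hB; apply: le_trans; apply: ler_sum => z _; case: ifP => // _.
  by rewrite (Normc.normc0 R) cmod_ge0.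
apply: eq_sums_to (sums_toZ (2 * pi)%:C%C (sums_to_csum aB)) => z.
rewrite cintegral_character /c.
have -> : (nu z == 0) = (nu z 0 ord0 == 0) && (nu' z == 0).
  apply/eqP/andP => [h|[/eqP h1 /eqP h2]].
    by split; [rewrite h mxE | apply/eqP/rowP => i; rewrite !mxE h mxE].
  apply/rowP => i; rewrite mxE; case: (unliftP ord0 i) => [j ->|->] //.
  by have := congr1 (fun v : 'rV_d => v 0 j) h2; rewrite !mxE.
by case: (nu z 0 ord0 == 0); case: (nu' z == 0) => /=; rewrite ?mulr0 ?mul0r // mulrC.
Qed.

End Torus.

Lemma cjM (R : rcfType) (b : bool) (x y : R[i]) : cj b (x * y) = cj b x * cj b y.
Proof. by case: b => //; exact: rmorphM. Qed.

Lemma dotfreq_sgz (R : realType) d (b : bool) (n : 'rV[int]_d) (x : 'rV[R]_d) :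
  dotfreq (sgz_if b n) x = sgz_if b (dotfreq n x).
Proof. by case: b => //; exact: dotfreqN. Qed.

Section RegularOperator.
Variables (R : realType) (d k : nat).
Let m := k.*2.+1.
Implicit Types (f : 'I_m -> fcoefs R d) (z : {ffun 'I_m -> 'rV[int]_d}).

Lemma dotfreq_conv z (x : 'rV[R]_d) :
  dotfreq (conv_freq z) x = \sum_(j < m) sgz_if (odd j) (dotfreq (z j) x).
Proof.
rewrite /conv_freq (big_morph (fun n => dotfreq n x) (fun n n' => dotfreqD n n' x) (dotfreq0 x)).
by apply: eq_bigr => j _; exact: dotfreq_sgz.
Qed.

Lemma op_term_bounded (mu : int -> R[i]) (K : R) f (B : 'I_m -> R) n :
  (forall a, cmod (mu a) <= K) -> (forall j, sum_bounded (fun n => cmod (f j n)) (B j)) ->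
  sum_bounded (fun z => cmod (op_term mu n f z)) (K * \prod_j B j).
Proof.
move=> hK hB S uS; have K0 : 0 <= K := le_trans (cmod_ge0 _) (hK 0).
have := sum_bounded_prod (fun j n => cmod_ge0 (f j n)) hB uS => h.
apply: le_trans (ler_wpM2l K0 h); rewrite mulr_sumr; apply: ler_sum => z _.
have p0 : 0 <= \prod_(j < m) cmod (f j (z j)) by apply: prodr_ge0 => j _; exact: cmod_ge0.
rewrite /op_term; case: ifP => _; last by rewrite (Normc.normc0 R) mulr_ge0.
rewrite Normc.normcM cmod_prod; under eq_bigr => j _ do rewrite cmod_cj.
exact: ler_wpM2r.
Qed.

Lemma fourier_coef_nonlin f (B : 'I_m -> R) n :
  (forall j, sum_bounded (fun n => cmod (f j n)) (B j)) ->
  fourier_coef (nonlin (fun j => fourier_series (f j))) n = csum (op_term (fun=> 1) n f).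
Proof.
move=> hB; pose a z : R[i] := \prod_(j < m) cj (odd j) (f j (z j)).
have aB : sum_bounded (fun z => cmod (a z)) (\prod_j B j).
  move=> S uS; have := sum_bounded_prod (fun j n => cmod_ge0 (f j n)) hB uS; apply: le_trans.
  by apply: ler_sum => z _; rewrite cmod_prod; under eq_bigr => j _ do rewrite cmod_cj.
rewrite /fourier_coef.
have -> : (fun x => cexpi (- dotfreq n x) * nonlin (fun j => fourier_series (f j)) x) =
    (fun x => csum (fun z => a z * cexpi (dotfreq (conv_freq z - n) x))).
  apply/funext => x; apply/esym.
  pose g (j : 'I_m) (l : 'rV[int]_d) : R[i] := cj (odd j) (cexpi (dotfreq l x) * f j l).
  have gc j l : cmod (g j l) = cmod (f j l) by rewrite cmod_cj Normc.normcM cmod_cexpi mul1r.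
  have gB j : sum_bounded (fun l => cmod (g j l)) (B j).
    by move=> S uS; under eq_bigr => l _ do rewrite gc; exact: hB.
  have gL j : sums_to (g j) (cj (odd j) (fourier_series (f j) x)).
    have hb : sum_bounded (fun l => cmod (cexpi (dotfreq l x) * f j l)) (B j).
      by move=> S uS; rewrite (eq_bigr (fun l => cmod (g j l))) ?gB // => l _; rewrite gc Normc.normcM cmod_cexpi mul1r.
    rewrite /g /cj; case: (odd j); last exact: sums_to_csum hb.
    exact: sums_to_conj (sums_to_csum hb).
  have -> : nonlin (fun j => fourier_series (f j)) x = \prod_(j < k.*2.+1) cj (odd j) (fourier_series (f j) x).
    rewrite /nonlin [RHS](bigID (fun j : 'I_k.*2.+1 => odd j)) mulrC /=; congr (_ * _).
      by apply: eq_bigr => j oj; rewrite /cj oj.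
    by apply: eq_bigr => j /negbTE oj; rewrite /cj oj.
  apply: (@csum_eq _ _ _ (\prod_j B j)).
    by move=> S /aB; apply: le_trans; apply: ler_sum => z _; rewrite Normc.normcM cmod_cexpi mulr1.
  apply: eq_sums_to (sums_toZ (cexpi (- dotfreq n x)) (sums_to_prod gB gL)) => z.
  rewrite dotfreqD dotfreqN cexpiD mulrA mulrC; congr (_ * _).
  rewrite /g; under eq_bigr => j _ do rewrite cjM cj_cexpi.
  by rewrite big_split /= mulrC; congr (_ * _); rewrite dotfreq_conv cexpi_sum.
rewrite (torus_integral_series _ aB) mulrA -rmorphM mulVf ?rmorph1 ?mul1r.
  by congr csum; apply/funext => z; rewrite subr_eq0 /op_term mul1r.
by rewrite expf_eq0 mulf_eq0 pnatr_eq0 /= gt_eqF ?pi_gt0 // andbF.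
Qed.

Lemma phase_factor (w : R -> R) f tau n z :
  cexpi (- (sqfreq R n * - w tau)) * op_term (fun=> 1) n (fun j => Uop w tau (f j)) z =
  op_term (fun=> 1) n f z * cexpi ((omega n z)%:~R * w tau).
Proof.
rewrite /op_term; case: ifP => _; last by rewrite mulr0 mul0r.
rewrite !mul1r /Uop; under eq_bigr => j _ do rewrite cjM cj_cexpi.
rewrite big_split /= mulrA mulrC; congr (_ * _).
rewrite -cexpi_sum -cexpiD /omega; congr cexpi.
rewrite sqfreqE rmorphB mulrBl mulrN opprK; congr (_ + _).
rewrite rmorph_sum mulr_suml -sumrN; apply: eq_bigr => j _.
by rewrite sqfreqE; case: (odd j); rewrite /= ?rmorphN; ring.
Qed.

(** The product of the Fourier series of the inputs is an absolutely convergent sum over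
    tuples of frequencies, in which the phases combine to [cexpi (omega n z * w tau)];
    integration in [tau] turns each phase into [Phi w t (omega n z)]. *)
Lemma Xreg_multop (T0 : R) (w : R -> R) (t s1 : R) f :
  (0 < d)%N -> {within `[0, T0], continuous w} -> 0 <= t <= T0 ->
  d%:R / 2 < s1 -> (forall j, in_Hs s1 (f j)) ->
  Xreg w t f = multop (fun a => - 'i%C * Phi w t a%:~R) f.
Proof.
move=> d0 cw /andP[t0 tT] hs1 hf; apply/funext => n.
have /choice[B hB] : forall j, exists B, sum_bounded (fun l => cmod (f j l)) B by move=> j; exact: Hs_l1 (hf j).
have UB tau j : sum_bounded (fun l => cmod (Uop w tau (f j) l)) (B j).
  by move=> S uS; under eq_bigr => l _ do rewrite /Uop Normc.normcM cmod_cexpi mul1r; exact: hB.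
have one_le : forall a : int, cmod (1 : R[i]) <= 1 by rewrite (Normc.normc1 R).
have cB := @op_term_bounded _ 1 f B n one_le hB.
have mw : measurable_fun (`[0, t]%classic : set R) w.
  apply: measurable_realfun.subspace_continuous_measurable_fun => //.
  apply: continuous_subspaceW cw => x /=; rewrite !in_itv /= => /andP[-> h]; exact: le_trans h tT.
have he z : bounded_measurable 0 t (fun tau => cexpi ((omega n z)%:~R * w tau)) 1.
  apply: bounded_measurable_cexpi; apply: measurable_realfun.measurable_funM => //; exact: measurable_cst.
have [_ st] := cintegral_csum t0 cB he.
rewrite /Xreg /multop.
have -> : (fun tau => Uop (fun r => - w r) tau
      (fourier_coef (nonlin (fun j => fourier_series (Uop w tau (f j))))) n) =
   (fun tau => csum (fun z => op_term (fun=> 1) n f z * cexpi ((omega n z)%:~R * w tau))).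
  apply/funext => tau; rewrite /Uop; apply/esym; apply: (@csum_eq _ _ _ (1 * \prod_j B j)).
    by move=> S /cB; apply: le_trans; apply: ler_sum => z _; rewrite Normc.normcM cmod_cexpi mulr1.
  rewrite (fourier_coef_nonlin _ (UB tau)).
  have := sums_to_csum (@op_term_bounded _ 1 (fun j => Uop w tau (f j)) B n one_le (UB tau)).
  by move=> /(sums_toZ (cexpi (- (sqfreq R n * - w tau)))); apply: eq_sums_to => z; exact: phase_factor.
apply/esym; have tB : sum_bounded (fun z => cmod (op_term (fun a : int => - 'i%C * Phi w t a%:~R) n f z)) ((2 * 1 * (t - 0)) * \prod_j B j).
  apply: op_term_bounded => // a; rewrite Normc.normcM cmodN.
  have -> : cmod ('i%C : R[i]) = 1 by rewrite /= expr0n expr1n add0r sqrtr1.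
  rewrite mul1r; apply: cintegral_le => //; apply: bounded_measurable_cexpi.
  apply: measurable_realfun.measurable_funM => //; exact: measurable_cst.
apply: csum_eq tB _; apply: eq_sums_to (sums_toZ _ st) => z.
rewrite /op_term; case: ifP => _; last by rewrite mul0r mulr0.
by rewrite mul1r mulrCA mulrC.
Qed.

End RegularOperator.

(** * The extension to low regularity *)

Section Multilinear.
Variables (R : realType) (d m : nat) (s : R).
Implicit Types (f : 'I_m -> fcoefs R d) (mu nu : int -> R[i]) (z : {ffun 'I_m -> 'rV[int]_d}).

Lemma multop_set_slot mu n f (j : 'I_m) (phi psi : fcoefs R d) (c : R[i]) B C :
  sum_bounded (fun z => cmod (op_term mu n (set_slot f j phi) z)) B ->
  sum_bounded (fun z => cmod (op_term mu n (set_slot f j psi) z)) C ->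
  multop mu (set_slot f j (fun l => c * phi l + psi l)) n =
    cj (odd j) c * multop mu (set_slot f j phi) n + multop mu (set_slot f j psi) n.
Proof.
move=> hB hC.
have E z : cj (odd j) c * op_term mu n (set_slot f j phi) z + op_term mu n (set_slot f j psi) z =
    op_term mu n (set_slot f j (fun l => c * phi l + psi l)) z.
  rewrite /op_term; case: ifP => _; last by rewrite mulr0 addr0.
  rewrite !(bigD1 j (P := predT)) //= /set_slot eqxx.
  have e g : \prod_(i < m | i != j) cj (odd i) ((if i == j then g else f i) (z i)) =
      \prod_(i < m | i != j) cj (odd i) (f i (z i)) by apply: eq_bigr => i /negbTE ->.
  rewrite !e; have -> : cj (odd j) (c * phi (z j) + psi (z j)) =
      cj (odd j) c * cj (odd j) (phi (z j)) + cj (odd j) (psi (z j)).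
    by case: (odd j) => //=; rewrite rmorphD rmorphM.
  by ring.
apply: (@csum_eq _ _ _ (cmod (cj (odd j) c) * B + C)).
  move=> S uS; apply: le_trans (lerD (ler_wpM2l (cmod_ge0 _) (hB S uS)) (hC S uS)).
  rewrite mulr_sumr -big_split; apply: ler_sum => z _; rewrite -E -Normc.normcM; exact: cmodD.
exact: eq_sums_to E (sums_toD (sums_toZ _ (sums_to_csum hB)) (sums_to_csum hC)).
Qed.

Lemma multop_sub mu nu n f B C :
  sum_bounded (fun z => cmod (op_term mu n f z)) B ->
  sum_bounded (fun z => cmod (op_term nu n f z)) C ->
  multop (fun a => mu a - nu a) f n = multop mu f n - multop nu f n.
Proof.
move=> hB hC.
have E z : op_term mu n f z + -1 * op_term nu n f z = op_term (fun a => mu a - nu a) n f z.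
  by rewrite /op_term; case: ifP => _; [rewrite mulrBl mulN1r | rewrite mulr0 addr0].
rewrite -[- multop nu f n]mulN1r; apply: (@csum_eq _ _ _ (B + C)).
  move=> S uS; apply: le_trans (lerD (hB S uS) (hC S uS)).
  by rewrite -big_split; apply: ler_sum => z _; rewrite -E mulN1r; exact: cmodB.
exact: eq_sums_to E (sums_toD (sums_to_csum hB) (sums_toZ _ (sums_to_csum hC))).
Qed.

Lemma in_Hs_set_slot f (j : 'I_m) phi : (forall i, in_Hs s (f i)) -> in_Hs s phi ->
  forall i, in_Hs s (set_slot f j phi i).
Proof. by move=> hf hp i; rewrite /set_slot; case: ifP. Qed.

(** The change is the value of the operator at the difference of the two arguments. *)
Lemma multilinear_slot_approx (B : ('I_m -> fcoefs R d) -> fcoefs R d) f (j : 'I_m) n e :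
  Hs_multilinear s B -> Hs_bounded s B -> (forall i, in_Hs s (f i)) -> 0 < e ->
  exists2 eta, 0 < eta & forall phi, in_Hs s phi -> in_Hs s (f j - phi) -> Hs_norm s (f j - phi) <= eta ->
    cmod (B f n - B (set_slot f j phi) n) <= e.
Proof.
move=> lin [C hC] hf e0.
pose P := \prod_(i < m | i != j) Hs_norm s (f i).
have P0 : 0 <= P by apply: prodr_ge0 => i _; exact: Hs_norm_ge0.
have w0 : 0 < japanese R n `^ s by rewrite powR_gt0 ?japanese_gt0.
pose K := `|C| * P + 1; have K0 : 0 < K by rewrite ltr_wpDl // mulr_ge0.
exists (e * japanese R n `^ s / K); first by rewrite divr_gt0 // mulr_gt0.
move=> phi hphi hdiff hle.
have slotf : set_slot f j (f j) = f by apply/funext => i; rewrite /set_slot; case: eqP => // ->.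
have L := lin f j phi (f j) (-1) hf hphi (hf j) n.
have sub : (fun l => -1 * phi l + f j l) = f j - phi.
  by apply/funext => l; rewrite fct_subE mulN1r addrC.
rewrite sub slotf in L.
have L' : B f n - B (set_slot f j phi) n = B (set_slot f j (f j - phi)) n.
  by rewrite L; case: (odd j); rewrite ?rmorphN ?rmorph1 mulN1r addrC.
have hs := in_Hs_set_slot j hf hdiff.
have [h1 h2] := hC _ hs.
rewrite L' -(ler_pM2l w0) mulrC; rewrite mulrC.
apply: le_trans (Hs_coef n h1) _; apply: le_trans h2 _.
rewrite (bigD1 j) //= {1}/set_slot eqxx.
have -> : \prod_(i < m | i != j) Hs_norm s (set_slot f j (f j - phi) i) = P.
  by apply: eq_bigr => i /negbTE ij; rewrite /set_slot ij.
have N0 := Hs_norm_ge0 s (f j - phi).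
apply: (@le_trans _ _ (K * Hs_norm s (f j - phi))).
  rewrite mulrCA mulrC ler_wpM2r // /K; have := ler_wpM2r P0 (ler_norm C); lra.
by move: hle; rewrite ler_pdivlMr // mulrC (mulrC e).
Qed.

(** This identifies the extension, known by its properties only, with the explicit
    multiplier. The slots are exchanged one at a time for truncations, which are as regular
    as needed. *)
Lemma multilinear_ext (s1 : R) (B B' : ('I_m -> fcoefs R d) -> fcoefs R d) :
  s <= s1 -> Hs_multilinear s B -> Hs_bounded s B -> Hs_multilinear s B' -> Hs_bounded s B' ->
  (forall f, (forall j, in_Hs s1 (f j)) -> B f = B' f) ->
  forall f, (forall j, in_Hs s (f j)) -> B f = B' f.
Proof.
move=> ss1 l1 b1 l2 b2 agree.
suff H i f : (forall j, in_Hs s (f j)) -> (forall j : 'I_m, (i <= j)%N -> in_Hs s1 (f j)) -> B f = B' f.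
  by move=> f hf; apply: (H m) => // j; rewrite leqNgt ltn_ord.
elim: i f => [|i IH] f hf hi; first by apply: agree => j; exact: hi.
have [im|im] := ltnP i m; last first.
  by apply: IH => // j ij; have := ltn_ord j; rewrite ltnNge (leq_trans im ij).
pose j := Ordinal im; apply/funext => n; apply: cmod_le_eq => e e0.
have e2 : 0 < e / 2 by rewrite divr_gt0.
have [eta1 p1 h1] := multilinear_slot_approx j n l1 b1 hf e2.
have [eta2 p2 h2] := multilinear_slot_approx j n l2 b2 hf e2.
have mp : 0 < Num.min eta1 eta2 by rewrite lt_min p1.
have [F [F1]] := Hs_truncate_approx (hf j) mp; rewrite le_min => /andP[F2 F3].
have tr x := @Hs_finite_support R d x F (f j).
have E : B (set_slot f j (truncate F (f j))) = B' (set_slot f j (truncate F (f j))).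
  apply: IH => [l|l il]; first exact: in_Hs_set_slot.
  rewrite /set_slot; case: eqP => [_|/eqP lj]; first exact: tr.
  by apply: hi; rewrite ltn_neqAle il andbT; apply: contra lj => /eqP il'; apply/eqP/val_inj.
have := h1 _ (tr s) F1 F2; have := h2 _ (tr s) F1 F3; rewrite E.
set x := B f n; set y := B' f n; set c := B' _ n.
have := cmodD (x - c) (c - y); rewrite addrA subrK (cmod_distC c y); lra.
Qed.

End Multilinear.

Section Irregularity.
Variables (R : realType) (rho gamma T0 : R) (w : R -> R).
Hypotheses (T00 : 0 < T0) (irr : irregular rho gamma T0 w).

Lemma Phi0 a : Phi w 0 a = 0.
Proof. by rewrite /Phi /cintegral set_itv1 !Rintegral_set1. Qed.

Lemma irr_norm_ge0 : 0 <= irr_norm rho gamma T0 w.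
Proof.
apply: fine_ge0; apply: le_trans (ereal_sup_ubound _); last first.
  by exists 0, 0, T0; split.
by rewrite lee_fin !mulr_ge0 ?invr_ge0 ?powR_ge0 ?cmod_ge0.
Qed.

Lemma irregular_le s t a : 0 <= s -> s <= t -> t <= T0 ->
  cmod (Phi w t a - Phi w s a) <= irr_norm rho gamma T0 w * (t - s) `^ gamma * (1 + `|a|) `^ (- rho).
Proof.
move=> s0; rewrite le_eqVlt => /orP[/eqP <- _|st tT].
  by rewrite subrr (Normc.normc0 R) !mulr_ge0 ?powR_ge0 ?irr_norm_ge0.
have a1 : 0 < 1 + `|a| by rewrite ltr_pwDl.
have q0 : 0 < (t - s) `^ gamma by rewrite powR_gt0 // subr_gt0.
have fin : irr_enorm rho gamma T0 w \is a fin_num.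
  rewrite ge0_fin_numE //; apply: le_trans (ereal_sup_ubound _); last first.
    by exists 0, 0, T0; split.
  by rewrite lee_fin !mulr_ge0 ?invr_ge0 ?powR_ge0 ?cmod_ge0.
have : (((1 + `|a|) `^ rho * (cmod (Phi w t a - Phi w s a) / `|t - s| `^ gamma))%:E <=
    irr_enorm rho gamma T0 w)%E by apply: ereal_sup_ubound; exists a, s, t; split.
rewrite -(fineK fin) lee_fin -/(irr_norm rho gamma T0 w).
have -> : `|t - s| = t - s by rewrite ger0_norm // subr_ge0 ltW.
by rewrite powRN ler_pdivlMr ?powR_gt0 // mulrA ler_pdivrMr // mulrC.
Qed.

End Irregularity.

(** The multiplier satisfies the defining properties of [Xext], hence coincides with it on
    [H^s]; the difference of two times is again a multiplier, whose symbol the irregularity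
    of the path bounds. The constant is chosen before the path because the existence time
    may depend on the path through its irregularity norm only. *)
Lemma Xext_hoelder (R : realType) (d k : nat) (rho s : R) :
  (0 < d)%N -> (0 < k)%N -> (d, k) <> (1%N, 1%N) -> 0 < rho -> rho <= 1 -> d%:R / 2 - rho / k%:R < s ->
  exists2 C : R, 0 <= C & forall (gamma T0 : R) (w : R -> R),
    0 < T0 -> {within `[0, T0], continuous w} -> irregular rho gamma T0 w ->
    (forall t, 0 <= t <= T0 -> Hs_multilinear s (@Xext R d k s w t)) /\
    forall t t' (f : 'I_(k.*2.+1) -> fcoefs R d), 0 <= t -> t <= t' -> t' <= T0 ->
      (forall j, in_Hs s (f j)) ->
      [/\ in_Hs s (Xext s w t f), in_Hs s (Xext s w t' f) &
        Hs_norm s (Xext s w t' f - Xext s w t f) <=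
          C * irr_norm rho gamma T0 w * (t' - t) `^ gamma * \prod_j Hs_norm s (f j)].
Proof.
move=> d0 k0 dk rho0 rho1 hs; have [C C0 hC] := multop_bound d0 k0 dk rho0 rho1 hs.
exists C => // gamma T0 w T00 cw irr; set M := irr_norm rho gamma T0 w.
have M0 : 0 <= M by exact: irr_norm_ge0.
pose mu (t : R) (a : int) : R[i] := - 'i%C * Phi w t a%:~R.
have i1 : cmod (- 'i%C : R[i]) = 1 by rewrite cmodN /= expr0n expr1n add0r sqrtr1.
have mu_diff t t' a : 0 <= t -> t <= t' -> t' <= T0 ->
    cmod (mu t' a - mu t a) <= M * (t' - t) `^ gamma * (1 + `|a|)%:~R `^ (- rho).
  move=> t0 tt' t'T; rewrite /mu -mulrBr Normc.normcM i1 mul1r intrD intr_norm.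
  exact: irregular_le.
have mu_le t a : 0 <= t -> t <= T0 -> cmod (mu t a) <= M * t `^ gamma * (1 + `|a|)%:~R `^ (- rho).
  move=> t0 tT; have := mu_diff 0 t a (lexx _) t0 tT.
  by rewrite {2}/mu Phi0 mulr0 !subr0.
have K0 t : 0 <= M * t `^ gamma by rewrite mulr_ge0 ?powR_ge0.
have multopP t : 0 <= t <= T0 -> @is_Xext R d k s w t (multop (mu t)).
  move=> /andP[t0 tT]; have hmu a := mu_le t a t0 tT; split.
  - move=> f j phi psi c hf hphi hpsi n.
    have [/(_ n)[B hB] _ _] := hC _ _ _ (K0 t) hmu (in_Hs_set_slot j hf hphi).
    have [/(_ n)[B' hB'] _ _] := hC _ _ _ (K0 t) hmu (in_Hs_set_slot j hf hpsi).
    by rewrite (multop_set_slot c hB hB') /cj; case: (odd j).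
  - exists (C * (M * t `^ gamma)) => f hf.
    by have [_ h1 h2] := hC _ _ _ (K0 t) hmu hf.
  - move=> s1 f hs1 ss1 hf; apply/esym; apply: (Xreg_multop d0 cw _ hs1 hf); exact/andP.
have XP t : 0 <= t <= T0 -> @is_Xext R d k s w t (@Xext R d k s w t).
  by move=> ht; apply: (@xgetPex _ (fun _ _ => 0) [set B | @is_Xext R d k s w t B]); exists (multop (mu t)); exact: multopP.
have XE t (f : 'I_(k.*2.+1) -> fcoefs R d) : 0 <= t <= T0 -> (forall j, in_Hs s (f j)) -> Xext s w t f = multop (mu t) f.
  move=> ht hf; have [l1 b1 r1] := XP t ht; have [l2 b2 r2] := multopP t ht.
  pose s1 := Num.max s (d%:R / 2 + 1).
  have ss1 : s <= s1 by rewrite le_max lexx.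
  have ds1 : d%:R / 2 < s1 by rewrite lt_max ltrDl ltr01 orbT.
  apply: (multilinear_ext ss1 l1 b1 l2 b2 _ hf) => g hg.
  by rewrite (r1 s1 g ds1 ss1 hg) (r2 s1 g ds1 ss1 hg).
split=> [t /XP[] //|t t' f t0 tt' t'T hf].
have ht : 0 <= t <= T0 by rewrite t0 (le_trans tt' t'T).
have ht' : 0 <= t' <= T0 by rewrite (le_trans t0 tt') t'T.
rewrite (XE t f ht hf) (XE t' f ht' hf).
have [/andP[_ tT] /andP[t'0 _]] := (ht, ht').
have [b1 h1 _] := hC _ _ _ (K0 t) (fun a => mu_le t a t0 tT) hf.
have [b2 h2 _] := hC _ _ _ (K0 t') (fun a => mu_le t' a t'0 t'T) hf.
split=> //; have [_ _] := hC _ _ _ (K0 (t' - t)) (fun a => mu_diff t t' a t0 tt' t'T) hf.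
have -> : multop (fun a => mu t' a - mu t a) f = multop (mu t') f - multop (mu t) f.
  apply/funext => n; have [[B hB] [B' hB']] := (b1 n, b2 n).
  by rewrite (multop_sub hB' hB) fct_subE.
by rewrite !mulrA.
Qed.

(** * The sewing lemma *)

(** Completeness and the triangle inequality are required on [P] alone: [Hs_norm] is meaningful on
    [in_Hs] only, while the coefficient families form the ambient group. *)
Record complete_norm (R : realType) (V : zmodType) (P : V -> Prop) (N : V -> R) : Prop := CompleteNorm {
  cn0 : P 0;
  cnB : forall x y, P x -> P y -> P (x - y);
  cn_ge0 : forall x, 0 <= N x;
  cn_triangle : forall x y, P x -> P y -> N (x + y) <= N x + N y;
  cn_opp : forall x, P x -> N (- x) = N x;
  cn_norm0 : N 0 = 0;
  cn_sep : forall x, P x -> N x <= 0 -> x = 0;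
  cn_complete : forall u : nat -> V, (forall i, P (u i)) ->
    (forall e, 0 < e -> exists n, forall i j, (n <= i)%N -> (n <= j)%N -> N (u i - u j) <= e) ->
    exists2 l, P l & forall e, 0 < e -> exists n, forall i, (n <= i)%N -> N (u i - l) <= e }.

Section NormedGroup.
Variables (R : realType) (V : zmodType) (P : V -> Prop) (N : V -> R).
Hypothesis cn : complete_norm P N.
Implicit Types x y z : V.

Lemma cnN x : P x -> P (- x).
Proof. by move=> hx; rewrite -sub0r; apply: (cnB cn) => //; exact: (cn0 cn). Qed.

Lemma cnD x y : P x -> P y -> P (x + y).
Proof. by move=> hx hy; rewrite -[y]opprK; apply: (cnB cn) => //; exact: cnN. Qed.

Lemma cn_normB x y : P x -> P y -> N (x - y) <= N x + N y.
Proof. by move=> hx hy; rewrite -(cn_opp cn hy); apply: (cn_triangle cn) => //; exact: cnN. Qed.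

Lemma cn_distC x y : P x -> P y -> N (x - y) = N (y - x).
Proof. by move=> hx hy; rewrite -(cn_opp cn) ?opprB //; exact: (cnB cn). Qed.

Lemma cn_dist x y z : P x -> P y -> P z -> N (x - z) <= N (x - y) + N (y - z).
Proof.
move=> hx hy hz; have -> : x - z = (x - y) + (y - z) by rewrite addrA subrK.
by apply: (cn_triangle cn); apply: (cnB cn).
Qed.

Lemma cn_eq x y : P x -> P y -> (forall e, 0 < e -> N (x - y) <= e) -> x = y.
Proof.
move=> hx hy h; apply/eqP; rewrite -subr_eq0; apply/eqP; apply: (cn_sep cn); first exact: (cnB cn).
by apply/ler_addgt0Pr => e e0; rewrite add0r; exact: h.
Qed.

Lemma cn_lim_le (u : nat -> V) l y b : (forall i, P (u i)) -> P l -> P y ->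
  (forall e, 0 < e -> exists n, forall i, (n <= i)%N -> N (u i - l) <= e) ->
  (exists n, forall i, (n <= i)%N -> N (u i - y) <= b) -> N (l - y) <= b.
Proof.
move=> hu hl hy lim [n hb]; apply/ler_addgt0Pr => e /lim[n' h].
have := h _ (leq_maxr n n'); have := hb _ (leq_maxl n n').
have := cn_dist hl (hu (maxn n n')) hy; rewrite (cn_distC hl (hu _)); lra.
Qed.

End NormedGroup.

Section PartitionSum.
Variables (R : realType) (V : zmodType).
Implicit Types (Xi : R -> R -> V) (a b : R) (r : seq R).

Fixpoint psum Xi a r : V := if r is x :: r' then Xi a x + psum Xi x r' else 0.

Lemma psum_cat Xi a r r' : psum Xi a (r ++ r') = psum Xi a r + psum Xi (last a r) r'.
Proof. by elim: r a => [|x r IH] a /=; rewrite ?add0r // IH addrA. Qed.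

Lemma psumB Xi Xi' a r : psum (fun x y => Xi x y - Xi' x y) a r = psum Xi a r - psum Xi' a r.
Proof. by elim: r a => [|x r IH] a /=; rewrite ?subrr // IH opprD addrACA. Qed.

Definition small_steps (e : R) a r := path (fun x y => y - x <= e) a r.

Lemma path_lt_le_last a r : path <%R a r -> a <= last a r.
Proof.
elim: r a => [|x r IH] a //= /andP[ax /IH]; exact: le_trans (ltW ax).
Qed.

Lemma path_lt_bounds a r x : path <%R a r -> x \in r -> a < x <= last a r.
Proof.
elim: r a => [|y r IH] a //= /andP[ay pr]; rewrite in_cons => /orP[/eqP ->|xr].
  by rewrite ay path_lt_le_last.
by have /andP[h ->] := IH y pr xr; rewrite (lt_trans ay h).
Qed.

Lemma common_refinement a b r1 r2 : itv_partition a b r1 -> itv_partition a b r2 ->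
  exists r, [/\ itv_partition a b r, {subset r1 <= r} & {subset r2 <= r}].
Proof.
move=> [p1 /eqP l1] [p2 /eqP l2]; pose r := sort <=%O (undup (r1 ++ r2)).
have mr x : (x \in r) = (x \in r1) || (x \in r2) by rewrite mem_sort mem_undup mem_cat.
exists r; split; [|by move=> x h; rewrite mr h|by move=> x h; rewrite mr h orbT].
have bd x : x \in r -> a < x <= b.
  by rewrite mr => /orP[] h; [rewrite -l1 | rewrite -l2]; exact: path_lt_bounds.
have sr : path <%R a r.
  have st : sorted <%O r by rewrite sort_lt_sorted undup_uniq.
  case E : r st => [|x r'] //= ->; rewrite andbT.
  by have /andP[] := bd x ltac:(by rewrite E mem_head).
split=> //; rewrite eq_le; apply/andP; split.
  case E : r => [|x r'] /=; last by have /andP[] := bd (last x r') ltac:(by rewrite E mem_last).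
  by rewrite -l1; exact: path_lt_le_last.
have [r1n|r1n] := eqVneq r1 [::]; first by rewrite -l1 r1n /=; exact: path_lt_le_last.
have br : b \in r by rewrite mr -l1; case: (r1) r1n => // y r1' _; rewrite /= mem_last.
by have /andP[] := path_lt_bounds sr br.
Qed.

Lemma fine_partition a b e : a <= b -> 0 < e -> exists r, itv_partition a b r /\ small_steps e a r.
Proof.
move=> ab e0; move: (ab); rewrite le_eqVlt => /orP[/eqP <-|ltab].
  by exists [::]; split => //; split.
have [n hn] : exists n : nat, b - a <= n%:R * e.
  exists (Num.truncn ((b - a) / e)).+1; rewrite -ler_pdivrMr // ltW //.
  exact: truncnS_gt.
elim: n a ab ltab hn => [|n IH] a ab ltab hn.
  by move: hn ltab; rewrite mul0r subr_le0 leNgt => /negbTE ->.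
have [be|be] := leP (b - a) e.
  by exists [:: b]; rewrite /itv_partition /small_steps /= ltab be; split => //; split.
have lt' : a + e < b by rewrite addrC -ltrBrDr.
have [|r [[pr lr] sr]] := IH (a + e) (ltW lt') lt'; first by move: hn; rewrite mulrS mulrDl mul1r; lra.
exists (a + e :: r); rewrite /itv_partition /small_steps /= ltrDl e0 pr lr addrC addKr lexx; split => //; split=> //.
Qed.

End PartitionSum.

Section Sewing.
Variables (R : realType) (V : zmodType) (P : V -> Prop) (N : V -> R).
Hypothesis cn : complete_norm P N.
Variable theta : R.
Hypothesis theta1 : 1 < theta.
Implicit Types (Xi : R -> R -> V) (a b : R) (r : seq R).

(** This is [2 * sum_n (2 `^ (1 - theta)) ^+ n]: halving an interval [n] times multiplies the
    number of defects by [2 ^+ n] and each defect by [2 `^ (- theta)] to the [n]. *)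
Definition sewing_const : R := 2 / (1 - 2 `^ (1 - theta)).
Let c := sewing_const.

Let q1 : 2 `^ (1 - theta) < 1 :> R.
Proof.
have -> : 2 `^ (1 - theta) = 2^-1 `^ (theta - 1) :> R.
  by rewrite -powR_inv1 // -powRrM mulN1r opprB.
have := @gt0_ltr_powR R (theta - 1) ltac:(by rewrite subr_gt0) 2^-1 1.
by rewrite powR1; apply; rewrite ?nnegrE ?invr_ge0 // invf_lt1 // ltr1n.
Qed.

Let c_fix : c * 2 `^ (1 - theta) + 2 = c.
Proof. by rewrite /c /sewing_const; have := q1; set q := 2 `^ _ => h; field; rewrite subr_eq0 gt_eqF. Qed.

Lemma sewing_const_ge0 : 0 <= c.
Proof. by rewrite divr_ge0 // subr_ge0 ltW. Qed.

Definition almost_additive Xi a b K : Prop :=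
  (forall x, a <= x <= b -> Xi x x = 0) /\
  forall x y z, a <= x -> x <= y -> y <= z -> z <= b ->
    [/\ P (Xi x y), P (Xi y z), P (Xi x z) &
      N (Xi x z - Xi x y - Xi y z) <= K * (z - x) `^ theta].

Lemma almost_additiveW Xi a b a' b' K : a <= a' -> b' <= b ->
  almost_additive Xi a b K -> almost_additive Xi a' b' K.
Proof.
move=> aa bb [h0 h]; split=> [x /andP[ax xb]|x y z ax xy yz zb].
  by apply: h0; rewrite (le_trans aa ax) (le_trans xb bb).
by apply: h => //; [exact: le_trans aa ax | exact: le_trans zb bb].
Qed.

Lemma psum_in Xi a b K r : almost_additive Xi a b K -> path <%R a r -> last a r <= b -> P (psum Xi a r).
Proof.
move=> hX; have [_ h] := hX; have aa := lexx a.
suff H a' : a <= a' -> path <%R a' r -> last a' r <= b -> P (psum Xi a' r) by exact: H.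
elim: r a' => [|x r IH] a' aa' /=; first by move=> _ _; exact: (cn0 cn).
move=> /andP[a'x pr] lb; apply: (cnD cn).
  have xb : x <= b := le_trans (path_lt_le_last pr) lb.
  by have [] := h a' a' x aa' (lexx _) (ltW a'x) xb.
exact: IH (le_trans aa' (ltW a'x)) pr lb.
Qed.

Lemma split_at a r m : a <= m -> m <= last a r -> r != [::] ->
  exists r1 x r2, [/\ r = r1 ++ x :: r2, last a r1 <= m & m <= x].
Proof.
elim: r a => // y r IH a am ml _; have [my|ym] := leP m y; first by exists [::], y, r.
have [E|rn] := eqVneq r [::]; first by move: ml ym; rewrite E /= leNgt => /negbTE ->.
by have [r1 [x [r2 [-> h1 h2]]]] := IH y (ltW ym) ml rn; exists (y :: r1), x, r2.
Qed.

(** Splitting the partition at the midpoint halves the interval, and [theta > 1] makes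
    the errors of the successive halvings summable whatever the partition. *)
Lemma sewing_maximal Xi a b K r : 0 <= K -> almost_additive Xi a b K ->
  path <%R a r -> last a r <= b ->
  N (psum Xi a r - Xi a (last a r)) <= c * K * (last a r - a) `^ theta.
Proof.
move=> K0; have [n] := ubnP (size r); elim: n a r => // n IH a r /ltnSE rn hX pr lb.
have [h0 h] := hX.
have ab := path_lt_le_last pr; have ab' := le_trans ab lb.
have [E|rnil] := eqVneq r [::].
  rewrite E /= h0 ?lexx // subrr (cn_norm0 cn).
  apply: mulr_ge0; last exact: powR_ge0.
  by apply: mulr_ge0 => //; exact: sewing_const_ge0.
set L := last a r - a; pose m := a + L / 2.
have am : a <= m by rewrite /m /L; lra.
have ml : m <= last a r by rewrite /m /L; lra.
have [r1 [x [r2 [E l1 mx]]]] := split_at am ml rnil.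
set y := last a r1 in l1.
have lE : last x r2 = last a r by rewrite E last_cat.
have [p1 p2 yx] : [/\ path <%R a r1, path <%R x r2 & y < x].
  by move: pr; rewrite E cat_path /= => /and3P[].
have ay := path_lt_le_last p1; have xl := path_lt_le_last p2; rewrite -/y in ay; rewrite lE in xl.
have ax := le_trans ay (ltW yx); have yl := le_trans (ltW yx) xl.
have s1 : (size r1 < n)%N by apply: leq_trans rn; rewrite E size_cat /= addnS ltnS leq_addr.
have s2 : (size r2 < n)%N by apply: leq_trans rn; rewrite E size_cat /= addnS ltnS leq_addl.
have i1 := IH a r1 s1 hX p1 (le_trans yl lb).
have i2 := IH x r2 s2 (almost_additiveW ax (lexx b) hX) p2 ltac:(by rewrite lE).
rewrite -/y in i1; rewrite lE in i2.
have [Pay Pyx Pax d1] := h a y x (lexx a) ay (ltW yx) (le_trans xl lb).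
have [_ Pxl Pal d2] := h a x (last a r) (lexx a) ax xl lb.
have Q1 := psum_in hX p1 (le_trans yl lb).
have Q2 := psum_in (almost_additiveW ax (lexx b) hX) p2 ltac:(by rewrite lE).
have -> : psum Xi a r - Xi a (last a r) =
   (psum Xi a r1 - Xi a y) + (psum Xi x r2 - Xi x (last a r)) -
   (Xi a x - Xi a y - Xi y x) - (Xi a (last a r) - Xi a x - Xi x (last a r)).
  rewrite {1}E psum_cat -/y /= !opprD !opprK !addrA.
  by rewrite [RHS](AC 10 (1*7*3*8*(2*6)*(4*10)*(5*9))) /= !addNr !addr0.
have hB := cnB cn.
have := cn_normB cn (x := (psum Xi a r1 - Xi a y) + (psum Xi x r2 - Xi x (last a r)) - (Xi a x - Xi a y - Xi y x))
   (y := Xi a (last a r) - Xi a x - Xi x (last a r)).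
have := cn_normB cn (x := (psum Xi a r1 - Xi a y) + (psum Xi x r2 - Xi x (last a r))) (y := Xi a x - Xi a y - Xi y x).
have := cn_triangle cn (x := psum Xi a r1 - Xi a y) (y := psum Xi x r2 - Xi x (last a r)).
move=> /(_ (hB _ _ Q1 Pay) (hB _ _ Q2 Pxl)) t1.
move=> /(_ (cnD cn (hB _ _ Q1 Pay) (hB _ _ Q2 Pxl)) (hB _ _ (hB _ _ Pax Pay) Pyx)) t2.
move=> /(_ (hB _ _ (cnD cn (hB _ _ Q1 Pay) (hB _ _ Q2 Pxl)) (hB _ _ (hB _ _ Pax Pay) Pyx))
  (hB _ _ (hB _ _ Pal Pax) Pxl)) t3.
have L0 : 0 <= L by rewrite subr_ge0.
have th0 : 0 <= theta by rewrite ltW // (lt_trans _ theta1).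
have cK : 0 <= c * K by rewrite mulr_ge0 //; exact: sewing_const_ge0.
have mono u v : 0 <= u -> u <= v -> u `^ theta <= v `^ theta.
  by move=> u0 uv; apply: ge0_ler_powR; rewrite ?nnegrE // (le_trans u0 uv).
have e1 : (y - a) `^ theta <= (L / 2) `^ theta by apply: mono; rewrite ?subr_ge0 //; move: l1; rewrite /m; lra.
have e2 : (last a r - x) `^ theta <= (L / 2) `^ theta by apply: mono; rewrite ?subr_ge0 //; move: mx; rewrite /m /L; lra.
have e3 : (x - a) `^ theta <= L `^ theta by apply: mono; rewrite ?subr_ge0 // /L; lra.
have e4 : (L / 2) `^ theta *+ 2 = 2 `^ (1 - theta) * L `^ theta.
  have -> : 2 `^ (1 - theta) = 2 * (2^-1) `^ theta :> R.
    rewrite powRD ?pnatr_eq0 ?implybT // powRr1 //.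
    by rewrite -powR_inv1 // -powRrM mulN1r.
  by rewrite powRM ?invr_ge0 // mulr2n; ring.
have := ler_wpM2l cK e1; have := ler_wpM2l cK e2; have := ler_wpM2l K0 e3.
have E5 : c * K * L `^ theta = c * K * ((L / 2) `^ theta) *+ 2 + 2 * K * L `^ theta.
  rewrite -{1}c_fix -mulrnAr e4; ring.
rewrite E5 mulr2n; move: t1 t2 t3 i1 i2 d1 d2; rewrite -/L; lra.
Qed.

(** This is [sewing_maximal] on each interval of the coarse partition. *)
Lemma psum_refine Xi a b K e r r' : 0 <= K -> 0 < e -> almost_additive Xi a b K ->
  path <%R a r -> path <%R a r' -> {subset r <= r'} -> last a r = last a r' -> last a r <= b ->
  small_steps e a r ->
  N (psum Xi a r' - psum Xi a r) <= c * K * e `^ (theta - 1) * (last a r - a).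
Proof.
move=> K0 e0; have cK : 0 <= c * K by rewrite mulr_ge0 //; exact: sewing_const_ge0.
elim: r a r' => [|x r IH] a r' hX pr pr' sub El lb st.
  case: r' pr' El {sub} => [_ _|y r' /= /andP[ay py] E].
    by rewrite /= subrr (cn_norm0 cn) subrr mulr0.
  by move: (lt_le_trans ay (path_lt_le_last py)); rewrite -E ltxx.
have xr' : x \in r' by apply: sub; rewrite mem_head.
move: pr st => /= /andP[ax pr] /andP[xe st].
case/splitPr: xr' pr' sub El lb => p q pr' sub El lb.
have [pp xl pq] : [/\ path <%R a p, last a p < x & path <%R x q].
  by move: pr'; rewrite cat_path /= => /and3P[].
have pp' : path <%R a (rcons p x) by rewrite rcons_path pp xl.
have subq : {subset r <= q}.
  move=> y yr; have /andP[xy _] := path_lt_bounds pr yr.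
  have : y \in p ++ x :: q by apply: sub; rewrite in_cons yr orbT.
  rewrite mem_cat in_cons => /or3P[yp|/eqP yx|//].
    have /andP[_ yl] := path_lt_bounds pp yp.
    by move: (lt_trans (le_lt_trans yl xl) xy); rewrite ltxx.
  by move: xy; rewrite yx ltxx.
rewrite last_cat /= in El; rewrite /= in lb.
have xb : x <= b := le_trans (path_lt_le_last pr) lb.
have hX' := almost_additiveW (ltW ax) (lexx b) hX.
have i1 := IH x q hX' pr pq subq El lb st.
have lr : last a (rcons p x) = x by rewrite last_rcons.
have i2 := sewing_maximal K0 hX pp' ltac:(by rewrite lr).
rewrite lr in i2.
have -> : psum Xi a (p ++ x :: q) = psum Xi a (rcons p x) + psum Xi x q by rewrite -cat_rcons psum_cat lr.
have [_ h] := hX; have [_ Pax _ _] := h a a x (lexx a) (lexx a) (ltW ax) xb.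
have P1 := psum_in hX pp' ltac:(by rewrite lr).
have P2 := psum_in hX' pq ltac:(by rewrite -El).
have P3 := psum_in hX' pr lb.
have -> : psum Xi a (rcons p x) + psum Xi x q - (Xi a x + psum Xi x r) =
   (psum Xi a (rcons p x) - Xi a x) + (psum Xi x q - psum Xi x r) by rewrite opprD addrACA.
apply: le_trans (cn_triangle cn (cnB cn P1 Pax) (cnB cn P2 P3)) _.
have xa : 0 < x - a by rewrite subr_gt0.
have h1 : (x - a) `^ theta <= e `^ (theta - 1) * (x - a).
  have -> : (x - a) `^ theta = (x - a) `^ (theta - 1) * (x - a).
    by rewrite -[X in _ = _ * X]powRr1 ?(ltW xa) // -powRD ?subrK // (gt_eqF xa) implybT.
  apply: ler_wpM2r (ltW xa) _ _ _; apply: ge0_ler_powR xe; rewrite ?nnegrE ?(ltW e0) ?(ltW xa) //.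
  by rewrite subr_ge0 ltW.
have := ler_wpM2l cK h1; rewrite /=; move: i1 i2; lra.
Qed.

(** The integral for all upper limits at once, which makes increments of [J] available. *)
Definition sewing_of Xi T (J : R -> V) : Prop :=
  forall t, 0 <= t <= T -> P (J t) /\ forall e, 0 < e -> exists2 dl, 0 < dl &
    forall r, itv_partition 0 t r -> small_steps dl 0 r -> P (psum Xi 0 r) /\ N (psum Xi 0 r - J t) <= e.

Lemma small_stepsW e e' a r : e <= e' -> small_steps e a r -> small_steps e' a r.
Proof. by move=> ee; apply: sub_path => x y /= h; exact: le_trans h ee. Qed.

Lemma small_steps_min d1 d2 a r : small_steps (Num.min d1 d2) a r -> small_steps d1 a r /\ small_steps d2 a r.
Proof. by move=> h; split; apply: small_stepsW h; rewrite ge_min lexx ?orbT. Qed.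

Lemma powR_small (b C e : R) : 0 < b -> 0 <= C -> 0 < e -> exists2 x, 0 < x & C * x `^ b <= e.
Proof.
move=> b0 C0 e0; have C1 : 0 < C + 1 by rewrite ltr_wpDl.
have q0 : 0 < e / (C + 1) by rewrite divr_gt0.
exists ((e / (C + 1)) `^ b^-1); first by rewrite powR_gt0.
by rewrite -powRrM mulVf ?(gt_eqF b0) // powRr1 ?(ltW q0) // mulrA ler_pdivrMr // mulrDr mulr1 mulrC lerDl ltW.
Qed.

Lemma sewing_exists Xi T K : 0 <= K -> almost_additive Xi 0 T K -> exists J, sewing_of Xi T J.
Proof.
move=> K0 hX; have cK : 0 <= c * K by rewrite mulr_ge0 //; exact: sewing_const_ge0.
have th : 0 < theta - 1 by rewrite subr_gt0.
have pt t : exists Jt : V, 0 <= t <= T -> P Jt /\ forall e, 0 < e -> exists2 dl, 0 < dl &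
    forall r, itv_partition 0 t r -> small_steps dl 0 r -> P (psum Xi 0 r) /\ N (psum Xi 0 r - Jt) <= e.
  have [/andP[t0 tT]|nt] := boolP (0 <= t <= T); last by exists 0.
  have close e : 0 < e -> exists2 dl, 0 < dl & forall r r', itv_partition 0 t r -> itv_partition 0 t r' ->
      small_steps dl 0 r -> small_steps dl 0 r' -> N (psum Xi 0 r - psum Xi 0 r') <= e.
    move=> e0; have e2 : 0 < e / 2 by rewrite divr_gt0.
    have [dl d0 hd] := powR_small th (mulr_ge0 cK t0) e2; exists dl => // r1 r2 q1' q2' s1 s2.
    have [r [qr sub1 sub2]] := common_refinement q1' q2'.
    have [p1 /eqP l1] := q1'; have [p2 /eqP l2] := q2'; have [p /eqP l] := qr.
    have h1 := psum_refine K0 d0 hX p1 p sub1 ltac:(by rewrite l1 l) ltac:(by rewrite l1) s1.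
    have h2 := psum_refine K0 d0 hX p2 p sub2 ltac:(by rewrite l2 l) ltac:(by rewrite l2) s2.
    have P1 := psum_in hX p1 ltac:(by rewrite l1).
    have P2 := psum_in hX p2 ltac:(by rewrite l2).
    have P3 := psum_in hX p ltac:(by rewrite l).
    have := cn_dist cn P1 P3 P2; rewrite (cn_distC cn P1 P3).
    rewrite l1 l2 subr0 in h1 h2; move: h1 h2; set E := c * K * dl `^ (theta - 1) * t.
    have -> : E = c * K * t * dl `^ (theta - 1) by rewrite /E; ring.
    move: hd; lra.
  have /choice[r hr] : forall n : nat, exists r, itv_partition 0 t r /\ small_steps n.+1%:R^-1 0 r.
    by move=> n; apply: fine_partition => //; rewrite invr_gt0.
  have Pr n : P (psum Xi 0 (r n)).
    by have [[p /eqP l] _] := hr n; apply: psum_in hX p _; rewrite l.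
  have arch dl : 0 < dl -> exists n : nat, forall i, (n <= i)%N -> i.+1%:R^-1 <= dl :> R.
    move=> d0; exists (Num.truncn dl^-1) => i ni; rewrite -[leRHS]invrK lef_pV2 ?posrE ?invr_gt0 //.
    by apply: ltW; apply: lt_le_trans (truncnS_gt _) _; rewrite ler_nat ltnS.
  have [l Pl hl] : exists2 l, P l & forall e, 0 < e -> exists n, forall i, (n <= i)%N -> N (psum Xi 0 (r i) - l) <= e.
    apply: (cn_complete cn) => // e e0; have [dl d0 hd] := close e e0.
    have [n hn] := arch dl d0; exists n => i j ni nj.
    have [[pi si] [pj sj]] := (hr i, hr j).
    by apply: hd => //; [apply: small_stepsW si | apply: small_stepsW sj]; exact: hn.
  exists l => _; split=> // e e0; have e2 : 0 < e / 2 by rewrite divr_gt0.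
  have [dl d0 hd] := close _ e2; exists dl => // r' pr' sr'.
  have [n hn] := arch dl d0; have [n' hn'] := hl _ e2; pose i := maxn n n'.
  have Pr' : P (psum Xi 0 r') by have [p /eqP lr] := pr'; apply: psum_in hX p _; rewrite lr.
  split => //; have [pi si] := hr i.
  have := hd r' (r i) pr' pi sr' (small_stepsW (hn i (leq_maxl _ _)) si).
  have := hn' i (leq_maxr _ _); have := cn_dist cn Pr' (Pr i) Pl; lra.
by have [J hJ] := choice pt; exists J.
Qed.

Lemma sewing_sub Xi Xi' T J J' : sewing_of Xi T J -> sewing_of Xi' T J' ->
  sewing_of (fun x y => Xi x y - Xi' x y) T (fun t => J t - J' t).
Proof.
move=> h h' t ht; have [PJ hJ] := h t ht; have [PJ' hJ'] := h' t ht.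
split; first exact: (cnB cn).
move=> e e0; have e2 : 0 < e / 2 by rewrite divr_gt0.
have [d1 p1 k1] := hJ _ e2; have [d2 p2 k2] := hJ' _ e2.
exists (Num.min d1 d2); first by rewrite lt_min p1.
move=> r pr sr; rewrite psumB.
have [sr1 sr2] := small_steps_min sr.
have [A1 B1] := k1 r pr sr1; have [A2 B2] := k2 r pr sr2.
split; first exact: (cnB cn).
rewrite opprD addrACA -opprD.
apply: le_trans (cn_normB cn (cnB cn A1 PJ) (cnB cn A2 PJ')) _; lra.
Qed.

Lemma sewing0 Xi T J : 0 <= T -> sewing_of Xi T J -> J 0 = 0.
Proof.
move=> T0 h; have [PJ hJ] := h 0 ltac:(by rewrite lexx).
apply: (cn_eq cn) => //; first exact: (cn0 cn).
move=> e /hJ[dl d0 /(_ [::])] []; [by split | by [] |].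
by move=> _; rewrite /= sub0r (cn_opp cn) // subr0.
Qed.

(** A partition through [s] compares [J t - J s] with sums over [s, t] alone, so that only
    the defects of the germ inside this interval matter. *)
Lemma sewing_increment Xi T J K s t : sewing_of Xi T J -> 0 <= K -> 0 <= s -> s <= t -> t <= T ->
  almost_additive Xi s t K -> N (J t - J s - Xi s t) <= c * K * (t - s) `^ theta.
Proof.
move=> hJ K0 s0 st tT hX.
have [PJs hs] := hJ s ltac:(by rewrite s0 (le_trans st tT)).
have [PJt ht] := hJ t ltac:(by rewrite (le_trans s0 st)).
apply/ler_addgt0Pr => e e0; have e2 : 0 < e / 2 by rewrite divr_gt0.
have [d1 p1 k1] := hs _ e2; have [d2 p2 k2] := ht _ e2.
have dp : 0 < Num.min d1 d2 by rewrite lt_min p1.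
have [r1 [q1' s1]] := fine_partition s0 dp; have [r2 [q2' s2]] := fine_partition st dp.
have [pp1 /eqP l1] := q1'; have [pp2 /eqP l2] := q2'.
have [s1' s1''] := small_steps_min s1; have [_ s2'] := small_steps_min s2.
have [A1 B1] := k1 r1 q1' s1'.
have q3 : itv_partition 0 t (r1 ++ r2).
  by split; [rewrite cat_path pp1 l1 | rewrite last_cat l1 l2].
have s3 : small_steps d2 0 (r1 ++ r2).
  by rewrite /small_steps cat_path l1; apply/andP.
have [A2 B2] := k2 _ q3 s3.
have A3 := psum_in hX pp2 ltac:(by rewrite l2).
have B3 := sewing_maximal K0 hX pp2 ltac:(by rewrite l2); rewrite l2 in B3.
have [_ /(_ s s t (lexx s) (lexx s) st (lexx t)) [_ PX _ _]] := hX.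
have E : psum Xi 0 (r1 ++ r2) = psum Xi 0 r1 + psum Xi s r2 by rewrite psum_cat l1.
have -> : J t - J s - Xi s t = (J t - psum Xi 0 (r1 ++ r2)) + (psum Xi 0 r1 - J s) + (psum Xi s r2 - Xi s t).
  rewrite E !opprD !addrA [RHS](AC 7 (1*5*7*(2*4)*(3*6))) /=.
  by rewrite addNr addNr !addr0.
have hB := cnB cn.
have Q1 := hB _ _ PJt A2; have Q2 := hB _ _ A1 PJs; have Q3 := hB _ _ A3 PX.
have := cn_triangle cn (cnD cn Q1 Q2) Q3; have := cn_triangle cn Q1 Q2.
rewrite (cn_distC cn PJt A2); lra.
Qed.

End Sewing.

(** * Differences of multilinear operators *)

Section Telescoping.
Variables (R : realType) (V : zmodType) (P : V -> Prop) (N : V -> R).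
Hypothesis cn : complete_norm P N.
Variable m : nat.
Implicit Types (f g : 'I_m -> V).

Definition hybrid (i : nat) f g : 'I_m -> V := fun j => if (j < i)%N then g j else f j.

(** The [i]-th argument in the telescoping sum from [B f] to [B g]. *)
Definition diff_slot (i : 'I_m) f g : 'I_m -> V := set_slot (hybrid i f g) i (f i - g i).

Definition slot_subtractive (B : ('I_m -> V) -> V) : Prop :=
  forall f (j : 'I_m) x y, (forall i, P (f i)) -> P x -> P y ->
    B (set_slot f j (x - y)) = B (set_slot f j x) - B (set_slot f j y).

Lemma hybrid_in i f g : (forall j, P (f j)) -> (forall j, P (g j)) -> forall j, P (hybrid i f g j).
Proof. by move=> hf hg j; rewrite /hybrid; case: ifP. Qed.

Lemma diff_slot_in i f g : (forall j, P (f j)) -> (forall j, P (g j)) -> forall j, P (diff_slot i f g j).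
Proof.
move=> hf hg j; rewrite /diff_slot /set_slot; case: eqP => _; last exact: hybrid_in.
exact: (cnB cn).
Qed.

Lemma multilinear_telescope B f g : slot_subtractive B -> (forall j, P (f j)) -> (forall j, P (g j)) ->
  B f - B g = \sum_(i < m) B (diff_slot i f g).
Proof.
move=> hB hf hg.
have h0 : hybrid 0 f g = f by apply/funext => j.
have hm : hybrid m f g = g by apply/funext => j; rewrite /hybrid ltn_ord.
rewrite -[in LHS]h0 -[X in _ - B X]hm -opprB.
rewrite -(telescope_sumr (fun i => B (hybrid i f g)) (leq0n m)) big_mkord -sumrN; apply: eq_bigr => i _.
rewrite opprB /diff_slot hB //; last exact: hybrid_in.
congr (B _ - B _); apply/funext => j; rewrite /set_slot /hybrid; case: eqP => [->|/eqP ij].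
- by rewrite ltnn.
- by [].
- by rewrite ltnSn.
- by rewrite ltnS leq_eqVlt; have -> : (j == i :> nat) = false by apply/negbTE; rewrite -(inj_eq val_inj) in ij.
Qed.

Lemma prod_le_one (a : 'I_m -> R) (i : 'I_m) (x Q : R) : 1 <= Q -> 0 <= x ->
  (forall j, 0 <= a j) -> a i <= x -> (forall j, j != i -> a j <= Q) -> \prod_j a j <= x * Q ^+ m.
Proof.
move=> Q1 x0 a0 ax aQ; rewrite (bigD1 i) //=; apply: ler_pM => //; first exact: prodr_ge0.
apply: (@le_trans _ _ (\prod_(j < m) Q)); last by rewrite prodr_const card_ord.
rewrite [leRHS](bigD1 i) //=; apply: (@le_trans _ _ (1 * \prod_(j < m | j != i) a j)); first by rewrite mul1r.
apply: ler_pM => //; first exact: prodr_ge0.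
by apply: ler_prod => j ji; rewrite a0 aQ.
Qed.

Lemma prod_le_two (a : 'I_m -> R) (i l : 'I_m) (x y Q : R) : 1 <= Q -> 0 <= x -> 0 <= y -> i != l ->
  (forall j, 0 <= a j) -> a i <= x -> a l <= y -> (forall j, j != i -> j != l -> a j <= Q) ->
  \prod_j a j <= x * y * Q ^+ m.
Proof.
move=> Q1 x0 y0 il a0 ax ay aQ.
pose b j := if j == i then 1 else a j.
have b0 j : 0 <= b j by rewrite /b; case: eqP.
have bQ j : j != l -> b j <= Q by rewrite /b => jl; case: ifP => // /negbT ji; exact: aQ.
have := @prod_le_one b l y Q Q1 y0 b0 ltac:(by rewrite /b eq_sym (negbTE il)) bQ.
have -> : \prod_j b j = \prod_(j < m | j != i) a j.
  by rewrite (bigD1 i) //= /b eqxx mul1r; apply: eq_bigr => j /negbTE ->.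
by move=> h; rewrite (bigD1 i) //= -mulrA; apply: ler_pM => //; exact: prodr_ge0.
Qed.

Variables (B : ('I_m -> V) -> V) (b Q : R).
Hypotheses (hB : slot_subtractive B) (b0 : 0 <= b) (Q1 : 1 <= Q) (m0 : (0 < m)%N).
Hypothesis bound : forall f, (forall j, P (f j)) -> P (B f) /\ N (B f) <= b * \prod_j N (f j).
Let diag (v : V) : V := B (fun _ => v).
Let L := b * (m ^ 2)%:R * Q ^+ m.

Let Qm0 : 0 <= Q ^+ m. Proof. by rewrite exprn_ge0 // (le_trans ler01). Qed.
Let m1 : 1 <= m%:R :> R. Proof. by rewrite ler1n. Qed.

Let N_sum (F : 'I_m -> V) (x : R) : 0 <= x -> (forall i, P (F i) /\ N (F i) <= x) -> N (\sum_i F i) <= m%:R * x.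
Proof.
move=> x0 h; have : P (\sum_i F i) /\ N (\sum_i F i) <= \sum_(i < m) x.
  elim/big_ind2: _ => [|u p v q [pu hu] [pv hv]|i _]; last exact: h.
    by rewrite (cn_norm0 cn); split => //; exact: (cn0 cn).
  split; first exact: (cnD cn).
  by apply: le_trans (cn_triangle cn pu pv) _; exact: lerD.
by rewrite sumr_const card_ord mulr_natl => -[].
Qed.

Lemma diag_le v : P v -> N v <= Q -> P (diag v) /\ N (diag v) <= L.
Proof.
move=> pv vQ; have [h1 h2] := bound (fun _ : 'I_m => pv); split => //; apply: le_trans h2 _.
rewrite /L -mulrA ler_wpM2l // prodr_const card_ord.
apply: (@le_trans _ _ (1 * Q ^+ m)); last by rewrite ler_wpM2r // ler1n expn_gt0 m0.
by rewrite mul1r lerXn2r // nnegrE ?(cn_ge0 cn) // (le_trans ler01).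
Qed.

Lemma diag_lipschitz v v' : P v -> P v' -> N v <= Q -> N v' <= Q ->
  N (diag v - diag v') <= L * N (v - v').
Proof.
move=> pv pv' vQ vQ'; rewrite /diag multilinear_telescope //.
set x := N (v - v'); have x0 : 0 <= x by exact: (cn_ge0 cn).
have : N (\sum_(i < m) B (diff_slot i (fun=> v) (fun=> v'))) <= m%:R * (b * (x * Q ^+ m)).
  apply: N_sum; first by rewrite !mulr_ge0.
  move=> i; have [h1 h2] := bound (diff_slot_in i (fun=> pv) (fun=> pv')).
  split=> //; apply: le_trans h2 _; rewrite ler_wpM2l //.
  apply: (@prod_le_one _ i) => // [j||j ji]; first exact: (cn_ge0 cn).
    by rewrite /diff_slot /set_slot eqxx.
  by rewrite /diff_slot /set_slot (negbTE ji) /hybrid; case: ifP.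
move=> h; apply: le_trans h _; rewrite /L natrX expr2.
have -> : m%:R * (b * (x * Q ^+ m)) = 1 * (m%:R * (b * (x * Q ^+ m))) by rewrite mul1r.
have -> : b * (m%:R * m%:R) * Q ^+ m * x = m%:R * (m%:R * (b * (x * Q ^+ m))) by ring.
by rewrite ler_wpM2r // !mulr_ge0.
Qed.

(** Telescoping twice leaves terms with either the second difference in one slot, or first
    differences in two distinct slots. *)
Lemma diag_second_difference v1 v2 v1' v2' x y z :
  P v1 -> P v2 -> P v1' -> P v2' -> N v1 <= Q -> N v2 <= Q -> N v1' <= Q -> N v2' <= Q ->
  N (v1 - v2 - (v1' - v2')) <= x -> N (v1 - v2) <= y -> N (v1' - v2') <= y ->
  N (v1 - v1') <= z -> N (v2 - v2') <= z ->
  N (diag v1 - diag v2 - (diag v1' - diag v2')) <= L * (x + y * z).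
Proof.
move=> p1 p2 p1' p2' n1 n2 n1' n2' hx hy hy' hz hz'.
have x0 : 0 <= x := le_trans (cn_ge0 cn _) hx.
have y0 : 0 <= y := le_trans (cn_ge0 cn _) hy.
have z0 : 0 <= z := le_trans (cn_ge0 cn _) hz.
rewrite /diag !multilinear_telescope // -sumrB.
pose F i := diff_slot i (fun=> v1) (fun=> v2); pose G i := diff_slot i (fun=> v1') (fun=> v2').
have pF i j : P (F i j) by exact: diff_slot_in.
have pG i j : P (G i j) by exact: diff_slot_in.
have xyz : 0 <= x + y * z by rewrite addr_ge0 // mulr_ge0.
have FQ i j : j != i -> N (F i j) <= Q.
  by move=> ji; rewrite /F /diff_slot /set_slot (negbTE ji) /hybrid; case: ifP.
have GQ i j : j != i -> N (G i j) <= Q.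
  by move=> ji; rewrite /G /diff_slot /set_slot (negbTE ji) /hybrid; case: ifP.
have Fi i : N (F i i) <= y by rewrite /F /diff_slot /set_slot eqxx.
have Gi i : N (G i i) <= y by rewrite /G /diff_slot /set_slot eqxx.
have FG i j : i != j -> N (F i j - G i j) <= z.
  by move=> ij; rewrite /F /G /diff_slot /set_slot eq_sym (negbTE ij) /hybrid; case: ifP.
have FGi i : N (F i i - G i i) <= x by rewrite /F /G /diff_slot /set_slot eqxx.
have key i l : N (B (diff_slot l (F i) (G i))) <= b * ((x + y * z) * Q ^+ m).
  have [_ h] := bound (diff_slot_in l (pF i) (pG i)); apply: le_trans h _; rewrite ler_wpM2l //.
  have n0 j : 0 <= N (diff_slot l (F i) (G i) j) by exact: (cn_ge0 cn).
  have [li|li] := eqVneq l i.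
    apply: (@le_trans _ _ (x * Q ^+ m)); last by rewrite ler_wpM2r // lerDl mulr_ge0.
    apply: (@prod_le_one _ i) => // [|j ji]; first by rewrite /diff_slot /set_slot li eqxx.
    rewrite /diff_slot /set_slot li (negbTE ji) /hybrid; case: ifP => _; [exact: GQ | exact: FQ].
  apply: (@le_trans _ _ (y * z * Q ^+ m)); last by rewrite ler_wpM2r // lerDr.
  apply: (@prod_le_two _ i l) => // [|||j ji jl]; first by rewrite eq_sym.
  - by rewrite /diff_slot /set_slot eq_sym (negbTE li) /hybrid; case: ifP.
  - by rewrite /diff_slot /set_slot eqxx; apply: FG; rewrite eq_sym.
  - rewrite /diff_slot /set_slot (negbTE jl) /hybrid; case: ifP => _; [exact: GQ | exact: FQ].
have b1 : 0 <= b * ((x + y * z) * Q ^+ m) by rewrite !mulr_ge0.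
have := @N_sum (fun i => B (F i) - B (G i)) (m%:R * (b * ((x + y * z) * Q ^+ m))).
have -> : L * (x + y * z) = m%:R * (m%:R * (b * ((x + y * z) * Q ^+ m))) by rewrite /L natrX expr2; ring.
apply; first by rewrite mulr_ge0.
move=> i; split; first by apply: (cnB cn); [have [] := bound (pF i) | have [] := bound (pG i)].
rewrite multilinear_telescope //; apply: N_sum => // l; split; last exact: key.
by have [] := bound (diff_slot_in l (pF i) (pG i)).
Qed.

End Telescoping.

(** * Young equations in a normed group *)

Lemma subrACA (V : zmodType) (a b c d : V) : a - b - (c - d) = a - c - (b - d).
Proof. by rewrite opprD addrACA -opprD. Qed.

Section Geometric.
Variable R : realType.

Lemma geometric_small (C e : R) : 0 <= C -> 0 < e -> exists n0 : nat, forall n, (n0 <= n)%N -> C / 4 ^+ n <= e.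
Proof.
move=> C0 e0; exists (Num.truncn (C / e)).+1 => n hn.
have p4 : 0 < 4 ^+ n :> R by rewrite exprn_gt0.
rewrite ler_pdivrMr // mulrC -ler_pdivrMr //; apply: ltW; apply: lt_trans (truncnS_gt _) _.
by rewrite -natrX ltr_nat; apply: leq_trans (ltn_expl _ (isT : (1 < 4)%N)) _; rewrite leq_exp2l.
Qed.

(** The number [xi / 3] is the fixed point of [fun rho => (rho + xi) / 4]. *)
Lemma contraction_bound (I : Type) (D : I -> Prop) (x y : I -> R) (M xi : R) :
  (forall i, D i -> 0 <= y i) -> 0 <= M -> 0 <= xi -> (forall i, D i -> x i <= M * y i) ->
  (forall rho, 0 <= rho -> (forall i, D i -> x i <= rho * y i) ->
     forall i, D i -> x i <= (rho + xi) / 4 * y i) ->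
  forall i, D i -> x i <= xi / 3 * y i.
Proof.
move=> y0 M0 xi0 start step i Di; apply/ler_addgt0Pr => e e0.
have H n : forall i, D i -> x i <= (M / 4 ^+ n + xi / 3) * y i.
  elim: n => [|n IH] j Dj.
    apply: le_trans (start j Dj) _; rewrite expr0 divr1 ler_wpM2r ?y0 // lerDl divr_ge0 //.
  have := step _ _ IH j Dj; have -> : (M / 4 ^+ n + xi / 3 + xi) / 4 = M / 4 ^+ n.+1 + xi / 3.
    by rewrite exprS; field; rewrite expf_neq0 // pnatr_eq0.
  by apply; rewrite addr_ge0 // divr_ge0 // exprn_ge0.
have [n /(_ n (leqnn n)) hn] := geometric_small (mulr_ge0 M0 (y0 i Di)) e0.
have := H n i Di; rewrite mulrDl mulrAC; lra.
Qed.

End Geometric.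

Section YoungEquation.
Variables (R : realType) (V : zmodType) (P : V -> Prop) (N : V -> R).
Hypothesis cn : complete_norm P N.
Variables (gamma lambda T0 : R) (Y : R -> V -> V).
Hypotheses (lambda0 : 0 < lambda) (lg : lambda < gamma) (young : 1 < gamma + lambda).
Let theta := gamma + lambda.
Let c := sewing_const theta.
Let c0 : 0 <= c. Proof. exact: sewing_const_ge0. Qed.
Let gamma0 : 0 < gamma. Proof. exact: lt_trans lg. Qed.

Definition inc (s t : R) (v : V) : V := Y t v - Y s v.

Definition germ (u : R -> V) (s t : R) : V := inc s t (u s).

(** The integral of a path is defined by the first two bounds; the bound on second
    differences makes the integral Lipschitz as a map between spaces of Hoelder paths. *)
Record young_bounds (Q L : R) : Prop := YoungBounds {
  yb_in : forall t v, 0 <= t -> t <= T0 -> P v -> P (Y t v);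
  yb_size : forall s t v, 0 <= s -> s <= t -> t <= T0 -> P v -> N v <= Q ->
    N (inc s t v) <= L * (t - s) `^ gamma;
  yb_lip : forall s t v v', 0 <= s -> s <= t -> t <= T0 -> P v -> P v' -> N v <= Q -> N v' <= Q ->
    N (inc s t v - inc s t v') <= L * (t - s) `^ gamma * N (v - v');
  yb_second : forall s t v1 v2 v1' v2' x y z, 0 <= s -> s <= t -> t <= T0 ->
    P v1 -> P v2 -> P v1' -> P v2' -> N v1 <= Q -> N v2 <= Q -> N v1' <= Q -> N v2' <= Q ->
    N (v1 - v2 - (v1' - v2')) <= x -> N (v1 - v2) <= y -> N (v1' - v2') <= y ->
    N (v1 - v1') <= z -> N (v2 - v2') <= z ->
    N (inc s t v1 - inc s t v2 - (inc s t v1' - inc s t v2')) <= L * (t - s) `^ gamma * (x + y * z) }.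

Definition hoelder_path a b Q H (u : R -> V) : Prop :=
  (forall t, a <= t -> t <= b -> P (u t) /\ N (u t) <= Q) /\
  forall s t, a <= s -> s <= t -> t <= b -> N (u t - u s) <= H * (t - s) `^ lambda.

Lemma hoelder_pathW a b a' b' Q H u : a <= a' -> b' <= b -> hoelder_path a b Q H u -> hoelder_path a' b' Q H u.
Proof.
move=> aa bb [h1 h2]; split=> [t at_ tb|s t as_ st tb].
  by apply: h1; [exact: le_trans at_ | exact: le_trans bb].
by apply: h2 => //; [exact: le_trans as_ | exact: le_trans bb].
Qed.

Let powR_theta (x : R) : x `^ gamma * x `^ lambda = x `^ theta.
Proof.
rewrite /theta -powRD //; apply/implyP => /eqP h.
by have := addr_gt0 gamma0 lambda0; rewrite h ltxx.
Qed.

Let powR_le_gamma (x y : R) : 0 <= x -> x <= y -> x `^ gamma <= y `^ gamma.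
Proof. by move=> x0 xy; apply: ge0_ler_powR => //; rewrite ?nnegrE ?(ltW gamma0) ?(le_trans x0 xy). Qed.

Let powR_le_lambda (x y : R) : 0 <= x -> x <= y -> x `^ lambda <= y `^ lambda.
Proof. by move=> x0 xy; apply: ge0_ler_powR => //; rewrite ?nnegrE ?(ltW lambda0) ?(le_trans x0 xy). Qed.

Let powR_le_one (x p : R) : 0 <= x -> x <= 1 -> 0 <= p -> x `^ p <= 1.
Proof.
move=> x0 x1 p0; have <- : 1 `^ p = 1 :> R by rewrite powR1.
by apply: ge0_ler_powR => //; rewrite ?nnegrE.
Qed.

(** The source of smallness on short intervals: [gamma > lambda]. *)
Let powR_gain (x y : R) : 0 <= x -> x <= y -> x `^ gamma <= y `^ (gamma - lambda) * x `^ lambda.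
Proof.
move=> x0 xy; have -> : x `^ gamma = x `^ (gamma - lambda) * x `^ lambda.
  rewrite -powRD ?subrK //; apply/implyP => /eqP h.
  by have := gamma0; rewrite h ltxx.
apply: ler_wpM2r; first exact: powR_ge0.
by apply: ge0_ler_powR => //; rewrite ?nnegrE ?subr_ge0 ?(ltW lg) ?(le_trans x0 xy).
Qed.

Section OneInterval.
Variables (Q L H a b : R).
Hypotheses (yb : young_bounds Q L) (L0 : 0 <= L) (H0 : 0 <= H).
Hypotheses (a0 : 0 <= a) (bT0 : b <= T0).

Let P_inc s t v : 0 <= s -> s <= t -> t <= T0 -> P v -> P (inc s t v).
Proof.
move=> s0 st tT pv; apply: (cnB cn); apply: (yb_in yb) => //; [exact: le_trans st | exact: le_trans tT].
Qed.

Lemma germ_almost_additive u : hoelder_path a b Q H u -> almost_additive P N theta (germ u) a b (L * H).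
Proof.
move=> [hu hH]; split=> [x _|x y z ax xy yz zb]; first by rewrite /germ /inc subrr.
have x0 := le_trans a0 ax; have y0 := le_trans x0 xy; have zT := le_trans zb bT0.
have yT := le_trans yz zT; have yb' := le_trans yz zb; have xz := le_trans xy yz.
have [px nx] := hu x ax (le_trans xz zb); have [py ny] := hu y (le_trans ax xy) yb'.
split; [exact: P_inc | exact: P_inc | exact: P_inc |].
have -> : germ u x z - germ u x y - germ u y z = inc y z (u x) - inc y z (u y).
  by rewrite /germ /inc; congr (_ - _); rewrite opprB addrA subrK.
apply: le_trans (yb_lip yb y0 yz zT px py nx ny) _.
rewrite -powR_theta (cn_distC cn px py).
have h1 : (z - y) `^ gamma <= (z - x) `^ gamma by apply: powR_le_gamma; rewrite ?subr_ge0 // lerB.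
have h2 : N (u y - u x) <= H * (z - x) `^ lambda.
  apply: le_trans (hH x y ax xy yb') _; apply: ler_wpM2l => //.
  by apply: powR_le_lambda; rewrite ?subr_ge0 // lerB.
have -> : L * H * ((z - x) `^ gamma * (z - x) `^ lambda) = L * (z - x) `^ gamma * (H * (z - x) `^ lambda) by ring.
apply: ler_pM => //; [by rewrite mulr_ge0 ?powR_ge0 | exact: (cn_ge0 cn) | exact: ler_wpM2l].
Qed.

Lemma germ_diff_almost_additive u v y rho : hoelder_path a b Q H u -> hoelder_path a b Q H v ->
  0 <= y -> 0 <= rho -> (forall t, a <= t -> t <= b -> N (u t - v t) <= y) ->
  (forall s t, a <= s -> s <= t -> t <= b -> N (u t - u s - (v t - v s)) <= rho * (t - s) `^ lambda) ->
  almost_additive P N theta (fun s t => germ u s t - germ v s t) a b (L * (rho + y * H)).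
Proof.
move=> [hu hH] [hv hHv] y0 rho0 hy hrho; split=> [x _|x1 y1 z1 ax xy yz zb].
  by rewrite /germ /inc !subrr.
have x0 := le_trans a0 ax; have y10 := le_trans x0 xy; have zT := le_trans zb bT0.
have yT := le_trans yz zT; have yb' := le_trans yz zb; have xz := le_trans xy yz.
have xb := le_trans xy yb'; have ay := le_trans ax xy.
have [px nx] := hu x1 ax xb; have [py ny] := hu y1 ay yb'.
have [qx mx] := hv x1 ax xb; have [qy my] := hv y1 ay yb'.
split; [by apply: (cnB cn); exact: P_inc | by apply: (cnB cn); exact: P_inc | by apply: (cnB cn); exact: P_inc |].
have -> : germ u x1 z1 - germ v x1 z1 - (germ u x1 y1 - germ v x1 y1) - (germ u y1 z1 - germ v y1 z1) =
   inc y1 z1 (u x1) - inc y1 z1 (v x1) - (inc y1 z1 (u y1) - inc y1 z1 (v y1)).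
  have e w : germ w x1 z1 - germ w x1 y1 = inc y1 z1 (w x1) by rewrite /germ /inc opprB addrA subrK.
  have -> : germ u x1 z1 - germ v x1 z1 - (germ u x1 y1 - germ v x1 y1) =
      (germ u x1 z1 - germ u x1 y1) - (germ v x1 z1 - germ v x1 y1) by rewrite subrACA.
  by rewrite !e.
have dl : 0 <= y1 - x1 by rewrite subr_ge0.
have dle : y1 - x1 <= z1 - x1 by rewrite lerB.
have hx : N (u x1 - v x1 - (u y1 - v y1)) <= rho * (z1 - x1) `^ lambda.
  have -> : u x1 - v x1 - (u y1 - v y1) = - (u y1 - u x1 - (v y1 - v x1)).
    by rewrite !opprB !addrA [RHS](AC 4 (3*2*1*4)).
  rewrite (cn_opp cn); last by apply: (cnB cn); exact: (cnB cn).
  apply: le_trans (hrho x1 y1 ax xy yb') _; apply: ler_wpM2l => //; exact: powR_le_lambda.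
have hz w : P (w x1) -> P (w y1) -> N (w y1 - w x1) <= H * (y1 - x1) `^ lambda -> N (w x1 - w y1) <= H * (z1 - x1) `^ lambda.
  move=> p q h; rewrite (cn_distC cn p q); apply: le_trans h _; apply: ler_wpM2l => //; exact: powR_le_lambda.
apply: le_trans (yb_second yb y10 yz zT px qx py qy nx mx ny my hx (hy x1 ax xb) (hy y1 ay yb')
  (hz u px py (hH x1 y1 ax xy yb')) (hz v qx qy (hHv x1 y1 ax xy yb'))) _.
rewrite -powR_theta.
have -> : L * (rho + y * H) * ((z1 - x1) `^ gamma * (z1 - x1) `^ lambda) =
   L * (z1 - x1) `^ gamma * (rho * (z1 - x1) `^ lambda + y * (H * (z1 - x1) `^ lambda)) by ring.
apply: ler_wpM2r; first by rewrite addr_ge0 // !mulr_ge0 ?powR_ge0.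
by apply: ler_wpM2l => //; apply: powR_le_gamma; rewrite ?subr_ge0 // lerB.
Qed.

Definition gain_const := L * (1 + c * (1 + H)).

Let A0 : 0 <= gain_const. Proof. by rewrite mulr_ge0 // addr_ge0 // mulr_ge0 // addr_ge0. Qed.

Variable T : R.
Hypotheses (bT : b <= T) (ba1 : b - a <= 1).

Let theta_gamma s t : a <= s -> s <= t -> t <= b -> (t - s) `^ theta <= (t - s) `^ gamma.
Proof.
move=> as_ st tb; have ts : 0 <= t - s by rewrite subr_ge0.
rewrite -powR_theta -[leRHS]mulr1 ler_wpM2l ?powR_ge0 //.
by apply: powR_le_one => //; [apply: le_trans ba1; exact: lerB | exact: ltW].
Qed.

Lemma young_growth u J s t : hoelder_path a b Q H u -> sewing_of P N (germ u) T J ->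
  a <= s -> s <= t -> t <= b ->
  N (J t - J s) <= gain_const * (b - a) `^ (gamma - lambda) * (t - s) `^ lambda.
Proof.
move=> hu hJ as_ st tb; have s0 := le_trans a0 as_; have tT := le_trans tb bT.
have LH : 0 <= L * H by rewrite mulr_ge0.
have h := sewing_increment cn young hJ LH s0 st tT (almost_additiveW as_ tb (germ_almost_additive hu)).
have [PJs _] := hJ s ltac:(by rewrite s0 (le_trans st tT)).
have [PJt _] := hJ t ltac:(by rewrite (le_trans s0 st) tT).
have [ps ns] := proj1 hu s as_ (le_trans st tb).
have Pg : P (germ u s t) := P_inc s0 st (le_trans tb bT0) ps.
have g := yb_size yb s0 st (le_trans tb bT0) ps ns; rewrite -/(germ u s t) in g.
have := cn_triangle cn (cnB cn (cnB cn PJt PJs) Pg) Pg; rewrite subrK.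
have cLH : 0 <= c * (L * H) by rewrite mulr_ge0.
have := ler_wpM2l cLH (theta_gamma as_ st tb).
have G0 : 0 <= (t - s) `^ gamma by exact: powR_ge0.
have e1 : L * (t - s) `^ gamma + c * (L * H) * (t - s) `^ gamma <= gain_const * (t - s) `^ gamma.
  rewrite -mulrDl ler_wpM2r // /gain_const mulrDr mulr1 lerD2l [leRHS]mulrCA ler_wpM2l // ler_wpM2l // lerDr //.
have : gain_const * (t - s) `^ gamma <= gain_const * (b - a) `^ (gamma - lambda) * (t - s) `^ lambda.
  rewrite -mulrA ler_wpM2l //; apply: powR_gain; [by rewrite subr_ge0 | exact: lerB].
move: h g e1; rewrite -/c -/theta; lra.
Qed.

(** The germ of the difference of the integrals has size [rho + xi] by the Lipschitz bound,
    and its defect of additivity has the same size by the bound on second differences. *)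
Lemma young_stability u v J J' rho xi : hoelder_path a b Q H u -> hoelder_path a b Q H v ->
  sewing_of P N (germ u) T J -> sewing_of P N (germ v) T J' -> 0 <= rho -> 0 <= xi -> a <= b ->
  N (u a - v a) <= xi ->
  (forall s t, a <= s -> s <= t -> t <= b -> N (u t - u s - (v t - v s)) <= rho * (t - s) `^ lambda) ->
  forall s t, a <= s -> s <= t -> t <= b ->
  N (J t - J s - (J' t - J' s)) <=
    gain_const * (b - a) `^ (gamma - lambda) * (rho + xi) * (t - s) `^ lambda.
Proof.
move=> hu hv hJ hJ' rho0 xi0 ab hxi hrho s t as_ st tb.
have s0 := le_trans a0 as_; have tT := le_trans tb bT; have tT0 := le_trans tb bT0.
have [pu nu] := hu; have [pv nv] := hv.
have hy r : a <= r -> r <= b -> N (u r - v r) <= xi + rho.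
  move=> ar rb; have [p1 _] := pu r ar rb; have [p2 _] := pv r ar rb.
  have [p3 _] := pu a (lexx a) ab; have [p4 _] := pv a (lexx a) ab.
  have -> : u r - v r = (u a - v a) + (u r - u a - (v r - v a)).
    by rewrite opprB !addrA [RHS](AC 6 (3*6*(1*4)*(5*2))) /= !subrr !addr0.
  apply: le_trans (cn_triangle cn (cnB cn p3 p4) (cnB cn (cnB cn p1 p3) (cnB cn p2 p4))) _.
  apply: lerD => //; apply: le_trans (hrho a r (lexx a) ar rb) _.
  rewrite -[leRHS]mulr1 ler_wpM2l // powR_le_one ?subr_ge0 ?(ltW lambda0) //.
  by apply: le_trans ba1; exact: lerB.
have y0 : 0 <= xi + rho by rewrite addr_ge0.
set K := L * (rho + (xi + rho) * H); have K0 : 0 <= K by rewrite mulr_ge0 // addr_ge0 // mulr_ge0.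
have hX := germ_diff_almost_additive hu hv y0 rho0 hy hrho.
have h := sewing_increment cn young (sewing_sub cn hJ hJ') K0 s0 st tT (almost_additiveW as_ tb hX).
have [PJs _] := hJ s ltac:(by rewrite s0 (le_trans st tT)).
have [PJt _] := hJ t ltac:(by rewrite (le_trans s0 st) tT).
have [PJs' _] := hJ' s ltac:(by rewrite s0 (le_trans st tT)).
have [PJt' _] := hJ' t ltac:(by rewrite (le_trans s0 st) tT).
have sb := le_trans st tb.
have [ps ns] := pu s as_ sb; have [qs ms] := pv s as_ sb.
have Pg : P (germ u s t - germ v s t) by apply: (cnB cn); exact: P_inc.
have g := yb_lip yb s0 st tT0 ps qs ns ms; rewrite -/(germ u s t) -/(germ v s t) in g.
have G0 : 0 <= (t - s) `^ gamma by exact: powR_ge0.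
have g' : N (germ u s t - germ v s t) <= L * (t - s) `^ gamma * (xi + rho).
  by apply: le_trans g _; apply: ler_wpM2l (hy s as_ sb); rewrite mulr_ge0.
rewrite subrACA.
have PD : P (J t - J' t - (J s - J' s)) by apply: (cnB cn); exact: (cnB cn).
have := cn_triangle cn (cnB cn PD Pg) Pg; rewrite subrK.
have cK : 0 <= c * K by rewrite mulr_ge0.
have := ler_wpM2l cK (theta_gamma as_ st tb).
have e1 : L * (t - s) `^ gamma * (xi + rho) + c * K * (t - s) `^ gamma <= gain_const * (rho + xi) * (t - s) `^ gamma.
  have -> : L * (t - s) `^ gamma * (xi + rho) + c * K * (t - s) `^ gamma =
    (L * (rho + xi) + c * (L * (rho + (xi + rho) * H))) * (t - s) `^ gamma by rewrite /K; ring.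
  rewrite ler_wpM2r // /gain_const.
  have -> : L * (1 + c * (1 + H)) * (rho + xi) = L * (rho + xi) + c * (L * (rho + (xi + rho) * H)) + c * L * xi by ring.
  by rewrite lerDl; apply: mulr_ge0 => //; exact: mulr_ge0.
have A1 : 0 <= gain_const * (rho + xi) by rewrite mulr_ge0 // addr_ge0.
have : gain_const * (rho + xi) * (t - s) `^ gamma <= gain_const * (rho + xi) * ((b - a) `^ (gamma - lambda) * (t - s) `^ lambda).
  rewrite ler_wpM2l //; apply: powR_gain; [by rewrite subr_ge0 | exact: lerB].
have -> : gain_const * (b - a) `^ (gamma - lambda) * (rho + xi) * (t - s) `^ lambda =
  gain_const * (rho + xi) * ((b - a) `^ (gamma - lambda) * (t - s) `^ lambda) by ring.
move: h g' e1; rewrite -/c -/theta -/K; lra.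
Qed.

End OneInterval.

Definition young_solution T psi u := sewing_of P N (germ u) T (fun t => u t - psi).

Let subrBB (x y p : V) : x - p - (y - p) = x - y. Proof. by rewrite opprB addrA subrK. Qed.

Lemma young_solution0 T psi u : 0 <= T -> young_solution T psi u -> u 0 = psi.
Proof. by move=> T0' /(sewing0 cn T0') /eqP; rewrite subr_eq0 => /eqP. Qed.

(** By [young_stability], any bound [rho] for the increments of [u - v] improves to
    [(rho + xi) / 4]. *)
Lemma stable_increments Q L H a b T psi psi' u v xi : young_bounds Q L -> 0 <= L -> 0 <= H ->
  0 <= a -> a <= b -> b <= T -> T <= T0 -> b - a <= 1 -> gain_const L H * (b - a) `^ (gamma - lambda) <= 1 / 4 ->
  hoelder_path a b Q H u -> hoelder_path a b Q H v ->
  young_solution T psi u -> young_solution T psi' v -> 0 <= xi -> N (u a - v a) <= xi ->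
  forall s t, a <= s -> s <= t -> t <= b -> N (u t - u s - (v t - v s)) <= xi / 3 * (t - s) `^ lambda.
Proof.
move=> yb L0 H0 a0 ab bT TT0 ba1 gain hu hv su sv xi0 hxi s t as_ st tb.
pose D (p : R * R) := [/\ a <= p.1, p.1 <= p.2 & p.2 <= b].
pose x (p : R * R) := N (u p.2 - u p.1 - (v p.2 - v p.1)).
pose y (p : R * R) := (p.2 - p.1) `^ lambda.
have y0 p : D p -> 0 <= y p by move=> _; exact: powR_ge0.
have [[pu hu2] [pv hv2]] := (hu, hv).
suff : x (s, t) <= xi / 3 * y (s, t) by [].
apply: (@contraction_bound R _ D x y (2 * H) xi y0 _ xi0) => //.
- by rewrite mulr_ge0.
- move=> [s' t'] [/= h1 h2 h3]; rewrite /x /y /=.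
  have s'b := le_trans h2 h3; have at' := le_trans h1 h2.
  have [p1 _] := pu _ h1 s'b; have [p2 _] := pu _ at' h3.
  have [p3 _] := pv _ h1 s'b; have [p4 _] := pv _ at' h3.
  apply: le_trans (cn_normB cn (cnB cn p2 p1) (cnB cn p4 p3)) _.
  have := hu2 _ _ h1 h2 h3; have := hv2 _ _ h1 h2 h3; lra.
- move=> rho rho0 hrho [s' t'] [/= h1 h2 h3]; rewrite /x /y /=.
  have hr s1 t1 : a <= s1 -> s1 <= t1 -> t1 <= b -> N (u t1 - u s1 - (v t1 - v s1)) <= rho * (t1 - s1) `^ lambda.
    by move=> k1 k2 k3; apply: (hrho (s1, t1)).
  have bT0 := le_trans bT TT0.
  have := young_stability yb L0 H0 a0 bT0 bT ba1 hu hv su sv rho0 xi0 ab hxi hr h1 h2 h3.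
  rewrite !subrBB => h; apply: le_trans h _; rewrite ler_wpM2r ?powR_ge0 //.
  have r0 : 0 <= rho + xi by rewrite addr_ge0.
  have := ler_wpM2r r0 gain; lra.
Qed.

Lemma small_time (A : R) : 0 <= A -> exists2 tau, 0 < tau <= 1 &
  forall x, 0 <= x -> x <= tau -> A * x `^ (gamma - lambda) <= 1 / 4.
Proof.
move=> A0; have gl : 0 < gamma - lambda by rewrite subr_gt0.
have [x x0 hx] := powR_small gl A0 (divr_gt0 ltr01 (ltr0Sn R 3)).
exists (Num.min x 1); first by rewrite lt_min x0 ltr01 ge_min lexx orbT.
move=> y y0; rewrite le_min => /andP[yx _]; apply: le_trans hx; apply: ler_wpM2l => //.
by apply: ge0_ler_powR => //; rewrite ?nnegrE ?(ltW gl) ?(ltW x0).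
Qed.

(** The solutions may leave any prescribed ball, so the interval is cut into pieces whose
    length depends on the norms of the two solutions themselves. *)
Lemma young_unique Q L H T psi u v : young_bounds Q L -> 0 <= L -> 0 <= H -> 0 <= T -> T <= T0 ->
  hoelder_path 0 T Q H u -> hoelder_path 0 T Q H v ->
  young_solution T psi u -> young_solution T psi v -> forall t, 0 <= t -> t <= T -> u t = v t.
Proof.
move=> yb L0 H0 T0' TT0 hu hv su sv.
have A0 : 0 <= gain_const L H by rewrite mulr_ge0 // addr_ge0 // mulr_ge0 // addr_ge0.
have [tau /andP[tau0 tau1] htau] := small_time A0.
have [[pu hu2] [pv hv2]] := (hu, hv).
suff H' n t : 0 <= t -> t <= T -> t <= n%:R * tau -> u t = v t.
  move=> t t0 tT; apply: (H' (Num.truncn (t / tau)).+1) => //.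
  by rewrite -ler_pdivrMr // ltW // truncnS_gt.
elim: n t => [|n IH] t t0 tT tn.
  have -> : t = 0 by apply/eqP; rewrite eq_le t0 andbT; move: tn; rewrite mul0r.
  by rewrite (young_solution0 T0' su) (young_solution0 T0' sv).
have [tn'|nt] := leP t (n%:R * tau); first exact: IH.
set a := n%:R * tau in nt; have a0 : 0 <= a by rewrite mulr_ge0 // ltW.
have at_ := ltW nt; have aT := le_trans at_ tT.
have ta : t - a <= tau by move: tn; rewrite mulrS mulrDl mul1r -/a; lra.
have ta0 : 0 <= t - a by rewrite subr_ge0.
have ua : u a = v a by apply: IH.
have := stable_increments yb L0 H0 a0 at_ tT TT0 (le_trans ta tau1) (htau _ ta0 ta)
  (hoelder_pathW a0 tT hu) (hoelder_pathW a0 tT hv) su sv (lexx 0) _ (lexx a) at_ (lexx t).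
rewrite ua subrr (cn_norm0 cn) => /(_ (lexx _)); rewrite !mul0r subrBB => h.
have [p1 _] := pu t t0 tT; have [p2 _] := pv t t0 tT.
by apply/eqP; rewrite -subr_eq0; apply/eqP; apply: (cn_sep cn) => //; exact: (cnB cn).
Qed.

Section Existence.
Variables (Q L T : R) (psi : V).
Hypotheses (yb : young_bounds Q L) (L0 : 0 <= L) (T0' : 0 <= T) (TT0 : T <= T0) (T1 : T <= 1).
Hypotheses (gain : gain_const L 1 * T `^ (gamma - lambda) <= 1 / 4).
Hypotheses (psiP : P psi) (psiQ : N psi + 1 <= Q).

Definition path_ball (u : R -> V) : Prop :=
  u 0 = psi /\ (forall t, 0 <= t -> t <= T -> P (u t)) /\
  forall s t, 0 <= s -> s <= t -> t <= T -> N (u t - u s) <= (t - s) `^ lambda.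

Lemma path_ball_hoelder u : path_ball u -> hoelder_path 0 T Q 1 u.
Proof.
move=> [u0 [pu hu]]; split=> [t t0 tT|s t s0 st tT]; last by rewrite mul1r; exact: hu.
have pt := pu t t0 tT; split => //; rewrite -[u t](subrK psi).
apply: le_trans (cn_triangle cn (cnB cn pt psiP) psiP) _.
have := hu 0 t (lexx _) t0 tT; rewrite u0 subr0.
have := powR_le_one t0 (le_trans tT T1) (ltW lambda0); move: psiQ; lra.
Qed.

Let Tsub : T - 0 <= 1. Proof. by rewrite subr0. Qed.

Lemma picard_step u : path_ball u -> exists v, path_ball v /\ sewing_of P N (germ u) T (fun t => v t - psi).
Proof.
move=> hu; have pu := path_ball_hoelder hu.
have hX := germ_almost_additive yb L0 ler01 (lexx 0) TT0 pu.
have [J hJ] := sewing_exists cn young (mulr_ge0 L0 ler01) hX.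
exists (fun t => psi + J t); split; last first.
  by have -> : (fun t => psi + J t - psi) = J by apply/funext => t; rewrite addrC addKr.
split; first by rewrite (sewing0 cn T0' hJ) addr0.
split=> [t t0 tT|s t s0 st tT].
  by apply: (cnD cn) => //; have [] := hJ t ltac:(by rewrite t0).
have -> : psi + J t - (psi + J s) = J t - J s by rewrite opprD addrACA subrr add0r.
have := young_growth yb L0 ler01 (lexx 0) TT0 (lexx T) Tsub pu hJ s0 st tT; rewrite subr0 => h.
apply: le_trans h _; apply: (@le_trans _ _ (1 / 4 * (t - s) `^ lambda)).
  by rewrite ler_wpM2r ?powR_ge0.
by have := powR_ge0 (t - s) lambda; lra.
Qed.

Let near rho (u v : R -> V) := forall s t, 0 <= s -> s <= t -> t <= T ->
  N (u t - u s - (v t - v s)) <= rho * (t - s) `^ lambda.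

Let picard_contract u v u' v' rho : path_ball u -> path_ball v -> 0 <= rho -> near rho u v ->
  sewing_of P N (germ u) T (fun t => u' t - psi) -> sewing_of P N (germ v) T (fun t => v' t - psi) ->
  near (rho / 4) u' v'.
Proof.
move=> hu hv rho0 h su sv s t s0 st tT.
have e0 : N (u 0 - v 0) <= 0 by have [-> _] := hu; have [-> _] := hv; rewrite subrr (cn_norm0 cn).
have := young_stability yb L0 ler01 (lexx 0) TT0 (lexx T) Tsub (path_ball_hoelder hu) (path_ball_hoelder hv)
  su sv rho0 (lexx 0) T0' e0 h s0 st tT.
rewrite !subrBB addr0 subr0 => h'; apply: le_trans h' _; rewrite ler_wpM2r ?powR_ge0 //.
have := ler_wpM2r rho0 gain; lra.
Qed.

(** Picard iterates started at any two paths of the ball merge at the rate [4 ^- n]; those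
    started at the constant path are therefore Cauchy, and their limit is a fixed point. *)
Lemma young_existence : exists u, path_ball u /\ young_solution T psi u.
Proof.
have ball0 : path_ball (fun=> psi).
  by split=> //; split=> // s t *; rewrite subrr (cn_norm0 cn) powR_ge0.
have /choice[G hG] : forall u, exists v, path_ball u -> path_ball v /\ sewing_of P N (germ u) T (fun t => v t - psi).
  move=> u; have [/picard_step[v hv]|nu] := pselect (path_ball u); first by exists v.
  by exists u => /nu.
have bG n u : path_ball u -> path_ball (iter n G u) by move=> hu; elim: n => //= n /hG[].
have near2 u v : path_ball u -> path_ball v -> near 2 u v.
  move=> [_ [pu hu]] [_ [pv hv]] s t s0 st tT; have t0 := le_trans s0 st; have sT := le_trans st tT.
  apply: le_trans (cn_normB cn (cnB cn (pu _ t0 tT) (pu _ s0 sT)) (cnB cn (pv _ t0 tT) (pv _ s0 sT))) _.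
  have := hu s t s0 st tT; have := hv s t s0 st tT; lra.
have contr n u v : path_ball u -> path_ball v -> near (2 / 4 ^+ n) (iter n G u) (iter n G v).
  move=> hu hv; elim: n => [|n IH] /=; first by rewrite expr0 divr1; exact: near2.
  have := picard_contract (bG n u hu) (bG n v hv) _ IH (proj2 (hG _ (bG n u hu))) (proj2 (hG _ (bG n v hv))).
  have -> : 2 / 4 ^+ n / 4 = 2 / 4 ^+ n.+1 :> R by rewrite exprSr invfM mulrA.
  by apply; rewrite divr_ge0 // exprn_ge0.
pose U n := iter n G (fun=> psi).
have bU n : path_ball (U n) by exact: bG.
have UU n i j : (n <= i)%N -> (n <= j)%N -> near (2 / 4 ^+ n) (U i) (U j).
  move=> ni nj; rewrite /U -(subnKC ni) -(subnKC nj) !iterD; apply: contr; exact: bG.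
have U0 n : U n 0 = psi by have [] := bU n.
have pU n t : 0 <= t -> t <= T -> P (U n t) by have [_ [h _]] := bU n; exact: h.
have UUt n i j t : (n <= i)%N -> (n <= j)%N -> 0 <= t -> t <= T -> N (U i t - U j t) <= 2 / 4 ^+ n.
  move=> ni nj t0 tT; have := UU n i j ni nj 0 t (lexx _) t0 tT; rewrite !U0 subrBB subr0 => h.
  apply: le_trans h _; rewrite -[leRHS]mulr1 ler_wpM2l ?divr_ge0 ?exprn_ge0 //.
  exact: powR_le_one t0 (le_trans tT T1) (ltW lambda0).
have /choice[u hu] : forall t, exists l, 0 <= t -> t <= T ->
    P l /\ forall e, 0 < e -> exists n, forall i, (n <= i)%N -> N (U i t - l) <= e.
  move=> t; have [/andP[t0 tT]|nt] := boolP (0 <= t <= T); last by exists 0 => t0 tT; rewrite t0 tT in nt.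
  have [l pl hl] : exists2 l, P l & forall e, 0 < e -> exists n, forall i, (n <= i)%N -> N (U i t - l) <= e.
    apply: (cn_complete cn) => [i|e e0]; first exact: pU.
    have [n hn] := geometric_small (ler0n R 2) e0; exists n => i j ni nj.
    exact: le_trans (UUt n i j t ni nj t0 tT) (hn n (leqnn n)).
  by exists l.
have pu t : 0 <= t -> t <= T -> P (u t) by move=> t0 tT; have [] := hu t t0 tT.
have lim t : 0 <= t -> t <= T -> forall e, 0 < e -> exists n, forall i, (n <= i)%N -> N (U i t - u t) <= e.
  by move=> t0 tT; have [] := hu t t0 tT.
have lim2 s t : 0 <= s -> s <= t -> t <= T -> forall e, 0 < e ->
    exists n, forall i, (n <= i)%N -> N (U i t - U i s - (u t - u s)) <= e.
  move=> s0 st tT e e0; have e2 : 0 < e / 2 by rewrite divr_gt0.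
  have t0 := le_trans s0 st; have sT := le_trans st tT.
  have [n1 h1] := lim s s0 sT _ e2; have [n2 h2] := lim t t0 tT _ e2; exists (maxn n1 n2) => i.
  rewrite geq_max => /andP[i1 i2]; rewrite subrACA.
  apply: le_trans (cn_normB cn (cnB cn (pU i t t0 tT) (pu t t0 tT)) (cnB cn (pU i s s0 sT) (pu s s0 sT))) _.
  have := h1 i i1; have := h2 i i2; lra.
have bu : path_ball u.
  split.
    apply: (cn_eq cn (pu 0 (lexx _) T0') psiP) => e /(lim 0 (lexx _) T0')[n /(_ n (leqnn n))].
    by rewrite U0 (cn_distC cn psiP (pu 0 (lexx _) T0')).

  split=> // s t s0 st tT; have t0 := le_trans s0 st; have sT := le_trans st tT.
  rewrite -[u t - u s]subr0; apply: (cn_lim_le cn (u := fun i => U i t - U i s)) (lim2 s t s0 st tT) _.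
  - by move=> i; apply: (cnB cn); exact: pU.
  - by apply: (cnB cn); exact: pu.
  - exact: (cn0 cn).
  - by exists 0 => i _; rewrite subr0; have [_ [_ h]] := bU i; exact: h.
have uU n : near (2 / 4 ^+ n) u (U n).
  move=> s t s0 st tT; have t0 := le_trans s0 st; have sT := le_trans st tT.
  apply: (cn_lim_le cn (u := fun i => U i t - U i s)) (lim2 s t s0 st tT) _.
  - by move=> i; apply: (cnB cn); exact: pU.
  - by apply: (cnB cn); exact: pu.
  - by apply: (cnB cn); exact: pU.
  - by exists n => i ni; exact: UU.
have [bGu sGu] := hG u bu.
exists u; split => //.
have Gu t : 0 <= t -> t <= T -> G u t = u t.
  move=> t0 tT; have pGu : P (G u t) by have [_ [h _]] := bGu; exact: h.
  apply: (cn_eq cn pGu (pu t t0 tT)) => e e0; have e2 : 0 < e / 2 by rewrite divr_gt0.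
  have [n1 h1] := geometric_small (ler0n R 2) e2; have [n2 h2] := lim t t0 tT _ e2.
  pose n := maxn n1 n2.
  have nn : 0 <= 2 / 4 ^+ n :> R by rewrite divr_ge0 // exprn_ge0.
  have := picard_contract bu (bU n) nn (uU n) sGu (proj2 (hG _ (bU n))) (lexx 0) t0 tT.
  have [-> _] := bGu; have [-> _] := (proj1 (hG _ (bU n))); rewrite subrBB -/(U n.+1) => h.
  have := powR_le_one t0 (le_trans tT T1) (ltW lambda0); rewrite subr0 in h.
  have k1 := h1 n (leq_maxl _ _); have k2 := h2 n.+1 (leq_trans (leq_maxr _ _) (leqnSn _)).
  have := cn_dist cn pGu (pU n.+1 t t0 tT) (pu t t0 tT).
  move=> d p1; apply: le_trans d _.
  have := ler_wpM2l (divr_ge0 nn (ler0n R 4)) p1; rewrite /U /= in k2 h *; lra.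
move=> t ht; have /andP[t0 tT] := ht; have := sGu t ht; rewrite Gu //.
Qed.

End Existence.
End YoungEquation.

(** * The Young equation for the modulated dispersion *)

Section YoungSum.
Variable R : realType.

Lemma small_stepsP (e a : R) r :
  reflect (forall j, (j < size r)%N -> nth 0 (a :: r) j.+1 - nth 0 (a :: r) j <= e) (small_steps e a r).
Proof. exact: (@pathP R (fun x y => y - x <= e) a r 0). Qed.

Lemma mesh_small_steps (e a : R) r : mesh a r < e -> small_steps e a r.
Proof.
move=> h; apply/small_stepsP => j jr; apply: le_trans (ltW h).
exact: (@le_bigmax _ R _ 0 (fun j : 'I_(size r) => nth 0 (a :: r) j.+1 - nth 0 (a :: r) j) (Ordinal jr)).
Qed.

Lemma small_steps_mesh (e a : R) r : 0 <= e -> small_steps e a r -> mesh a r <= e.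
Proof. by move=> e0 /small_stepsP h; apply: bigmax_le => // j _; exact: h. Qed.

Lemma psum_nth (V : zmodType) (Xi : R -> R -> V) (a : R) r :
  psum Xi a r = \sum_(j < size r) Xi (nth 0 (a :: r) j) (nth 0 (a :: r) j.+1).
Proof.
elim: r a => [|x r IH] a; first by rewrite big_ord0.
by rewrite big_ord_recl /= IH.
Qed.

Lemma sum_fcoefs d (I : Type) (r : seq I) (F : I -> fcoefs R d) n :
  (\sum_(i <- r) F i) n = \sum_(i <- r) F i n.
Proof. by elim: r => [|i r IH]; rewrite ?big_nil // !big_cons fct_addE IH. Qed.

Lemma young_sum_psum (d m : nat) (X : R -> ('I_m -> fcoefs R d) -> fcoefs R d) (u : R -> fcoefs R d) r :
  young_sum X (fun=> u) r = psum (germ (fun t v => X t (fun=> v)) u) 0 r.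
Proof.
by apply/funext => n; rewrite psum_nth sum_fcoefs; apply: eq_bigr.
Qed.

End YoungSum.

Lemma Hs_complete_norm (R : realType) (d : nat) (s : R) :
  complete_norm (@in_Hs R d s) (@Hs_norm R d s).
Proof.
split; first by have [] := @Hs_zero R d s.
- by move=> x y; exact: Hs_sub.
- by move=> x; exact: Hs_norm_ge0.
- by move=> x y hx hy; have [] := Hs_add hx hy.
- by move=> x hx; have [] := Hs_opp hx.
- by have [] := @Hs_zero R d s.
- by move=> x; exact: Hs_norm_eq0.
- by move=> u; exact: Hs_complete.
Qed.

Section Translation.
Variables (R : realType) (d k : nat) (s lambda T : R) (w : R -> R).
Hypotheses (T0 : 0 < T).
Notation P := (@in_Hs R d s).
Notation N := (@Hs_norm R d s).
Let Y t (v : fcoefs R d) := @Xext R d k s w t (fun=> v).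

Lemma is_solutionP psi (u : R -> fcoefs R d) : P psi -> (forall t, 0 <= t <= T -> P (u t)) ->
  is_solution k s w T psi u <-> young_solution P N Y T psi u.
Proof.
move=> ppsi pu; have cn := Hs_complete_norm d s; split=> h t ht.
  have [J [pJ hJ] uJ] := h t ht.
  have EJ : J = u t - psi by apply/funext => n; rewrite fct_subE uJ addrC addKr.
  rewrite -EJ; split => // e e0; have [dl d0 hd] := hJ e e0.
  exists (dl / 2) => [|r pr sr]; first by rewrite divr_gt0.
  have mr : mesh 0 r < dl.
    apply: le_lt_trans (small_steps_mesh _ sr) _; first by rewrite divr_ge0 // ltW.
    by rewrite ltr_pdivrMr // mulr_natr mulr2n ltrDl.
  have [] := hd r pr mr; rewrite young_sum_psum => p1 n1; split; last exact: ltW.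
  rewrite -[psum _ _ _](subrK J); exact: (cnD cn).
have [pJ hJ] := h t ht; exists (u t - psi); last by move=> n; rewrite fct_subE addrC subrK.
split=> // e e0; have e2 : 0 < e / 2 by rewrite divr_gt0.
have [dl d0 hd] := hJ _ e2; exists dl => // r pr /mesh_small_steps sr.
have [p1 n1] := hd r pr sr; rewrite young_sum_psum; split; first exact: (cnB cn).
by apply: le_lt_trans n1 _; rewrite ltr_pdivrMr // mulr_natr mulr2n ltrDl.
Qed.

Lemma hoelder_enorm_le (u : R -> fcoefs R d) (A B : R) :
  (forall t, 0 <= t -> t <= T -> N (u t) <= A) ->
  (forall s t, 0 <= s -> s <= t -> t <= T -> N (u t - u s) <= B * (t - s) `^ lambda) ->
  (hoelder_enorm lambda T s u <= (A + B)%:E)%E.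
Proof.
move=> hA hB; rewrite EFinD; apply: leeD; apply: ge_ereal_sup.
  by move=> _ [t /andP[t0 tT] ->]; rewrite lee_fin; exact: hA.
move=> _ [t1 [t2 [t10 t12 t2T ->]]]; rewrite lee_fin.
have -> : `|t2 - t1| = t2 - t1 by rewrite ger0_norm // subr_ge0 ltW.
by rewrite ler_pdivrMr ?powR_gt0 ?subr_gt0 //; apply: hB => //; exact: ltW.
Qed.

Lemma in_hoelder_path (u : R -> fcoefs R d) : in_hoelder lambda T s u ->
  exists Q H, 0 <= H /\ hoelder_path P N lambda 0 T Q H u.
Proof.
move=> [pu fin]; have cn := Hs_complete_norm d s.
have s0 : (0 <= sup_enorm T s u)%E.
  apply: le_trans (ereal_sup_ubound _); last by exists 0 => //; rewrite lexx ltW.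
  by rewrite lee_fin Hs_norm_ge0.
have h0 : (0 <= hoelder_seminorm lambda T s u)%E.
  apply: le_trans (ereal_sup_ubound _); last by exists 0, T; split.
  by rewrite lee_fin divr_ge0 ?Hs_norm_ge0 ?powR_ge0.
have sfin : sup_enorm T s u \is a fin_num.
  by rewrite ge0_fin_numE //; apply: le_lt_trans fin; rewrite leeDl.
have hfin : hoelder_seminorm lambda T s u \is a fin_num.
  by rewrite ge0_fin_numE //; apply: le_lt_trans fin; rewrite leeDr.
exists (fine (sup_enorm T s u)), (fine (hoelder_seminorm lambda T s u)); split; first exact: fine_ge0.
split=> [t t0 tT|t1 t2 t10].
  have ht : 0 <= t <= T by rewrite t0.
  split; first exact: pu.
  by rewrite -lee_fin fineK //; apply: ereal_sup_ubound; exists t.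
rewrite le_eqVlt => /orP[/eqP <- _|t12 t2T].
  by rewrite !subrr (cn_norm0 cn) mulr_ge0 ?powR_ge0 ?fine_ge0.
rewrite -ler_pdivrMr ?powR_gt0 ?subr_gt0 // -lee_fin fineK //; apply: ereal_sup_ubound.
exists t1, t2; split => //; congr (_ / _ `^ _)%:E; by rewrite ger0_norm // subr_ge0 ltW.
Qed.

End Translation.

Lemma Xext_young_bounds (R : realType) (d k : nat) (rho s : R) :
  (0 < d)%N -> (0 < k)%N -> (d, k) <> (1%N, 1%N) -> 0 < rho -> rho <= 1 -> d%:R / 2 - rho / k%:R < s ->
  exists2 C : R, 0 <= C & forall (gamma T0 : R) (w : R -> R) (Q : R),
    0 < T0 -> {within `[0, T0], continuous w} -> irregular rho gamma T0 w -> 1 <= Q ->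
    young_bounds (@in_Hs R d s) (@Hs_norm R d s) gamma T0 (fun t v => @Xext R d k s w t (fun=> v))
      Q (C * irr_norm rho gamma T0 w * Q ^+ (k.*2.+1)).
Proof.
move=> d0 k0 dk rho0 rho1 hs; have [C C0 hC] := Xext_hoelder d0 k0 dk rho0 rho1 hs.
set m := k.*2.+1; have cn := Hs_complete_norm d s.
exists (C * (m ^ 2)%:R); first by rewrite mulr_ge0.
move=> gamma T0 w Q T00 cw irr Q1; have [lin hol] := hC gamma T0 w T00 cw irr.
set M := irr_norm rho gamma T0 w; have M0 : 0 <= M by exact: irr_norm_ge0.
pose B t t' (f : 'I_m -> fcoefs R d) := Xext s w t' f - Xext s w t f.
pose b t t' : R := C * M * (t' - t) `^ gamma.
have b0 t t' : 0 <= b t t' by rewrite !mulr_ge0 ?powR_ge0.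
have bound t t' : 0 <= t -> t <= t' -> t' <= T0 -> forall f, (forall j, in_Hs s (f j)) ->
    in_Hs s (B t t' f) /\ Hs_norm s (B t t' f) <= b t t' * \prod_j Hs_norm s (f j).
  by move=> t0 tt' t'T f hf; have [p1 p2 h] := hol t t' f t0 tt' t'T hf; split => //; exact: (cnB cn).
have sub t t' : 0 <= t -> t <= t' -> t' <= T0 -> slot_subtractive (@in_Hs R d s) (B t t').
  move=> t0 tt' t'T f j x y hf hx hy.
  have X r : 0 <= r <= T0 -> Xext s w r (set_slot f j (x - y)) = Xext s w r (set_slot f j x) - Xext s w r (set_slot f j y).
    move=> hr; apply/funext => n; have := lin r hr f j y x (-1) hf hy hx n.
    have -> : (fun l => -1 * y l + x l) = x - y by apply/funext => l; rewrite fct_subE mulN1r addrC.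
    by rewrite fct_subE => ->; case: (odd j); rewrite ?rmorphN ?rmorph1 mulN1r addrC.
  by rewrite /B !X ?t0 ?(le_trans t0 tt') ?t'T ?(le_trans tt' t'T) // subrACA.
have EL t t' : C * (m ^ 2)%:R * M * Q ^+ m * (t' - t) `^ gamma = b t t' * (m ^ 2)%:R * Q ^+ m.
  by rewrite /b; ring.
split.
- by move=> t v t0 tT pv; have [] := hol t t (fun=> v) t0 (lexx _) tT (fun=> pv).
- move=> t t' v t0 tt' t'T pv nv; rewrite EL.
  by have [] := diag_le cn (b0 t t') Q1 (ltn0Sn _) (bound t t' t0 tt' t'T) pv nv.
- move=> t t' v v' t0 tt' t'T pv pv' nv nv'; rewrite EL.
  exact: (diag_lipschitz cn (sub t t' t0 tt' t'T) (b0 t t') Q1 (ltn0Sn _) (bound t t' t0 tt' t'T)).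
- move=> t t' v1 v2 v1' v2' x y z t0 tt' t'T p1 p2 p1' p2' n1 n2 n1' n2' hx hy hy' hz hz'; rewrite EL.
  exact: (diag_second_difference cn (sub t t' t0 tt' t'T) (b0 t t') Q1 (bound t t' t0 tt' t'T)).
Qed.

Section LocalTheory.
Variables (R : realType) (d k : nat) (s gamma lambda T0 L r T : R) (w : R -> R).
Notation P := (@in_Hs R d s).
Notation N := (@Hs_norm R d s).
Let Y t (v : fcoefs R d) := @Xext R d k s w t (fun=> v).
Hypotheses (lambda0 : 0 < lambda) (lg : lambda < gamma) (young : 1 < gamma + lambda).
Hypothesis yb : forall Q, 1 <= Q -> exists2 L', 0 <= L' & young_bounds P N gamma T0 Y Q L'.
Hypotheses (L0 : 0 <= L) (ybr : young_bounds P N gamma T0 Y (r + 1) L).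
Hypotheses (T00 : 0 < T) (TT0 : T <= T0) (T1 : T <= 1).
Hypothesis gain : gain_const gamma lambda L 1 * T `^ (gamma - lambda) <= 1 / 4.

Let cn : complete_norm P N := Hs_complete_norm d s.

Lemma path_ball_in_hoelder psi u : in_Hs_ball s r psi -> path_ball P N lambda T psi u -> in_hoelder lambda T s u.
Proof.
move=> [ppsi npsi] hu; have q : N psi + 1 <= r + 1 by rewrite lerD2r.
have [h1 h2] := path_ball_hoelder cn lambda0 T1 ppsi q hu.
split=> [t /andP[t0 tT]|]; first by have [] := h1 t t0 tT.
apply: le_lt_trans (ltry (r + 1 + 1)); apply: hoelder_enorm_le h2 => t t0 tT.
by have [] := h1 t t0 tT.
Qed.

Lemma hoelder_pathW_bounds a b Q H Q' H' u : Q <= Q' -> H <= H' ->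
  hoelder_path P N lambda a b Q H u -> hoelder_path P N lambda a b Q' H' u.
Proof.
move=> QQ HH [h1 h2]; split=> [t at_ tb|s' t as_ st tb].
  by have [p n] := h1 t at_ tb; split => //; exact: le_trans QQ.
by apply: le_trans (h2 s' t as_ st tb) _; rewrite ler_wpM2r ?powR_ge0.
Qed.

Lemma local_existence psi : in_Hs_ball s r psi -> exists u,
  [/\ path_ball P N lambda T psi u, young_solution P N Y T psi u & is_unique_solution k s lambda w T psi u].
Proof.
move=> hpsi; have [ppsi npsi] := hpsi.
have q : N psi + 1 <= r + 1 by rewrite lerD2r.
have [u [bu su]] := young_existence cn lambda0 lg young ybr L0 (ltW T00) TT0 T1 gain ppsi q.
exists u; split => //; have hu := path_ball_in_hoelder hpsi bu.
split=> // [|v hv sv t /andP[t0 tT]].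
  by apply/is_solutionP => //; have [] := hu.
have sv' : young_solution P N Y T psi v by apply/is_solutionP => //; have [] := hv.
have [Q1 [H1 [H10 hp1]]] := in_hoelder_path T00 hu.
have [Q2 [H2 [H20 hp2]]] := in_hoelder_path T00 hv.
pose Q := Num.max 1 (Num.max Q1 Q2); pose H := Num.max H1 H2.
have QQ : 1 <= Q by rewrite le_max lexx.
have [L' L'0 yb'] := yb QQ.
have H0 : 0 <= H by rewrite le_max H10.
apply: (young_unique cn lambda0 lg young yb' L'0 H0 (ltW T00) TT0 _ _ sv' su t0 tT).
  by apply: hoelder_pathW_bounds hp2; rewrite !le_max lexx ?orbT.
by apply: hoelder_pathW_bounds hp1; rewrite !le_max lexx ?orbT.
Qed.

Lemma solution_lipschitz psi psi' (u v : R -> fcoefs R d) : in_Hs_ball s r psi -> in_Hs_ball s r psi' ->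
  path_ball P N lambda T psi u -> path_ball P N lambda T psi' v ->
  young_solution P N Y T psi u -> young_solution P N Y T psi' v ->
  (hoelder_enorm lambda T s (fun t => (u t - v t)%R) <= (5 / 3 * N (psi - psi')%R)%:E)%E.
Proof.
move=> [p1 n1] [p2 n2] bu bv su sv; set xi := N _.
have q1 : N psi + 1 <= r + 1 by rewrite lerD2r.
have q2 : N psi' + 1 <= r + 1 by rewrite lerD2r.
have hu := path_ball_hoelder cn lambda0 T1 p1 q1 bu; have hv := path_ball_hoelder cn lambda0 T1 p2 q2 bv.
have xi0 : 0 <= xi by exact: Hs_norm_ge0.
have [[u0 [pu _]] [v0 [pv _]]] := (bu, bv).
have e0 : N (u 0 - v 0) <= xi by rewrite u0 v0.
have Ts : T - 0 <= 1 by rewrite subr0.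
have gain' : gain_const gamma lambda L 1 * (T - 0) `^ (gamma - lambda) <= 1 / 4 by rewrite subr0.
have incr := stable_increments cn lambda0 lg young ybr L0 ler01 (lexx 0) (ltW T00) (lexx T) TT0 Ts gain'
  hu hv su sv xi0 e0.
(* the supremum is at most the initial value plus one increment *)
have -> : 5 / 3 * xi = (xi + xi / 3) + xi / 3 by field.
apply: hoelder_enorm_le => [t t0 tT|a t a0 at_ tT]; last first.
  by rewrite subrACA; exact: incr.
have -> : u t - v t = (psi - psi') + (u t - u 0 - (v t - v 0)).
  by rewrite u0 v0 [u t - psi - _]subrACA [RHS]addrC subrK.
have pt := cnB cn (pu t t0 tT) (pv t t0 tT).
apply: le_trans (cn_triangle cn _ _) _; first exact: (cnB cn).
  by rewrite u0 v0 subrACA; apply: (cnB cn) => //; exact: (cnB cn).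
rewrite -/xi lerD2l; apply: le_trans (incr 0 t (lexx _) t0 tT) _; rewrite subr0.
rewrite -[leRHS]mulr1 ler_wpM2l ?divr_ge0 //.
have <- : 1 `^ lambda = 1 :> R by rewrite powR1.
by apply: ge0_ler_powR; rewrite ?nnegrE ?(ltW lambda0) // (le_trans tT T1).
Qed.

End LocalTheory.

Theorem theorem1p2 (R : realType) (d k : nat) (T0 rho lambda gamma s : R)
    (hd : (0 < d)%N) (hk : (0 < k)%N) (hdk : (d, k) <> (1%N, 1%N))
    (hT0 : 0 < T0)
    (hrho0 : 0 < rho) (hrho1 : rho <= 1)
    (hlambda : 0 < lambda) (hlg : lambda < gamma) (hgamma : gamma <= 1)
    (hyoung : 1 < gamma + lambda)
    (hs : d%:R / 2 - rho / k%:R < s) :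
  (* T depends on the datum and on w only through the two norms *)
  exists T : R -> R -> R,
  forall w : R -> R,
    {within `[0, T0], continuous w} ->
    irregular rho gamma T0 w ->
    let M := irr_norm rho gamma T0 w in
    (forall psi : fcoefs R d, in_Hs s psi ->
       0 < T (Hs_norm s psi) M < T0 /\
       exists u : R -> fcoefs R d,
         is_unique_solution k s lambda w (T (Hs_norm s psi) M) psi u)
    /\
    (forall r : R, 0 < r ->
       0 < T r M < T0 /\
       exists S : fcoefs R d -> R -> fcoefs R d,
         (forall psi, in_Hs_ball s r psi ->
            is_unique_solution k s lambda w (T r M) psi (S psi)) /\
         solmap_continuous s lambda (T r M) r S).
Proof.
have [C C0 hC] := Xext_young_bounds hd hk hdk hrho0 hrho1 hs.
(* a path that starts in the ball of radius [r] and moves by at most [1] stays in the ball of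
   radius [r + 1] *)
pose L r M := C * M * (r + 1) ^+ (k.*2.+1).
have /choice[T hT] : forall p : R * R, exists T, [/\ 0 < T, T < T0, T <= 1 &
    0 <= p.1 -> 0 <= p.2 -> gain_const gamma lambda (L p.1 p.2) 1 * T `^ (gamma - lambda) <= 1 / 4].
  move=> [r M] /=; have [tau /andP[tau0 tau1] htau] :=
    small_time hlg (normr_ge0 (gain_const gamma lambda (L r M) 1)).
  pose T := Num.min tau (T0 / 2); have T_gt0 : 0 < T by rewrite lt_min tau0 divr_gt0.
  exists T; split => //.
  - by rewrite gt_min ltr_pdivrMr // mulr_natr mulr2n ltrDl hT0 orbT.
  - by rewrite ge_min tau1.
  - move=> _ _; apply: le_trans (htau T (ltW T_gt0) ltac:(by rewrite ge_min lexx)).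
    by rewrite ler_wpM2r ?powR_ge0 // ler_norm.
exists (fun r M => T (r, M)) => w cw irr M.
have M0 : 0 <= M by exact: irr_norm_ge0.
have yb Q : 1 <= Q -> exists2 L', 0 <= L' &
    young_bounds (@in_Hs R d s) (@Hs_norm R d s) gamma T0 (fun t v => @Xext R d k s w t (fun=> v)) Q L'.
  move=> Q1; exists (C * M * Q ^+ k.*2.+1); last exact: hC.
  by rewrite !mulr_ge0 // exprn_ge0 // (le_trans ler01).
have ybr r : 0 <= r -> 0 <= L r M /\ young_bounds (@in_Hs R d s) (@Hs_norm R d s) gamma T0
    (fun t v => @Xext R d k s w t (fun=> v)) (r + 1) (L r M).
  move=> r0; have r1 : 1 <= r + 1 by rewrite lerDr.
  split; last exact: hC.
  by rewrite !mulr_ge0 // exprn_ge0 // (le_trans ler01).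
have loc r : 0 <= r -> forall psi, in_Hs_ball s r psi -> exists u,
    [/\ path_ball (@in_Hs R d s) (@Hs_norm R d s) lambda (T (r, M)) psi u,
        young_solution (@in_Hs R d s) (@Hs_norm R d s) (fun t v => @Xext R d k s w t (fun=> v)) (T (r, M)) psi u &
        is_unique_solution k s lambda w (T (r, M)) psi u].
  move=> r0 psi hpsi; have [T_gt0 TT0 T1 gain] := hT (r, M); have [L0 yb'] := ybr r r0.
  exact: (local_existence hlambda hlg hyoung yb L0 yb' T_gt0 (ltW TT0) T1 (gain r0 M0) hpsi).
split=> [psi hpsi|r r0].
  have [T_gt0 TT0 _ _] := hT (Hs_norm s psi, M); split; first by rewrite T_gt0.
  have [u [_ _ hu]] := loc _ (Hs_norm_ge0 s psi) psi (conj hpsi (lexx _)).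
  by exists u.
have [T_gt0 TT0 T1 gain] := hT (r, M); split; first by rewrite T_gt0.
have /choice[S hS] : forall psi : fcoefs R d, exists u, in_Hs_ball s r psi ->
    [/\ path_ball (@in_Hs R d s) (@Hs_norm R d s) lambda (T (r, M)) psi u,
        young_solution (@in_Hs R d s) (@Hs_norm R d s) (fun t v => @Xext R d k s w t (fun=> v)) (T (r, M)) psi u &
        is_unique_solution k s lambda w (T (r, M)) psi u].
  move=> psi; have [/(loc r (ltW r0) psi)[u hu]|n] := pselect (in_Hs_ball s r psi); first by exists u.
  by exists (fun=> psi).
exists S; split=> [psi /hS[] //|psi hpsi e e0].
exists (e / 2) => [|psi' hpsi' near]; first by rewrite divr_gt0.
have [bu su _] := hS psi hpsi; have [bv sv _] := hS psi' hpsi'.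
have [L0 yb'] := ybr r (ltW r0).
have lip := solution_lipschitz hlambda hlg hyoung L0 yb' T_gt0 (ltW TT0) T1 (gain (ltW r0) M0)
  hpsi' hpsi bv bu sv su.
apply: le_lt_trans lip _.
have : Hs_norm s (psi' - psi) < e / 2 by exact: near.
by rewrite lte_fin; have := Hs_norm_ge0 s (psi' - psi); lra.
Qed.
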